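(* Consider the switched linear hyperbolic system described in the context, and assume that $m_i=m$ for all $i\in I$. Assume that there exist $\nu>0$, $\gamma\ge1$, and, for each $i\in I$, $\mu_i\in\mathbb{R}$ and a diagonal positive definite matrix $Q_i=\begin{pmatrix} Q_i^- & 0 \\ 0 & Q_i^+ \end{pmatrix}\in\mathbb{R}^{n\times n}$, where $Q_i^-\in\mathbb{R}^{m\times m}$ and $Q_i^+\in\mathbb{R}^{(n-m)\times(n-m)}$ are diagonal positive definite, such that, with $\mathcal{Q}_i(x)=\mathrm{diag}[e^{2\mu_ix}Q_i^-,e^{-2\mu_ix}Q_i^+]$, for all $i\in I$ and all $x\in[0,1]$, $$-2\mu_i\,\mathcal{Q}_i(x)\Lambda_i^++F_i^\top\mathcal{Q}_i(x)+\mathcal{Q}_i(x)F_i\le-2\nu\,\mathcal{Q}_i(x),$$ $$\begin{pmatrix} I_m & 0_{m,n-m} \\ G_{i+-} & G_{i++} \end{pmatrix}^\top\mathcal{Q}_i(0)\Lambda_i\begin{pmatrix} I_m & 0_{m,n-m} \\ G_{i+-} & G_{i++} \end{pmatrix}\le\begin{pmatrix} G_{i--} & G_{i-+} \\ 0_{n-m,m} & I_{n-m} \end{pmatrix}^\top\mathcal{Q}_i(1)\Lambda_i\begin{pmatrix} G_{i--} & G_{i-+} \\ 0_{n-m,m} & I_{n-m} \end{pmatrix},$$ and, for all $i,j\in I$, $$(S_i^+)^\top Q_i^+S_i^+\le\gamma\,(S_j^+)^\top Q_j^+S_j^+,\qquad(S_i^-)^\top Q_i^-S_i^-\le\gamma\,(S_j^-)^\top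 Q_j^-S_j^-.$$ Let $\Delta_\mu=\max_{i\in I}\mu_i-\min_{i\in I}\mu_i$. Then, for all $N_0\in\mathbb{N}$ and all $\tau_D>\frac{\ln(\gamma)}{2\nu}+\frac{\Delta_\mu}{\nu}$ (with $\tau_D>0$), the switched linear hyperbolic system is globally uniformly exponentially stable (GUES) with respect to the set of switching signals $\mathcal{S}_{\tau_D,N_0}(\mathbb{R}_+,I)$.
   Context: Notation: for symmetric matrices, $A\le B$ means $B-A$ is positive semidefinite; $I_p$, $0_{p,q}$ are identity and zero matrices; $\mathrm{diag}[A,B]$ is block diagonal; blocks of size zero are omitted. Switched system. $I$ is a finite set of modes. For each $i\in I$, $A_i,L_i\in\mathbb{R}^{n\times n}$, and there is an invertible $S_i\in\mathbb{R}^{n\times n}$ with $L_i=S_i^{-1}\Lambda_iS_i$, $\Lambda_i=\mathrm{diag}(\lambda_{i,1},\dots,\lambda_{i,n})$, $\lambda_{i,k}<0$ for $k\in\{1,\dots,m_i\}$ and $\lambda_{i,k}>0$ for $k\in\{m_i+1,\dots,n\}$. Write $S_i=\begin{pmatrix} S_i^- \\ S_i^+ \end{pmatrix}$ with $S_i^-\in\mathbb{R}^{m_i\times n}$, $S_i^+\in\mathbb{R}^{(n-m_i)\times n}$; set $F_i=S_iA_iS_i^{-1}$ and $\Lambda_i^+=\mathrm{diag}(|\lambda_{i,1}|,\dots,|\lambda_{i,n}|)$. Let $G_i=\begin{pmatrix} G_{i--} & G_{i-+} \\ G_{i+-} & G_{i++} \end{pmatrix}\in\mathbb{R}^{n\times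 n}$ with $G_{i--}\in\mathbb{R}^{m_i\times m_i}$ and the other blocks sized accordingly, and $B_i^0=\begin{pmatrix} -G_{i--} & 0_{m_i,n-m_i} \\ -G_{i+-} & I_{n-m_i} \end{pmatrix}S_i$, $B_i^1=\begin{pmatrix} I_{m_i} & -G_{i-+} \\ 0_{n-m_i,m_i} & -G_{i++} \end{pmatrix}S_i$. For a switching signal $\sigma$ the system is $$\partial_tw(t,x)+L_{\sigma(t)}\partial_xw(t,x)=A_{\sigma(t)}w(t,x),\quad B^0_{\sigma(t)}w(t,0)+B^1_{\sigma(t)}w(t,1)=0,\quad w(0,x)=w^0(x),$$ $x\in[0,1]$, $t\ge0$, with $w^0\in L^2((0,1);\mathbb{R}^n)$. Switching signals. A switching signal is a piecewise constant, right-continuous function $\sigma:\mathbb{R}_+\to I$ with finitely many discontinuities (switching times) on every bounded interval; $\mathcal{S}(\mathbb{R}_+,I)$ is the set of them. $N_\sigma(\tau,t)$ is the number of discontinuities of $\sigma$ on $(\tau,t]$. For $\tau_D>0$ (average dwell time) and $N_0\in\mathbb{N}$ (chatter bound), $\mathcal{S}_{\tau_D,N_0}(\mathbb{R}_+,I)$ is the set of switching signals with $N_\sigma(\tau,t)\le N_0+\frac{t-\tau}{\tau_D}$ for all $0\le\tau<t$. Solutions. Let $t_0=0$ and $t_1<t_2<\dots$ be the switching times. A (weak) solution is $w\in C^0(\mathbb{R}_+;L^2((0,1);\mathbb{R}^n))$ with $w(0,\cdot)=w^0$ such that on each interval $[t_k,t_{k+1}]$ (or $[t_k,\infty)$ if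 $t_k$ is the last switching time), with $i$ the value of $\sigma$ on $[t_k,t_{k+1})$, the function $y=S_iw=\begin{pmatrix} y^- \\ y^+ \end{pmatrix}$ ($y^-\in\mathbb{R}^{m_i}$) is a weak solution of $\partial_ty+\Lambda_i\partial_xy=F_iy$, $\begin{pmatrix} y^-(t,1) \\ y^+(t,0) \end{pmatrix}=G_i\begin{pmatrix} y^-(t,0) \\ y^+(t,1) \end{pmatrix}$; i.e. for every $T$ in the interval, $T>t_k$, and every $\varphi\in C^1([t_k,T]\times[0,1];\mathbb{R}^n)$ with $\Lambda_i^+\begin{pmatrix} \varphi^-(t,0) \\ \varphi^+(t,1) \end{pmatrix}=G_i^\top\Lambda_i^+\begin{pmatrix} \varphi^-(t,1) \\ \varphi^+(t,0) \end{pmatrix}$ for $t\in[t_k,T]$, one has $\int_0^1\varphi(T,x)^\top y(T,x)dx-\int_0^1\varphi(t_k,x)^\top y(t_k,x)dx=\int_{t_k}^T\int_0^1(\partial_t\varphi+\Lambda_i\partial_x\varphi+F_i^\top\varphi)^\top y\,dx\,dt$. For every $\sigma\in\mathcal{S}(\mathbb{R}_+,I)$ and $w^0$ a unique solution exists. GUES with respect to $\mathcal{S}\subseteq\mathcal{S}(\mathbb{R}_+,I)$: there exist $\nu>0$, $C>0$ such that for every $w^0\in L^2((0,1);\mathbb{R}^n)$ and every $\sigma\in\mathcal{S}$ the solution satisfies $\|w(t,\cdot)\|_{L^2((0,1);\mathbb{R}^n)}\le Ce^{-\nu t}\|w^0\|_{L^2((0,1);\mathbb{R}^n)}$ for all $t\ge0$.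 *)

(* Defs.v *)
From HB Require Import structures.
From mathcomp Require Import all_boot all_order all_algebra.
From mathcomp Require Import finmap.
From mathcomp Require Import all_classical all_reals all_analysis.

Set Implicit Arguments.
Unset Strict Implicit.
Unset Printing Implicit Defensive.

Import Order.TTheory GRing.Theory Num.Theory.
Import numFieldNormedType.Exports.

Local Open Scope classical_set_scope.
Local Open Scope ring_scope.

Definition dotv (R : realType) (n : nat) (u v : 'cV[R]_n) : R :=
  (u^T *m v) 0 0.

Definition possemidefmx (R : realType) (n : nat) (M : 'M[R]_n) : Prop :=
  M^T = M /\ forall v : 'cV[R]_n, 0 <= dotv v (M *m v).

Definition posdefmx (R : realType) (n : nat) (M : 'M[R]_n) : Prop :=
  M^T = M /\ forall v : 'cV[R]_n, v != 0 -> 0 < dotv v (M *m v).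

Definition loewner_le (R : realType) (n : nat) (A B : 'M[R]_n) : Prop :=
  possemidefmx (B - A).

(* [max_i mu i - min_i mu i]; a value of the family serves as the initial     *)
(* value of the iterated max and min, and 0 is returned when I is empty.      *)
Definition max_sub_min (R : realType) (I : finType) (mu : I -> R) : R :=
  if [pick i : I] is Some i0 then
    \big[Num.max/mu i0]_(i : I) mu i - \big[Num.min/mu i0]_(i : I) mu i
  else 0.

(* Elements of L^2((0,1); R^n) are represented by functions on R of which     *)
(* only the restriction to ]0, 1[ matters. The norm uses the Euclidean norm   *)
(* of R^n, not the sup norm that the library puts on matrices.                *)
Definition in_L2 (R : realType) (n : nat) (f : R -> 'cV[R]_n) : Prop :=
  forall k : 'I_n,
    measurable_fun `]0 : R, 1[ (fun x => f x k 0) /\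
    (@lebesgue_measure R).-integrable `]0 : R, 1[ (fun x => ((f x k 0) ^+ 2)%:E).

Definition L2norm (R : realType) (n : nat) (f : R -> 'cV[R]_n) : R :=
  Num.sqrt (\int[@lebesgue_measure R]_(x in `]0, 1[) dotv (f x) (f x)).

(* Every mode has m negative and p positive characteristic speeds; the state  *)
(* dimension is written n = m + p so that block operations need no casts.     *)
Record switched_system (R : realType) (I : finType) (m p : nat) :=
  SwitchedSystem {
    sysA : I -> 'M[R]_(m + p);
    sysL : I -> 'M[R]_(m + p);
    sysS : I -> 'M[R]_(m + p);
    speed : I -> 'rV[R]_(m + p);
    sysG : I -> 'M[R]_(m + p);
    sysS_unit : forall i, sysS i \in unitmx;
    sysL_diag : forall i,
      sysL i = invmx (sysS i) *m diag_mx (speed i) *m sysS i;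
    speed_neg : forall i (k : 'I_m), speed i 0 (lshift p k) < 0;
    speed_pos : forall i (k : 'I_p), 0 < speed i 0 (rshift m k)
  }.

Definition Lam (R : realType) (I : finType) (m p : nat)
    (sys : switched_system R I m p) (i : I) : 'M[R]_(m + p) :=
  diag_mx (speed sys i).

Definition Lamp (R : realType) (I : finType) (m p : nat)
    (sys : switched_system R I m p) (i : I) : 'M[R]_(m + p) :=
  diag_mx (\row_k `|speed sys i 0 k|).

Definition sysF (R : realType) (I : finType) (m p : nat)
    (sys : switched_system R I m p) (i : I) : 'M[R]_(m + p) :=
  sysS sys i *m sysA sys i *m invmx (sysS sys i).

Definition Sm (R : realType) (I : finType) (m p : nat)
    (sys : switched_system R I m p) (i : I) : 'M[R]_(m, m + p) :=
  usubmx (sysS sys i).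

Definition Sp (R : realType) (I : finType) (m p : nat)
    (sys : switched_system R I m p) (i : I) : 'M[R]_(p, m + p) :=
  dsubmx (sysS sys i).

Definition Gmm (R : realType) (I : finType) (m p : nat)
    (sys : switched_system R I m p) (i : I) : 'M[R]_m := ulsubmx (sysG sys i).

Definition Gmp (R : realType) (I : finType) (m p : nat)
    (sys : switched_system R I m p) (i : I) : 'M[R]_(m, p) :=
  ursubmx (sysG sys i).

Definition Gpm (R : realType) (I : finType) (m p : nat)
    (sys : switched_system R I m p) (i : I) : 'M[R]_(p, m) :=
  dlsubmx (sysG sys i).

Definition Gpp (R : realType) (I : finType) (m p : nat)
    (sys : switched_system R I m p) (i : I) : 'M[R]_p := drsubmx (sysG sys i).

Definition B0 (R : realType) (I : finType) (m p : nat)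
    (sys : switched_system R I m p) (i : I) : 'M[R]_(m + p) :=
  block_mx (- Gmm sys i) 0 (- Gpm sys i) 1%:M *m sysS sys i.

Definition B1 (R : realType) (I : finType) (m p : nat)
    (sys : switched_system R I m p) (i : I) : 'M[R]_(m + p) :=
  block_mx 1%:M (- Gmp sys i) 0 (- Gpp sys i) *m sysS sys i.

(* The boundary condition B0 w(t,0) + B1 w(t,1) = 0, written in the           *)
(* characteristic variable y = S w; the weak formulation below uses this form.*)
Lemma boundary_conditionP (R : realType) (I : finType) (m p : nat)
    (sys : switched_system R I m p) (i : I) (w0 w1 : 'cV[R]_(m + p)) :
  B0 sys i *m w0 + B1 sys i *m w1 = 0 <->
  col_mx (usubmx (sysS sys i *m w1)) (dsubmx (sysS sys i *m w0)) =
  sysG sys i *m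
    col_mx (usubmx (sysS sys i *m w0)) (dsubmx (sysS sys i *m w1)).
Proof.
rewrite /B0 /B1 -!mulmxA.
move: (sysS sys i *m w0) (sysS sys i *m w1) => y0 y1.
rewrite -{1}(vsubmxK y0) -{1}(vsubmxK y1) -(submxK (sysG sys i)).
rewrite /Gmm /Gmp /Gpm /Gpp !mul_block_col add_col_mx -col_mx0.
rewrite !mul0mx !mul1mx !mulNmx addr0 add0r.
have E (V : zmodType) (g h u : V) : (- g + u - h = 0) <-> (u = g + h).
  by rewrite -addrA addrC -addrA -opprD (addrC h); split=> [/subr0_eq|->];
    rewrite ?subrr.
by rewrite addrA; split=> /eq_col_mx[hu hd]; congr col_mx; exact/E.
Qed.

(* A signal is a function on R of which only the restriction to [0, +oo[      *)
(* matters, and I carries the discrete topology: continuity at t means being  *)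
(* constant near t in [0, +oo[.                                               *)
Definition switching_times (R : realType) (I : finType) (sigma : R -> I) :
    set R :=
  [set t : R | 0 <= t /\
           ~ (\forall s \near within `[0 : R, +oo[ (nbhs t), sigma s = sigma t)].

(* Finitely many discontinuities on bounded intervals make sigma constant on  *)
(* the intervals between consecutive ones, i.e. piecewise constant.           *)
Definition switching_signal (R : realType) (I : finType) (sigma : R -> I) :
    Prop :=
  (forall t : R, 0 <= t -> \forall s \near t^'+, sigma s = sigma t) /\
  (forall T : R, finite_set (switching_times sigma `&` `[0, T])).

Definition nb_switch (R : realType) (I : finType) (sigma : R -> I)
    (tau t : R) : nat :=
  #|` fset_set (switching_times sigma `&` `]tau, t])|%fset.

Definition dwell_signals (R : realType) (I : finType) (tauD : R) (N0 : nat) :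
    set (R -> I) :=
  [set sigma | switching_signal sigma /\
    forall tau t : R, 0 <= tau -> tau < t ->
      (nb_switch sigma tau t)%:R <= N0%:R + (t - tau) / tauD].

(* phi is of class C^1 on [a, b] x [0, 1] with partial derivatives phit and   *)
(* phix: these are the derivatives in the open rectangle, and phi, phit, phix *)
(* are continuous up to the boundary.                                         *)
Definition C1_rect (R : realType) (n : nat) (a b : R)
    (phi phit phix : R -> R -> 'cV[R]_n) : Prop :=
  forall k : 'I_n,
    [/\ {within `[a, b] `*` `[0, 1],
          continuous (fun z : R * R => phi z.1 z.2 k 0)},
        {within `[a, b] `*` `[0, 1],
          continuous (fun z : R * R => phit z.1 z.2 k 0)},
        {within `[a, b] `*` `[0, 1],
          continuous (fun z : R * R => phix z.1 z.2 k 0)} &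
        forall t x : R, a < t < b -> 0 < x < 1 ->
          is_derive t 1 (fun s : R => phi s x k 0) (phit t x k 0) /\
          is_derive x 1 (fun z : R => phi t z k 0) (phix t x k 0)].

(* Weak formulation on [a, T] of                                              *)
(*   d_t y + Lambda_i d_x y = F_i y,                                          *)
(*   (y^-(t,1), y^+(t,0)) = G_i (y^-(t,0), y^+(t,1)).                         *)
(* For y continuous in time with values in L^2, the inner integral is a       *)
(* continuous function of t, so that the iterated integral is meaningful.     *)
Definition weak_identity (R : realType) (I : finType) (m p : nat)
    (sys : switched_system R I m p) (i : I) (a T : R)
    (y : R -> R -> 'cV[R]_(m + p)) : Prop :=
  forall phi phit phix : R -> R -> 'cV[R]_(m + p),
    C1_rect a T phi phit phix ->
    (forall t : R, a <= t <= T ->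
      Lamp sys i *m col_mx (usubmx (phi t 0)) (dsubmx (phi t 1)) =
      (sysG sys i)^T *m Lamp sys i *m
        col_mx (usubmx (phi t 1)) (dsubmx (phi t 0))) ->
    \int[@lebesgue_measure R]_(x in `]0, 1[) dotv (phi T x) (y T x) -
    \int[@lebesgue_measure R]_(x in `]0, 1[) dotv (phi a x) (y a x) =
    \int[@lebesgue_measure R]_(t in `[a, T])
      \int[@lebesgue_measure R]_(x in `]0, 1[)
        dotv (phit t x + Lam sys i *m phix t x + (sysF sys i)^T *m phi t x)
             (y t x).

(* C^0([0, +oo[; L^2((0,1); R^n)) *)
Definition C0_L2 (R : realType) (n : nat) (w : R -> R -> 'cV[R]_n) : Prop :=
  (forall t : R, 0 <= t -> in_L2 (w t)) /\
  (forall t : R, 0 <= t ->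
    L2norm (fun x => w s x - w t x) @[s --> within `[0 : R, +oo[ (nbhs t)] --> 0).

(* In the last clause a is a t_k (0 or a switching time) and T > t_k is such  *)
(* that no switching time lies in ]t_k, T[, i.e. T <= t_{k+1} if t_{k+1}      *)
(* exists.                                                                    *)
Definition weak_solution (R : realType) (I : finType) (m p : nat)
    (sys : switched_system R I m p) (sigma : R -> I)
    (w0 : R -> 'cV[R]_(m + p)) (w : R -> R -> 'cV[R]_(m + p)) : Prop :=
  [/\ C0_L2 w,
      {ae @lebesgue_measure R, forall x, `]0, 1[%classic x -> w 0 x = w0 x} &
      forall a T : R, a = 0 \/ switching_times sigma a -> a < T ->
        (forall s : R, a < s < T -> ~ switching_times sigma s) ->
        weak_identity sys (sigma a) a T
          (fun t x => sysS sys (sigma a) *m w t x)].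

Definition GUES (R : realType) (I : finType) (m p : nat)
    (sys : switched_system R I m p) (signals : set (R -> I)) : Prop :=
  exists nu C : R, [/\ 0 < nu, 0 < C &
    forall (w0 : R -> 'cV[R]_(m + p)) (sigma : R -> I)
        (w : R -> R -> 'cV[R]_(m + p)),
      in_L2 w0 -> signals sigma -> weak_solution sys sigma w0 w ->
      forall t : R, 0 <= t ->
        L2norm (w t) <= C * expR (- nu * t) * L2norm w0].

Definition weight (R : realType) (m p : nat) (mu : R) (Qm : 'M[R]_m)
    (Qp : 'M[R]_p) (x : R) : 'M[R]_(m + p) :=
  block_mx (expR (2 * mu * x) *: Qm) 0 0 (expR (- (2 * mu * x)) *: Qp).

Definition bdry0 (R : realType) (I : finType) (m p : nat)
    (sys : switched_system R I m p) (i : I) : 'M[R]_(m + p) :=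
  block_mx 1%:M 0 (Gpm sys i) (Gpp sys i).

Definition bdry1 (R : realType) (I : finType) (m p : nat)
    (sys : switched_system R I m p) (i : I) : 'M[R]_(m + p) :=
  block_mx (Gmm sys i) (Gmp sys i) 0 1%:M.

(* Main.v *)
(* On an interval without switching, a weak solution y has no traces at
   x = 0, 1, so its energy cannot be differentiated directly.  Its time integral
   v(t) = \int_t^{t+h} y(s) ds is more regular: the weak formulation, tested
   against primitives, shows that
     \Lambda v_x = F v - (y(t+h) - y(t)),
   so v is absolutely continuous in x, and affine test functions show that v
   satisfies the boundary condition.  Integrating by parts the weighted energy
   E(t) = \int v^T Q(x) v dx, the two matrix inequalities give
   E' <= -2 \nu E.  As h tends to 0, the energy of y itself decays like
   e^{-2 \nu t}.  Comparing the weights on [0, 1], a switch multiplies the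
   energy by at most K = \gamma e^{2 \Delta_\mu}.  The energy at time t is thus
   at most K^N e^{-2 \nu t} times the initial one, N being the number of
   switches, and the average dwell time bounds N by N_0 + t / \tau_D; the
   assumption on \tau_D says that ln K / \tau_D < 2 \nu. *)
Require Import Defs.
From HB Require Import structures.
From mathcomp Require Import all_boot all_order all_algebra.
From mathcomp Require Import finmap.
From mathcomp Require Import all_classical all_reals all_analysis.
From mathcomp Require Import measurable_realfun.
From mathcomp Require Import ring lra.

Set Implicit Arguments.
Unset Strict Implicit.
Unset Printing Implicit Defensive.

Import Order.TTheory GRing.Theory Num.Theory.
Import numFieldNormedType.Exports.

Local Open Scope classical_set_scope.
Local Open Scope ring_scope.

(** * Square-integrable functions on (0,1) *)

Section SquareIntegrable.
Context {R : realType}.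
Notation mu := (@lebesgue_measure R).
Notation D := (`]0 : R, 1[%classic).
Implicit Types f g h : R -> R.

(** The average is therefore handled through the numbers \int <r, y_k(s)> ds and through the time
    integrals of [prim (y s) x], which is continuous in [s] and in [x]; an argument of du
    Bois-Reymond type then yields a genuine function [v] representing these pairings. The time
    derivative of [v] is a mere L^2 increment, so the energy E of [v] is differentiated by
    polarisation, with a remainder quadratic in the increment of time. Letting h tend to 0 needs no
    convergence of v/h to y: for continuous psi, 2 h <psi, v> - h^2 <psi, psi> bounds E from below,
    and E <= h \int <y, y> bounds it from above. The exponent of the weight has the sign opposite to
    that of the speed, so that differentiating the weight in x produces exactly the term -2 mu Q
    |Lambda| of the matrix inequality. *)

Definition sqint f : Prop :=
  measurable_fun D f /\ mu.-integrable D (fun x => ((f x) ^+ 2)%:E).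

Definition ip f g : R := \int[mu]_(x in D) (f x * g x).

Let mD : measurable (D : set (measurableTypeR R)).
Proof. exact: measurable_itv. Qed.

Let muD : mu (D : set (measurableTypeR R)) = 1%E.
Proof. by rewrite lebesgue_measure_itv/= lte_fin ltr01 oppr0 adde0. Qed.

Lemma sqint_integrableM f g : sqint f -> sqint g ->
  mu.-integrable D (EFin \o (fun x => f x * g x)).
Proof.
move=> [mf if2] [mg ig2].
apply: (@le_integrable _ _ _ mu D mD _ (fun x => ((f x)^+2 + (g x)^+2)%:E)).
- by apply/measurable_EFinP; exact: measurable_funM.
- move=> x Dx /=; rewrite lee_fin [leRHS]ger0_norm ?addr_ge0 ?sqr_ge0//.
  rewrite normrM -(real_normK (num_real (f x))) -(real_normK (num_real (g x))).
  set u := `|f x|; set v := `|g x|.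
  by have := sqr_ge0 (u - v); have := sqr_ge0 u; have := sqr_ge0 v; nra.
- have := integrableD mD if2 ig2.
  by apply: eq_integrable => // x _; rewrite /= EFinD.
Qed.

Lemma sqint_bounded f (M : R) : measurable_fun D f ->
  (forall x, D x -> `|f x| <= M) -> sqint f.
Proof.
move=> mf fM; split => //.
apply: (@le_integrable _ _ _ mu D mD _ (fun=> (M ^+ 2)%:E)).
- by apply/measurable_EFinP; exact: measurable_funX.
- move=> x Dx /=; rewrite lee_fin !ger0_norm ?sqr_ge0//.
  rewrite -(real_normK (num_real (f x))).
  by rewrite lerXn2r ?nnegrE ?(le_trans _ (fM x Dx)) ?fM.
- apply: measurable_bounded_integrable => //.
    exact: (eq_ind_r (fun z => (z < +oo)%E) (ltry _) muD).
  by exists (M ^+ 2); split; [exact: num_real|move=> N MN x _; rewrite ger0_norm ?sqr_ge0 ?ltW].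
Qed.

Lemma continuous_bounded_itv f : continuous f ->
  exists2 M : R, 0 < M & forall x, D x -> `|f x| <= M.
Proof.
move=> cf.
have [M [_ HM]] : bounded_set (f @` `[0, 1]).
  apply: compact_bounded; apply: continuous_compact.
    exact: continuous_subspaceT.
  exact: segment_compact.
exists (`|M| + 1); first by rewrite ltr_wpDl.
move=> x; rewrite /= in_itv/= => /andP[x0 x1]; apply: (HM (`|M| + 1)).
  by rewrite (le_lt_trans (ler_norm _))// ltrDl.
by exists x => //; rewrite /= in_itv/= !ltW.
Qed.

Lemma sqint_continuous f : continuous f -> sqint f.
Proof.
move=> cf; have [M _ fM] := continuous_bounded_itv cf.
apply: (sqint_bounded _ fM).
by apply: measurable_funS (continuous_measurable_fun cf).
Qed.

Lemma sqint_cst (c : R) : sqint (fun=> c).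
Proof. by apply: sqint_continuous => x; exact: cvg_cst. Qed.

Lemma sqintD f g : sqint f -> sqint g -> sqint (fun x => f x + g x).
Proof.
move=> Lf Lg; have [mf if2] := Lf; have [mg ig2] := Lg; split.
  exact: measurable_funD.
have -> : (fun x => ((f x + g x) ^+ 2)%:E) =
  (fun x => ((f x)^+2)%:E + ((2 * (f x * g x))%:E + ((g x)^+2)%:E))%E.
  by apply/funext => x; rewrite -!EFinD; congr (_%:E); ring.
apply: integrableD => //; apply: integrableD => //.
have := integrableZl mD 2 (sqint_integrableM Lf Lg).
by apply: eq_integrable => // x _; rewrite /= EFinM.
Qed.

Lemma sqintZ (c : R) f : sqint f -> sqint (fun x => c * f x).
Proof.
move=> [mf if2]; split; first exact: measurable_funM.
have -> : (fun x => ((c * f x) ^+ 2)%:E) = (fun x => (c ^+ 2)%:E * ((f x)^+2)%:E)%E.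
  by apply/funext => x; rewrite exprMn EFinM.
exact: integrableZl.
Qed.

Lemma sqintB f g : sqint f -> sqint g -> sqint (fun x => f x - g x).
Proof.
move=> Lf /(sqintZ (-1)) Lg; have := sqintD Lf Lg.
by under eq_fun do rewrite mulN1r.
Qed.

Lemma sqint_sum (J : Type) (s : seq J) (F : J -> R -> R) :
  (forall j, sqint (F j)) -> sqint (fun x => \sum_(j <- s) F j x).
Proof.
move=> LF; elim: s => [|j s IH].
  by under eq_fun do rewrite big_nil; exact: sqint_cst.
by under eq_fun do rewrite big_cons; exact: sqintD.
Qed.

Lemma sqintM_bounded (q f : R -> R) (M : R) : measurable_fun D q ->
  (forall x, D x -> `|q x| <= M) -> sqint f -> sqint (fun x => q x * f x).
Proof.
move=> mq qM [mf if2].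
split; first exact: measurable_funM.
apply: (@le_integrable _ _ _ mu D mD _ (fun x => ((M ^+ 2)%:E * ((f x)^+2)%:E)%E)).
- by apply/measurable_EFinP; apply: measurable_funX; exact: measurable_funM.
- move=> x Dx /=; rewrite lee_fin exprMn (ger0_norm (mulr_ge0 (sqr_ge0 _) (sqr_ge0 _))) (ger0_norm (mulr_ge0 (sqr_ge0 _) (sqr_ge0 _))).
  rewrite ler_wpM2r ?sqr_ge0// -(real_normK (num_real (q x))).
  by rewrite lerXn2r ?nnegrE ?(le_trans _ (qM x Dx))// qM.
- exact: integrableZl.
Qed.

Lemma sqintM_continuous (q f : R -> R) : continuous q -> sqint f ->
  sqint (fun x => q x * f x).
Proof.
move=> cq Lf; have [M M0 qM] := continuous_bounded_itv cq.
apply: (sqintM_bounded _ qM) => //.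
by apply: measurable_funS (continuous_measurable_fun cq).
Qed.

Lemma eq_ip f g f' g' : (forall x, 0 < x < 1 -> f x * g x = f' x * g' x) ->
  ip f g = ip f' g'.
Proof.
by move=> E; apply: eq_Rintegral => x; rewrite inE/= in_itv/=; exact: E.
Qed.

Lemma ipC f g : ip f g = ip g f.
Proof. by apply: eq_ip => x _; rewrite mulrC. Qed.

Lemma ipDr f g h : sqint f -> sqint g -> sqint h ->
  ip f (fun x => g x + h x) = ip f g + ip f h.
Proof.
move=> Lf Lg Lh; rewrite /ip -RintegralD//; try exact: sqint_integrableM.
by apply: eq_Rintegral => x _; rewrite mulrDr.
Qed.

Lemma ipZr (c : R) f g : sqint f -> sqint g ->
  ip f (fun x => c * g x) = c * ip f g.
Proof.
move=> Lf Lg; rewrite /ip -RintegralZl//; last exact: sqint_integrableM.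
by apply: eq_Rintegral => x _; rewrite mulrCA.
Qed.

Lemma ipBr f g h : sqint f -> sqint g -> sqint h ->
  ip f (fun x => g x - h x) = ip f g - ip f h.
Proof.
move=> Lf Lg Lh; rewrite /ip -RintegralB//; try exact: sqint_integrableM.
by apply: eq_Rintegral => x _; rewrite mulrBr.
Qed.

Lemma ip_sumr (J : Type) (s : seq J) (F : J -> R -> R) f :
  sqint f -> (forall j, sqint (F j)) ->
  ip f (fun x => \sum_(j <- s) F j x) = \sum_(j <- s) ip f (F j).
Proof.
move=> Lf LF; elim: s => [|j s IH].
  rewrite big_nil /ip; under eq_Rintegral do rewrite big_nil mulr0.
  by rewrite Rintegral_cst ?mul0r.
rewrite big_cons -IH -ipDr//; last exact: sqint_sum.
by apply: eq_ip => x _; rewrite big_cons.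
Qed.

Lemma ipDl f g h : sqint f -> sqint g -> sqint h ->
  ip (fun x => g x + h x) f = ip g f + ip h f.
Proof. by move=> *; rewrite ipC ipDr// !(ipC f). Qed.

Lemma ipBl f g h : sqint f -> sqint g -> sqint h ->
  ip (fun x => g x - h x) f = ip g f - ip h f.
Proof. by move=> *; rewrite ipC ipBr// !(ipC f). Qed.

Lemma ipZl (c : R) f g : sqint f -> sqint g ->
  ip (fun x => c * g x) f = c * ip g f.
Proof. by move=> *; rewrite ipC ipZr// (ipC f). Qed.

Lemma ip_suml (J : Type) (s : seq J) (F : J -> R -> R) f :
  sqint f -> (forall j, sqint (F j)) ->
  ip (fun x => \sum_(j <- s) F j x) f = \sum_(j <- s) ip (F j) f.
Proof.
by move=> *; rewrite ipC ip_sumr//; apply: eq_bigr => j _; rewrite ipC.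
Qed.

Lemma ip_cst (c d : R) : ip (fun=> c) (fun=> d) = c * d.
Proof. by rewrite /ip Rintegral_cst// [X in _ * fine X](_ : _ = 1%E) ?mulr1. Qed.

Lemma ip_ge0 f : 0 <= ip f f.
Proof. by apply: Rintegral_ge0 => x _; rewrite -expr2 sqr_ge0. Qed.

Lemma le_ip f g f' g' : sqint f -> sqint g -> sqint f' -> sqint g' ->
  (forall x, 0 < x < 1 -> f x * g x <= f' x * g' x) -> ip f g <= ip f' g'.
Proof.
move=> Lf Lg Lf' Lg' H.
apply: le_Rintegral (sqint_integrableM Lf Lg) (sqint_integrableM Lf' Lg') _.
  exact: mD.
by move=> x; rewrite /= in_itv/=; exact: H.
Qed.

Lemma ip_sqrD f g : sqint f -> sqint g ->
  ip (fun x => f x + g x) (fun x => f x + g x) = ip f f + 2 * ip f g + ip g g.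
Proof.
move=> Lf Lg; have Lfg := sqintD Lf Lg.
by rewrite ipDr// !ipDl// (ipC g f); ring.
Qed.

Lemma ip_sqrB f g : sqint f -> sqint g ->
  ip (fun x => f x - g x) (fun x => f x - g x) = ip f f - 2 * ip f g + ip g g.
Proof.
move=> Lf Lg; have Lfg := sqintB Lf Lg.
by rewrite ipBr// !ipBl// (ipC g f); ring.
Qed.

Lemma ip_sqrD_le f g : sqint f -> sqint g ->
  ip (fun x => f x + g x) (fun x => f x + g x) <= 2 * ip f f + 2 * ip g g.
Proof.
move=> Lf Lg; rewrite ip_sqrD//.
by have := ip_ge0 (fun x => f x - g x); rewrite ip_sqrB//; lra.
Qed.

Lemma ip_CS f g : sqint f -> sqint g -> (ip f g) ^+ 2 <= ip f f * ip g g.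
Proof.
move=> Lf Lg.
have H (t : R) : 0 <= ip f f + 2 * t * ip f g + t ^+ 2 * ip g g.
  have := ip_ge0 (fun x => f x + t * g x).
  have Ltg := sqintZ t Lg.
  by rewrite ip_sqrD// !ipZr// ipZl//; lra.
(* The minimiser of the quadratic in [H]. In the case [ip g g = 0] this instance is dropped. *)
have := H (- (ip f g / ip g g)); have gg := ip_ge0 g; have ff := ip_ge0 f.
have [g0|g0] := eqVneq (ip g g) 0.
  move=> _; rewrite g0 mulr0; have [->|fg] := eqVneq (ip f g) 0.
    by rewrite expr0n.
  (* The quadratic is now affine in [t], and this argument gives it the value -1. *)
  have := H (- ((ip f f + 1) / (2 * ip f g))); rewrite g0 mulr0 addr0.
  have -> : 2 * - ((ip f f + 1) / (2 * ip f g)) * ip f g = - (ip f f + 1).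
    by field.
  lra.
have gpos : 0 < ip g g by rewrite lt_def g0.
have -> : ip f f + 2 * - (ip f g / ip g g) * ip f g +
  (- (ip f g / ip g g)) ^+ 2 * ip g g = ip f f - (ip f g)^+2 / ip g g by field.
by rewrite subr_ge0 ler_pdivrMr.
Qed.

Lemma norm_ip_le f g : sqint f -> sqint g ->
  `|ip f g| <= Num.sqrt (ip f f) * Num.sqrt (ip g g).
Proof.
move=> Lf Lg; rewrite -sqrtrM ?ip_ge0// -sqrtr_sqr ler_wsqrtr//.
exact: ip_CS.
Qed.

End SquareIntegrable.

(** * Primitives *)

Section Primitive.
Context {R : realType}.
Notation mu := (@lebesgue_measure R).
Notation D := (`]0 : R, 1[%classic).
Implicit Types f g h : R -> R.

Lemma lipschitz_continuous_comp (c : R -> R) g :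
  (forall a b : R, `|c a - c b| <= `|a - b|) -> continuous g ->
  continuous (fun x => c (g x)).
Proof.
move=> cl cg x; apply/cvgrPdist_le => e e0; near=> y.
rewrite (le_trans (cl _ _))//; near: y.
by move/cvgrPdist_le : (cg x); apply.
Unshelve. all: by end_near. Qed.

(** Used in two ways: on values, to truncate a function ([clip]), and on times, to freeze a curve
    outside an interval. *)
Definition clamp (lo hi a : R) : R := Num.max lo (Num.min hi a).

Lemma clamp_lipschitz (lo hi a b : R) :
  `|clamp lo hi a - clamp lo hi b| <= `|a - b|.
Proof.
rewrite /clamp /Order.min; case: (ltP hi a) => ?; case: (ltP hi b) => ?;
rewrite /Order.max; do ?[case: (ltP lo _) => ?]; have [H|H] := ger0P (a - b);
by rewrite ?ler_norml; lra.
Qed.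

Lemma clamp_itv (lo hi a : R) : lo <= hi -> lo <= clamp lo hi a <= hi.
Proof.
move=> lohi; rewrite /clamp /Order.min; case: (ltP hi a) => ?;
by rewrite /Order.max; case: ltP => ?; lra.
Qed.

Lemma clamp_id (lo hi a : R) : lo <= a <= hi -> clamp lo hi a = a.
Proof.
rewrite /clamp /Order.min => ?; case: (ltP hi a) => ?;
by rewrite /Order.max; case: ltP => ?; lra.
Qed.

Definition clip (M : R) : R -> R := clamp (- M) M.

Lemma clip_bound (M a : R) : 0 <= M -> `|clip M a| <= M.
Proof. by move=> M0; rewrite ler_norml clamp_itv//; lra. Qed.

Lemma clip_id (M a : R) : `|a| <= M -> clip M a = a.
Proof. by rewrite ler_norml; exact: clamp_id. Qed.

Lemma clip_le (M a : R) : 0 <= M -> `|a - clip M a| <= `|a|.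
Proof.
move=> M0; rewrite /clip /clamp /Order.min; case: (ltP M a) => ?;
rewrite /Order.max; case: ltP => ?; have [H|H] := ger0P a;
by rewrite ler_norml; lra.
Qed.

Lemma measurable_clip (M : R) f : measurable_fun D f -> measurable_fun D (fun x => clip M (f x)).
Proof.
move=> mf; rewrite /clip /clamp.
apply: measurable_maxr => //; apply: measurable_minr => //.
Qed.

(** Dominated convergence: at each point the truncation error is eventually zero, and its square is
    at most [f x ^+ 2]. *)
Lemma sqint_clip_approx f (e : R) : sqint f -> 0 < e ->
  exists2 M : R, 0 < M &
    ip (fun x => f x - clip M (f x)) (fun x => f x - clip M (f x)) < e.
Proof.
move=> Lf e0; have [mf if2] := Lf.
pose F n x := ((f x - clip n.+1%:R (f x)) ^+ 2)%:E.
have mF n : measurable_fun D (F n).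
  apply/measurable_EFinP; apply: measurable_funX; apply: measurable_funB => //.
  exact: measurable_clip.
have cv : (\int[mu]_(x in D) F n x @[n --> \oo] --> \int[mu]_(x in D) (0%:E : \bar R))%E.
  apply: (@dominated_cvg _ _ _ mu D _ F (fun=> 0%:E) (fun x => ((f x) ^+ 2)%:E)) => //.
  - move=> x Dx; apply: cvg_near_cst; near=> n.
    rewrite /F clip_id ?subrr ?expr0n//.
    have : (`|f x| <= n%:R)%R by near: n; exact: nbhs_infty_ger.
    by move/le_trans; apply; rewrite ler_nat.
  - move=> n x Dx; rewrite /F /= lee_fin (ger0_norm (sqr_ge0 _)).
    rewrite -(real_normK (num_real (f x))) -(real_normK (num_real (f x - _))).
    by rewrite lerXn2r ?nnegrE// clip_le.
rewrite integral0 in cv.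
have /fine_cvgP[_ cv'] := cv.
have /cvgrPdist_lt/(_ _ e0) := cv'.
move=> [N _ /(_ N (leqnn N))] /=; rewrite sub0r normrN => H.
exists N.+1%:R => //; apply: le_lt_trans H.
rewrite (le_trans _ (ler_norm _))//.
Unshelve. all: by end_near. Qed.

(** Density of continuous functions in L^1 is transferred to L^2. If [h] and [g] are bounded by [M],
    then |h - g|^2 <= 2 M |h - g|; hence [f] is truncated before it is approximated, and the
    approximant is clipped to the same bound, which does not move it away from [h]. *)
Lemma sqint_continuous_dense f (e : R) : sqint f -> 0 < e ->
  exists2 g, continuous g & ip (fun x => f x - g x) (fun x => f x - g x) < e.
Proof.
move=> Lf e0; have [mf if2] := Lf.
have e4 : 0 < e / 4 by lra.
have [M M0 HM] := sqint_clip_approx Lf e4.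
pose h x := clip M (f x).
have mh : measurable_fun D h by exact: measurable_clip.
have hM x : D x -> `|h x| <= M by move=> _; apply: clip_bound; exact: ltW.
have Lh : sqint h := sqint_bounded mh hM.
have ih : mu.-integrable D (EFin \o h).
  have := sqint_integrableM (sqint_cst (1 : R)) Lh.
  by apply: eq_integrable => // x _ /=; rewrite mul1r.
have mD : measurable (D : set (measurableTypeR R)) by exact: measurable_itv.
have mDoo : (mu (D : set (measurableTypeR R)) < +oo)%E.
  by rewrite lebesgue_measure_itv/= lte_fin ltr01 oppr0 adde0 ltry.
have [g_ [cg ig gcvg]] := approximation_continuous_integrable mD mDoo ih.
have /fine_cvgP[_ cv'] := gcvg.
(* With this choice both the truncation error and the approximation error are at most e/4; each is
   counted twice when the squares are added. *)
have eM : 0 < e / (8 * M) by rewrite divr_gt0// mulr_gt0.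
have /cvgrPdist_lt/(_ _ eM) := cv'.
move=> [N _ /(_ N (leqnn N))] /=; rewrite sub0r normrN => H.
pose g x := clip M (g_ N x).
have cg' : continuous g by apply: lipschitz_continuous_comp; [exact: clamp_lipschitz|exact: cg].
have Lg := sqint_continuous cg'.
exists g => //.
have Lfh := sqintB Lf Lh; have Lhg := sqintB Lh Lg; have Lfg := sqintB Lf Lg.
have H2 : ip (fun x => h x - g x) (fun x => h x - g x) <= 2 * M * (e / (8 * M)).
  apply: le_trans (ler_wpM2l _ (ltW (le_lt_trans (ler_norm _) H))); last lra.
  rewrite -RintegralZl//; last first.
    have := integrableB mD ih (ig N) => /integrable_abse.
    by apply: eq_integrable => // x _.
  apply: le_Rintegral => //.
  - exact: sqint_integrableM.
  - have := integrableB mD ih (ig N) => /integrable_abse /(integrableZl mD (2 * M)).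
    by apply: eq_integrable => // x _.
  - move=> x Dx; rewrite -expr2 -real_normK ?num_real// expr2 ler_pM//.
      have := hM x Dx; have : `|g x| <= M by apply: clip_bound; exact: ltW.
      by move=> ? ?; rewrite (le_trans (ler_normB _ _))//; lra.
    have := clamp_lipschitz (- M) M (h x) (g_ N x).
    by rewrite -/(clip M) (clip_id (hM x Dx)).
have H3 : ip (fun x => f x - g x) (fun x => f x - g x) <=
    2 * ip (fun x => f x - h x) (fun x => f x - h x) +
    2 * ip (fun x => h x - g x) (fun x => h x - g x).
  apply: le_trans (ip_sqrD_le Lfh Lhg).
  have -> // : (fun x => f x - g x) = (fun x => (f x - h x) + (h x - g x)).
  by apply/funext => x; rewrite addrA subrK.
rewrite (le_lt_trans H3)//.
have : 2 * M * (e / (8 * M)) = e / 4 by field; exact: lt0r_neq0.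
move: HM; rewrite -/h; lra.
Qed.

Definition before (x z : R) : R := (z < x)%R%:R.

Lemma sqint_before (x : R) : sqint (before x).
Proof.
apply: (@sqint_bounded _ _ 1).
  have -> : before x = \1_(`]-oo, x[%classic).
    by apply/funext => z; rewrite /before indicE mem_setE in_itv/=.
  exact: measurable_indic.
by move=> z _; rewrite /before; case: (z < x); rewrite ?normr1 ?normr0.
Qed.

(** Writing the primitive as a pairing gives it linearity and the Cauchy-Schwarz bound for free, and
    defines it on the whole line: it is constant outside [0, 1]. *)
Definition prim f (x : R) : R := ip (before x) f.

Lemma ip0l f : sqint f -> ip (fun=> 0) f = 0.
Proof.
move=> Lf; rewrite -[RHS](mul0r (ip f f)) -(ipZl 0 Lf Lf).
by apply: eq_ip => x _; rewrite !mul0r.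
Qed.

Lemma prim0 f : sqint f -> prim f 0 = 0.
Proof.
move=> Lf; rewrite -[RHS](ip0l Lf); apply: eq_ip => x /andP[x0 _].
by rewrite /before ltNge ltW// mul0r.
Qed.

Lemma prim1 f : prim f 1 = ip (fun=> 1) f.
Proof. by apply: eq_ip => x /andP[_ x1]; rewrite /before x1. Qed.

Lemma primB f g (x : R) : sqint f -> sqint g ->
  prim (fun x => f x - g x) x = prim f x - prim g x.
Proof. by move=> Lf Lg; rewrite /prim ipBr//; exact: sqint_before. Qed.

Lemma prim_le f (x : R) : sqint f -> `|prim f x| <= Num.sqrt (ip f f).
Proof.
move=> Lf; rewrite (le_trans (norm_ip_le (sqint_before x) Lf))//.
rewrite ler_piMl ?sqrtr_ge0// -[leRHS]sqrtr1 ler_wsqrtr//.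
have := ip_cst (1 : R) 1; rewrite mulr1 => <-.
apply: le_ip; try exact: sqint_before; try exact: sqint_cst.
by move=> z _; rewrite /before; case: (z < x); rewrite !(mulr1,mulr0).
Qed.

(** Cauchy-Schwarz against the indicator of [[x, x'[]. The points may lie outside [0, 1], so the
    measure of its trace on the unit interval is only bounded by [x' - x]. *)
Lemma prim_holder f (x x' : R) : sqint f -> x <= x' ->
  `|prim f x' - prim f x| <= Num.sqrt (x' - x) * Num.sqrt (ip f f).
Proof.
move=> Lf xx'; rewrite /prim -ipBl//; try exact: sqint_before.
have Lb := sqintB (sqint_before x') (sqint_before x).
rewrite (le_trans (norm_ip_le Lb Lf))// ler_wpM2r ?sqrtr_ge0// ler_wsqrtr//.
have -> : ip (fun z => before x' z - before x z) (fun z => before x' z - before x z)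
   = \int[mu]_(z in D) (\1_(`[x, x'[%classic) z).
  apply: eq_Rintegral => z _; rewrite /before indicE mem_setE in_itv/=.
  have [zx|xz] := ltP z x; first by rewrite (lt_le_trans zx xx') subrr mulr0.
  by case: (z < x'); rewrite subr0 !(mulr1,mulr0).
have mD : measurable (D : set (measurableTypeR R)) by exact: measurable_itv.
rewrite /Rintegral integral_indic//.
have mI : (mu (`[x, x'[%classic : set (measurableTypeR R)) = (x' - x)%:E)%E.
  rewrite lebesgue_measure_itv/= lte_fin; have [//|] := ltP x x'.
  move=> x'x; have -> : x = x' by apply/eqP; rewrite eq_le xx'.
  by rewrite subrr.
rewrite -[leRHS]/(fine (x' - x)%:E) -mI fine_le//.
- rewrite ge0_fin_numE//; apply: le_lt_trans (ltry (x' - x)); rewrite -mI.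
  by apply: le_measure; rewrite ?inE//; exact: measurableI.
- by rewrite mI.
- by apply: le_measure; rewrite ?inE//; exact: measurableI.
Qed.

Lemma prim_continuous f : sqint f -> continuous (prim f).
Proof.
move=> Lf x; apply/cvgrPdist_le => e e0.
set N := Num.sqrt (ip f f).
have N0 : 0 <= N by exact: sqrtr_ge0.
have d0 : 0 < (e / (N + 1)) ^+ 2 by rewrite exprn_gt0// divr_gt0// ltr_wpDl.
have key (a b : R) : a <= b -> b - a <= (e / (N + 1)) ^+ 2 ->
    `|prim f b - prim f a| <= e.
  move=> ab H; rewrite (le_trans (prim_holder Lf ab))// -/N.
  have : Num.sqrt (b - a) <= e / (N + 1).
    have E0 : 0 <= e / (N + 1) by rewrite divr_ge0 ?addr_ge0// ltW.
    by rewrite -(ger0_norm E0) -sqrtr_sqr ler_wsqrtr.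
  move=> /(ler_wpM2r N0)/le_trans; apply.
  by rewrite mulrAC ler_pdivrMr ?ltr_wpDl// ler_wpM2l ?ltW// ltrDl.
near=> y.
have : `|x - y| <= (e / (N + 1)) ^+ 2.
  by near: y; apply: cvgr_dist_le.
rewrite ler_norml => /andP[H1 H2].
have [xy|yx] := leP x y.
  by rewrite distrC; apply: key => //; lra.
by apply: key; [exact: ltW|lra].
Unshelve. all: by end_near. Qed.

Lemma prim_itv f (x : R) : continuous f -> 0 <= x <= 1 ->
  prim f x = \int[mu]_(z in `[0, x]) f z.
Proof.
move=> cf /andP[x0 x1].
have iD (a b : R) : mu.-integrable `[a, b] (EFin \o f).
  by apply: continuous_compact_integrable; [exact: segment_compact|exact: continuous_subspaceT].
rewrite -Rintegral_itv_obnd_cbnd; last first.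
  by apply: integrableS (iD 0 x) => //; exact: subset_itv_oc_cc.
rewrite -Rintegral_itv_bndo_bndc; last first.
  by apply: integrableS (iD 0 x) => //; exact: subset_itv_oo_cc.
have -> : [set` `]0, x[] = D `&` [set` `]-oo, x[].
  apply/seteqP; split => z /=; rewrite !in_itv/=.
    by move=> /andP[z0 zx]; rewrite z0 zx (lt_le_trans zx x1).
  by move=> [/andP[-> _] ->].
rewrite Rintegral_mkcondr; apply: eq_Rintegral => z _.
rewrite patchE mem_setE in_itv/= /before.
by case: (z < x); rewrite ?mul1r ?mul0r.
Qed.

Lemma prim_derive f (x : R) : continuous f -> 0 < x < 1 ->
  is_derive x 1 (prim f) (f x).
Proof.
move=> cf /andP[x0 x1].
have iD (a b : R) : mu.-integrable `[a, b] (EFin \o f).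
  by apply: continuous_compact_integrable; [exact: segment_compact|exact: continuous_subspaceT].
have [] := @continuous_FTC1_closed _ f 0 x 1 x1 (iD 0 1) x0 (cf x).
move=> d1 d2; rewrite -d2 derive1E.
have E : \forall z \near x, \int[mu]_(t in `[0, z]) f t = prim f z.
  near=> z; rewrite prim_itv//.
  by apply/andP; split; apply/ltW; near: z; [exact: lt_nbhsr|exact: lt_nbhsl].
exact: (near_eq_is_derive E (DeriveDef d1 erefl)).
Unshelve. all: by end_near. Qed.

Lemma itv01_ip f g : continuous f -> continuous g ->
  \int[mu]_(z in `[0, 1]) (f z * g z) = ip f g.
Proof.
move=> cf cg.
have iD (a b : R) : mu.-integrable `[a, b] (EFin \o (fun z => f z * g z)).
  apply: continuous_compact_integrable; first exact: segment_compact.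
  by apply: continuous_subspaceT => x; apply: cvgM; [exact: cf|exact: cg].
rewrite -Rintegral_itv_obnd_cbnd; last first.
  by apply: integrableS (iD 0 1) => //; exact: subset_itv_oc_cc.
rewrite -Rintegral_itv_bndo_bndc//.
by apply: integrableS (iD 0 1) => //; exact: subset_itv_oo_cc.
Qed.

(** The fundamental theorem of calculus for [q * (c + prim f) ^+ 2]. The constant [c] is the value
    at 0 of the function whose derivative is [f]. *)
Lemma ip_square_continuous f (q q' : R -> R) (c : R) :
  continuous f -> continuous q ->
  (forall x : R, 0 < x < 1 -> is_derive x 1 q (q' x)) -> continuous q' ->
  2 * ip (fun x => q x * (c + prim f x)) f =
  q 1 * (c + prim f 1) ^+ 2 - q 0 * (c + prim f 0) ^+ 2
  - ip q' (fun x => (c + prim f x) ^+ 2).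
Proof.
move=> cf cq dq cq'.
have Lf := sqint_continuous cf.
have cG : continuous (fun x => c + prim f x).
  by move=> x; apply: cvgD; [exact: cvg_cst|exact: prim_continuous].
have cG2 : continuous (fun x => (c + prim f x) ^+ 2).
  by move=> x; under eq_fun do rewrite expr2; apply: (cvgM (cG x) (cG x)).
have cqG : continuous (fun x => q x * (c + prim f x)).
  by move=> x; apply: cvgM; [exact: cq|exact: cG].
have cqG2 : continuous (fun x => q x * (c + prim f x) ^+ 2).
  by move=> x; apply: cvgM; [exact: cq|exact: cG2].
pose g x := q' x * (c + prim f x) ^+ 2 + 2 * (q x * (c + prim f x) * f x).
have cg : continuous g.
  move=> x; apply: cvgD.
    by apply: cvgM; [exact: cq'|exact: cG2].
  by apply: cvgM; [exact: cvg_cst|apply: cvgM; [exact: cqG|exact: cf]].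
have dF (x : R) : 0 < x < 1 -> is_derive x 1 (fun x => q x * (c + prim f x) ^+ 2) (g x).
  move=> x01; have dP := prim_derive cf x01.
  have dG : is_derive x 1 (cst c + prim f) (0 + f x) by exact: is_deriveD.
  have dqG := is_deriveM (dq x x01) (is_deriveX 2 dG).
  rewrite (_ : (fun x => _) = q * (cst c + prim f) ^+ 2); last first.
    by apply/funext => z; rewrite /= !exprfctE.
  apply: (is_derive_eq dqG).
  by rewrite /g/= !fctE /GRing.scale/=; ring.
have FTC : \int[mu]_(z in `[0, 1]) g z =
  q 1 * (c + prim f 1) ^+ 2 - q 0 * (c + prim f 0) ^+ 2.
  rewrite /Rintegral (@continuous_FTC2 _ g (fun x => q x * (c + prim f x) ^+ 2) 0 1)//.
  - exact: continuous_subspaceT.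
  - split.
    + by move=> x; rewrite in_itv/= => /dF[].
    + by apply: cvg_at_right_filter; exact: cqG2.
    + by apply: cvg_at_left_filter; exact: cqG2.
  - by move=> x; rewrite in_itv/= derive1E => /dF[_ ->].
have iD (k : R -> R) : continuous k -> mu.-integrable `[0, 1] (EFin \o k).
  move=> ck; apply: continuous_compact_integrable; first exact: segment_compact.
  exact: continuous_subspaceT.
rewrite -FTC -itv01_ip// -itv01_ip// /g RintegralD//.
- rewrite RintegralZl//; first by rewrite addrAC subrr add0r.
  by apply: iD => x; apply: cvgM; [exact: cqG|exact: cf].
- by apply: iD => x; apply: cvgM; [exact: cq'|exact: cG2].
- apply: iD => x.
  by apply: cvgM; [exact: cvg_cst|apply: cvgM; [exact: cqG|exact: cf]].
Qed.

End Primitive.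

(** * Convergence in mean square *)

Section Convergence.
Context {R : realType}.
Implicit Types f g : R -> R.

(** The filter is arbitrary because the notion serves both for approximating sequences and for the
    continuity in time of curves in L^2. *)
Definition cvg2 {T : Type} (F : set_system T) (u : T -> R -> R) f : Prop :=
  ip (fun x => u t x - f x) (fun x => u t x - f x) @[t --> F] --> (0 : R).

Lemma cvg_sqrt0 {T : Type} (F : set_system T) {FF : Filter F} (a : T -> R) :
  a t @[t --> F] --> (0 : R) -> Num.sqrt (a t) @[t --> F] --> (0 : R).
Proof.
move=> a0; rewrite -(sqrtr0 R).
by apply: continuous_cvg => //; exact: sqrt_continuous.
Qed.

(** The difference of the pairings expands into <u - f, v - g> + <u - f, g> + <f, v - g>, and
    Cauchy-Schwarz bounds each term. *)
Lemma cvg_ip {T : Type} (F : set_system T) {FF : Filter F} (u v : T -> R -> R) f g :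
  (forall t, sqint (u t)) -> (forall t, sqint (v t)) -> sqint f -> sqint g ->
  cvg2 F u f -> cvg2 F v g -> ip (u t) (v t) @[t --> F] --> ip f g.
Proof.
move=> Lu Lv Lf Lg uf vg.
pose nu t := Num.sqrt (ip (fun x => u t x - f x) (fun x => u t x - f x)).
pose nv t := Num.sqrt (ip (fun x => v t x - g x) (fun x => v t x - g x)).
have nu0 : nu t @[t --> F] --> (0 : R) by exact: cvg_sqrt0.
have nv0 : nv t @[t --> F] --> (0 : R) by exact: cvg_sqrt0.
pose A := Num.sqrt (ip f f); pose B := Num.sqrt (ip g g).
have bound t : `|ip f g - ip (u t) (v t)| <= nu t * nv t + nu t * B + A * nv t.
  have L1 := sqintB (Lu t) Lf; have L2 := sqintB (Lv t) Lg.
  have -> : ip f g - ip (u t) (v t) = - (ip (fun x => u t x - f x) (fun x => v t x - g x)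
     + ip (fun x => u t x - f x) g + ip f (fun x => v t x - g x)).
    by rewrite !(ipBr, ipBl)//; ring.
  rewrite normrN (le_trans (ler_normD _ _))// lerD ?norm_ip_le//.
  by rewrite (le_trans (ler_normD _ _))// lerD ?norm_ip_le.
apply/cvgrPdist_le => e e0.
have lim0 : nu t * nv t + nu t * B + A * nv t @[t --> F] --> (0 : R).
  rewrite -[0 in X in _ --> X](_ : (0 : R) * 0 + 0 * B + A * 0 = 0); last by ring.
  by apply: cvgD; [apply: cvgD; [exact: cvgM|apply: cvgM => //; exact: cvg_cst]|
    apply: cvgM => //; exact: cvg_cst].
near=> t; rewrite (le_trans (bound t))//.
rewrite (le_trans (ler_norm _))// -[X in `|X|]subr0 distrC.
near: t; by move/cvgrPdist_le : lim0; apply.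
Unshelve. all: by end_near. Qed.

Lemma cvg2_cst {T : Type} (F : set_system T) {FF : Filter F} f :
  sqint f -> cvg2 F (fun=> f) f.
Proof.
move=> Lf; rewrite /cvg2 (_ : ip _ _ = 0); first exact: cvg_cst.
by rewrite -[RHS](ip0l Lf); apply: eq_ip => x _; rewrite subrr !mul0r.
Qed.

Lemma cvg2D {T : Type} (F : set_system T) {FF : Filter F} (u v : T -> R -> R) f g :
  (forall t, sqint (u t)) -> (forall t, sqint (v t)) -> sqint f -> sqint g ->
  cvg2 F u f -> cvg2 F v g -> cvg2 F (fun t x => u t x + v t x) (fun x => f x + g x).
Proof.
move=> Lu Lv Lf Lg uf vg; rewrite /cvg2.
apply: (@squeeze_cvgr _ _ _ _ (fun=> 0) (fun t =>
  2 * ip (fun x => u t x - f x) (fun x => u t x - f x) +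
  2 * ip (fun x => v t x - g x) (fun x => v t x - g x))).
- near=> t; rewrite ip_ge0/=.
  have L1 := sqintB (Lu t) Lf; have L2 := sqintB (Lv t) Lg.
  apply: le_trans (ip_sqrD_le L1 L2).
  have -> // : (fun x => u t x + v t x - (f x + g x)) =
    (fun x => (u t x - f x) + (v t x - g x)).
  by apply/funext => x; rewrite opprD addrACA.
- exact: cvg_cst.
- rewrite -[0 in X in _ --> X](_ : (2 : R) * 0 + 2 * 0 = 0); last by ring.
  by apply: cvgD; apply: cvgM => //; exact: cvg_cst.
Unshelve. all: by end_near. Qed.

Lemma cvg2Z {T : Type} (F : set_system T) {FF : Filter F} (c : R) (u : T -> R -> R) f :
  (forall t, sqint (u t)) -> sqint f ->
  cvg2 F u f -> cvg2 F (fun t x => c * u t x) (fun x => c * f x).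
Proof.
move=> Lu Lf uf; rewrite /cvg2.
have -> : (fun t => ip (fun x => c * u t x - c * f x) (fun x => c * u t x - c * f x))
   = (fun t => c ^+ 2 * ip (fun x => u t x - f x) (fun x => u t x - f x)).
  apply/funext => t; have L1 := sqintB (Lu t) Lf.
  have -> : (fun x => c * u t x - c * f x) = (fun x => c * (u t x - f x)).
    by apply/funext => x; rewrite mulrBr.
  have L2 := sqintZ c L1.
  by rewrite ipZr// ipZl// mulrA expr2.
rewrite -(mulr0 (c ^+ 2)).
by apply: cvgM => //; exact: cvg_cst.
Qed.

Lemma cvg2_unif {T : Type} (F : set_system T) {FF : Filter F} (u : T -> R -> R) f (e : T -> R) :
  (forall t, sqint (u t)) -> sqint f ->
  (forall t x, 0 < x < 1 -> `|u t x - f x| <= e t) -> e t @[t --> F] --> (0 : R) ->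
  cvg2 F u f.
Proof.
move=> Lu Lf ue e0; rewrite /cvg2.
apply: (@squeeze_cvgr _ _ _ _ (fun=> 0) (fun t => e t * e t)).
- near=> t; rewrite ip_ge0/= -ip_cst.
  have L1 := sqintB (Lu t) Lf.
  apply: le_ip => //; try exact: sqint_cst.
  move=> x x01; rewrite -expr2 -real_normK ?num_real// expr2.
  by rewrite ler_pM ?ue.
- exact: cvg_cst.
- by rewrite -(mulr0 (0 : R)); exact: cvgM.
Unshelve. all: by end_near. Qed.

Lemma sqint_continuous_seq f : sqint f ->
  exists2 u : nat -> R -> R, forall n, continuous (u n) & cvg2 \oo u f.
Proof.
move=> Lf.
have /choice[u Hu] : forall n : nat, exists g, continuous g /\
    ip (fun x => f x - g x) (fun x => f x - g x) < n.+1%:R^-1.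
  move=> n; have n0 : 0 < n.+1%:R^-1 :> R by rewrite invr_gt0.
  by have [g cg Hg] := sqint_continuous_dense Lf n0; exists g.
exists u => [n|]; first by have [] := Hu n.
rewrite /cvg2; apply: (@squeeze_cvgr _ _ _ _ (fun=> 0) (fun n => n.+1%:R^-1)).
- near=> n; rewrite ip_ge0/=; have [_ /ltW] := Hu n; apply: le_trans.
  by rewrite le_eqVlt; apply/orP; left; apply/eqP; apply: eq_ip => x _; ring.
- exact: cvg_cst.
- exact: cvg_harmonic.
Unshelve. all: by end_near. Qed.

(** By density: both sides are continuous in [f] for the mean square norm, because [prim_le] makes
    mean square convergence of [f] uniform convergence of [prim f]. *)
Lemma ip_square f (q q' : R -> R) (c : R) :
  sqint f -> continuous q ->
  (forall x : R, 0 < x < 1 -> is_derive x 1 q (q' x)) -> continuous q' ->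
  2 * ip (fun x => q x * (c + prim f x)) f =
  q 1 * (c + prim f 1) ^+ 2 - q 0 * (c + prim f 0) ^+ 2
  - ip q' (fun x => (c + prim f x) ^+ 2).
Proof.
move=> Lf cq dq cq'.
have [u cu uf] := sqint_continuous_seq Lf.
have Lu n := sqint_continuous (cu n).
pose d n := Num.sqrt (ip (fun x => u n x - f x) (fun x => u n x - f x)).
have d0 : d n @[n --> \oo] --> (0 : R) by exact: cvg_sqrt0.
have cG g : sqint g -> continuous (fun x => c + prim g x).
  by move=> Lg x; apply: cvgD; [exact: cvg_cst|exact: prim_continuous].
have cG2 g : sqint g -> continuous (fun x => (c + prim g x) ^+ 2).
  by move=> Lg x; under eq_fun do rewrite expr2; apply: (cvgM (cG g Lg x) (cG g Lg x)).
have cqG g : sqint g -> continuous (fun x => q x * (c + prim g x)).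
  by move=> Lg x; apply: cvgM; [exact: cq|exact: cG].
have [K K0 qK] := continuous_bounded_itv cq.
have dist n x : `|(c + prim (u n) x) - (c + prim f x)| <= d n.
  rewrite opprD addrACA subrr add0r -primB//.
  by apply: prim_le; exact: sqintB.
pose A := `|c| + Num.sqrt (ip f f).
have GA x : `|c + prim f x| <= A.
  by rewrite (le_trans (ler_normD _ _))// lerD// prim_le.
have dist2 n x : `|(c + prim (u n) x) ^+ 2 - (c + prim f x) ^+ 2| <= d n * (d n + 2 * A).
  rewrite subr_sqr normrM ler_pM//.
  have -> : c + prim (u n) x + (c + prim f x) =
    (c + prim (u n) x) - (c + prim f x) + 2 * (c + prim f x) by ring.
  by rewrite (le_trans (ler_normD _ _))// lerD// normrM ger0_norm// ler_wpM2l.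
have dA : d n * (d n + 2 * A) @[n --> \oo] --> (0 : R).
  rewrite -(mul0r (0 + 2 * A)); apply: cvgM => //.
  by apply: cvgD => //; exact: cvg_cst.
have pt x : (c + prim (u n) x) ^+ 2 @[n --> \oo] --> (c + prim f x) ^+ 2.
  apply/cvgrPdist_le => e e0; near=> n.
  rewrite distrC (le_trans (dist2 n x))// (le_trans (ler_norm _))//.
  rewrite -[X in `|X|]subr0 distrC.
  by near: n; move/cvgrPdist_le : dA; apply.
have limL : 2 * ip (fun x => q x * (c + prim (u n) x)) (u n) @[n --> \oo] -->
     2 * ip (fun x => q x * (c + prim f x)) f.
  apply: cvgM; first exact: cvg_cst.
  apply: cvg_ip => //; try by move=> *; apply: sqint_continuous; exact: cqG.
  apply: (@cvg2_unif _ _ _ _ _ (fun n => K * d n)).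
  - by move=> n; apply: sqint_continuous; exact: cqG.
  - by apply: sqint_continuous; exact: cqG.
  - move=> n x x01; rewrite -mulrBr normrM ler_pM//.
    by apply: qK; rewrite /= in_itv/=.
  - by rewrite -(mulr0 K); apply: cvgM => //; exact: cvg_cst.
have limR : q 1 * (c + prim (u n) 1) ^+ 2 - q 0 * (c + prim (u n) 0) ^+ 2
  - ip q' (fun x => (c + prim (u n) x) ^+ 2) @[n --> \oo] -->
  q 1 * (c + prim f 1) ^+ 2 - q 0 * (c + prim f 0) ^+ 2
  - ip q' (fun x => (c + prim f x) ^+ 2).
  apply: cvgB.
    by apply: cvgB; apply: cvgM; try exact: cvg_cst; exact: pt.
  apply: cvg_ip => //; try by move=> *; apply: sqint_continuous => //; exact: cG2.
  - by apply: cvg2_cst; exact: sqint_continuous.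
  - apply: (@cvg2_unif _ _ _ _ _ (fun n => d n * (d n + 2 * A))) => //.
    by move=> n; apply: sqint_continuous; exact: cG2.
    by apply: sqint_continuous; exact: cG2.
have E : (fun n => 2 * ip (fun x => q x * (c + prim (u n) x)) (u n)) =
  (fun n => q 1 * (c + prim (u n) 1) ^+ 2 - q 0 * (c + prim (u n) 0) ^+ 2
  - ip q' (fun x => (c + prim (u n) x) ^+ 2)).
  by apply/funext => n; exact: ip_square_continuous.
rewrite E in limL.
exact: (cvg_unique _ limL limR).
Unshelve. all: by end_near. Qed.

(** The case of the constant function 1 in [ip_square], that is, [f = 0] and [c = 1]. *)
Lemma ip_ftc (q q' : R -> R) : continuous q ->
  (forall x : R, 0 < x < 1 -> is_derive x 1 q (q' x)) -> continuous q' ->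
  ip q' (fun=> 1) = q 1 - q 0.
Proof.
move=> cq dq cq'.
have L0 := sqint_cst (0 : R).
have P0 x : prim (fun=> 0) x = 0.
  by rewrite /prim ipC; apply: ip0l; exact: sqint_before.
have := ip_square 1 L0 cq dq cq'.
rewrite !P0 !addr0 expr1n !mulr1 ipC ip0l; last first.
  under eq_fun do rewrite P0 addr0 mulr1.
  exact: sqint_continuous.
rewrite mulr0 => /esym/eqP; rewrite subr_eq0 => /eqP ->.
by apply: eq_ip => x _; rewrite P0 addr0 expr1n.
Qed.

(** Polarisation of [ip_square]: between [c = 1] and [c = 0] the quadratic terms cancel, and
    [ip_ftc] removes the constant ones. *)
Lemma ip_parts f (q q' : R -> R) : sqint f -> continuous q ->
  (forall x : R, 0 < x < 1 -> is_derive x 1 q (q' x)) -> continuous q' ->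
  ip q f = q 1 * prim f 1 - ip q' (prim f).
Proof.
move=> Lf cq dq cq'.
have cP := prim_continuous Lf.
have cP2 : continuous (fun x => (prim f x) ^+ 2).
  by move=> x; under eq_fun do rewrite expr2; apply: (cvgM (cP x) (cP x)).
have cqP : continuous (fun x => q x * prim f x).
  by move=> x; apply: cvgM; [exact: cq|exact: cP].
have Lq := sqint_continuous cq; have Lq' := sqint_continuous cq'.
have LP := sqint_continuous cP; have LP2 := sqint_continuous cP2.
have LqP := sqint_continuous cqP; have L1 := sqint_cst (1 : R).
have := ip_square 1 Lf cq dq cq'; have := ip_square 0 Lf cq dq cq'.
have -> : (fun x => (0 + prim f x) ^+ 2) = (fun x => (prim f x) ^+ 2).
  by apply/funext => x; rewrite add0r.
have -> : (fun x => q x * (0 + prim f x)) = (fun x => q x * prim f x).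
  by apply/funext => x; rewrite add0r.
have -> : (fun x => (1 + prim f x) ^+ 2) =
  (fun x => 1 + (2 * prim f x + (prim f x) ^+ 2)).
  by apply/funext => x; ring.
have -> : (fun x => q x * (1 + prim f x)) = (fun x => q x + q x * prim f x).
  by apply/funext => x; ring.
have L2P := sqintZ 2 LP; have LD := sqintD L2P LP2.
rewrite (ipDl Lf Lq LqP) (ipDr Lq' L1 LD) (ipDr Lq' L2P LP2) (ipZr 2 Lq' LP).
rewrite (ip_ftc cq dq cq') prim0//.
lra.
Qed.

End Convergence.

(** * Time integrals of curves in L² *)

Section TimeIntegral.
Context {R : realType}.
Notation mu := (@lebesgue_measure R).
Notation D := (`]0 : R, 1[%classic).
Implicit Types (a b c : R) (f g : R -> R) (y : R -> R -> R).

Definition tint a b g : R := \int[mu]_(s in `[a, b]) g s.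

Lemma tint_integrable a b g : continuous g ->
  mu.-integrable `[a, b] (EFin \o g).
Proof.
move=> cg; apply: continuous_compact_integrable; first exact: segment_compact.
exact: continuous_subspaceT.
Qed.

Lemma tintD a b f g : continuous f -> continuous g ->
  tint a b (fun s => f s + g s) = tint a b f + tint a b g.
Proof. by move=> cf cg; rewrite /tint RintegralD//; exact: tint_integrable. Qed.

Lemma tintZ a b (k : R) g : continuous g ->
  tint a b (fun s => k * g s) = k * tint a b g.
Proof. by move=> cg; rewrite /tint RintegralZl//; exact: tint_integrable. Qed.

Lemma tintB a b f g : continuous f -> continuous g ->
  tint a b (fun s => f s - g s) = tint a b f - tint a b g.
Proof. by move=> cf cg; rewrite /tint RintegralB//; exact: tint_integrable. Qed.

Lemma tint_cst a b (k : R) : a <= b -> tint a b (fun=> k) = k * (b - a).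
Proof.
move=> ab; rewrite /tint Rintegral_cst//; congr (_ * _).
suff E : mu (`[a, b]%classic : set (measurableTypeR R)) = (b - a)%:E.
  exact: (congr1 fine E).
rewrite lebesgue_measure_itv/= lte_fin; have [//|] := ltP a b.
by move=> ba; have -> : a = b; [apply/eqP; rewrite eq_le ab|rewrite subrr].
Qed.

Lemma continuous_sum (J : Type) (s : seq J) (F : J -> R -> R) :
  (forall j, continuous (F j)) -> continuous (fun x => \sum_(j <- s) F j x).
Proof.
move=> cF; elim: s => [|j s IH] x.
  by under eq_fun do rewrite big_nil; exact: cvg_cst.
by under eq_fun do rewrite big_cons; apply: cvgD; [exact: cF|exact: IH].
Qed.

Lemma tint_sum a b (J : Type) (s : seq J) (F : J -> R -> R) :
  a <= b -> (forall j, continuous (F j)) ->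
  tint a b (fun t => \sum_(j <- s) F j t) = \sum_(j <- s) tint a b (F j).
Proof.
move=> ab cF; elim: s => [|j s IH].
  under [LHS]eq_Rintegral do rewrite big_nil.
  by rewrite big_nil -[LHS]/(tint a b (fun=> 0)) tint_cst// mul0r.
under [LHS]eq_Rintegral do rewrite big_cons.
by rewrite big_cons -IH -tintD//; exact: continuous_sum.
Qed.

Lemma le_tint a b f g : continuous f -> continuous g ->
  (forall s, a <= s <= b -> f s <= g s) -> tint a b f <= tint a b g.
Proof.
move=> cf cg fg.
apply: le_Rintegral (tint_integrable _ _ cf) (tint_integrable _ _ cg) _ => //.
Qed.

Lemma tint_norm_le a b g (M : R) : a <= b -> continuous g ->
  (forall s, a <= s <= b -> `|g s| <= M) -> `|tint a b g| <= M * (b - a).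
Proof.
move=> ab cg gM; have cM : continuous (fun _ : R => M) by move=> x; exact: cvg_cst.
have cNM : continuous (fun _ : R => - M) by move=> x; exact: cvg_cst.
rewrite ler_norml -mulNr -!tint_cst//; apply/andP; split; apply: le_tint => // s /gM.
  by rewrite ler_norml => /andP[].
by rewrite ler_norml => /andP[].
Qed.

Lemma tint_split a b c g : continuous g -> a <= b -> b <= c ->
  tint a c g = tint a b g + tint b c g.
Proof.
move=> cg ab bc; apply/eqP; rewrite addrC -subr_eq; apply/eqP.
rewrite /tint Rintegral_itvB ?bnd_simp//; last exact: tint_integrable.
rewrite Rintegral_itv_obnd_cbnd//.
by apply: integrableS (tint_integrable b c cg) => //; exact: subset_itv_oc_cc.
Qed.

Lemma tint_derive c g (s : R) : continuous g -> c < s ->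
  is_derive s 1 (tint c ^~ g) (g s).
Proof.
move=> cg cs; have s1 : s < s + 1 by rewrite ltrDl.
have [] := @continuous_FTC1_closed _ g c s _ s1 (tint_integrable _ _ cg) cs (cg s).
by move=> d1 <-; rewrite derive1E; exact: DeriveDef.
Qed.

Lemma continuous_bounded_segment a b g : continuous g ->
  exists2 M : R, 0 < M & forall s, a <= s <= b -> `|g s| <= M.
Proof.
move=> cg.
have [M [_ HM]] : bounded_set (g @` `[a, b]).
  apply: compact_bounded; apply: continuous_compact.
    exact: continuous_subspaceT.
  exact: segment_compact.
exists (`|M| + 1); first by rewrite ltr_wpDl.
move=> s sab; apply: (HM (`|M| + 1)).
  by rewrite (le_lt_trans (ler_norm _))// ltrDl.
by exists s => //; rewrite /= in_itv.
Qed.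

Lemma continuous_ip y g : (forall s, sqint (y s)) ->
  (forall s : R, cvg2 (nbhs s) y (y s)) -> sqint g ->
  continuous (fun s => ip g (y s)).
Proof. by move=> Ly cy Lg s; apply: cvg_ip (cvg2_cst (F:=nbhs s) Lg) (cy s). Qed.

Lemma continuous_ip_self y : (forall s, sqint (y s)) ->
  (forall s : R, cvg2 (nbhs s) y (y s)) -> continuous (fun s => ip (y s) (y s)).
Proof. by move=> Ly cy s; apply: cvg_ip (cy s) (cy s). Qed.

Lemma derive0_eq a b f : a <= b ->
  (forall s, a <= s <= b -> is_derive s 1 f 0) -> f a = f b.
Proof.
rewrite le_eqVlt => /predU1P[-> //|ab] df.
have [c _ /eqP] : exists2 c, c \in `]a, b[ & f b - f a = 0 * (b - a).
  apply: (@MVT _ f (fun=> 0)) => //.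
    by move=> x; rewrite in_itv/= => /andP[? ?]; apply: df; rewrite !ltW.
  apply: derivable_within_continuous => x; rewrite in_itv/= => xab.
  by have [] := df x xab.
by rewrite mul0r subr_eq0 => /eqP.
Qed.

Section swap.
Variables (y : R -> R -> R) (Ly : forall s, sqint (y s))
  (cy : forall s : R, cvg2 (nbhs s) y (y s)).

Let cprim x : continuous (fun s => prim (y s) x).
Proof. by apply: continuous_ip => //; exact: sqint_before. Qed.

Lemma tint_prim_continuous a b : a <= b ->
  continuous (fun x => tint a b (fun s => prim (y s) x)).
Proof.
move=> ab x.
have cN : continuous (fun s => Num.sqrt (ip (y s) (y s))).
  move=> s; apply: continuous_cvg; first exact: sqrt_continuous.
  exact: continuous_ip_self.
have [M M0 HM] := continuous_bounded_segment a b cN.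
have key (x1 x2 : R) : x1 <= x2 ->
   `|tint a b (fun s => prim (y s) x2) - tint a b (fun s => prim (y s) x1)| <=
   Num.sqrt (`|x2 - x1|) * M * (b - a).
  move=> x12; rewrite -tintB//; apply: tint_norm_le => //.
    by move=> s; apply: cvgB; exact: cprim.
  move=> s sab; rewrite (le_trans (prim_holder (Ly s) x12))//.
  rewrite ger0_norm ?subr_ge0// ler_wpM2l ?sqrtr_ge0//.
  by rewrite (le_trans _ (HM s sab))// ler_norm.
have key2 x1 x2 : `|tint a b (fun s => prim (y s) x1) - tint a b (fun s => prim (y s) x2)| <=
   Num.sqrt (`|x1 - x2|) * M * (b - a).
  have [x12|/ltW x21] := leP x1 x2; last exact: key.
  by rewrite distrC (distrC x1); exact: key.
apply/cvgrPdist_le => e e0.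
have lim0 : Num.sqrt `|x - z| * M * (b - a) @[z --> x] --> (0 : R).
  rewrite -[0 in X in _ --> X](_ : 0 * M * (b - a) = 0 :> R); last by rewrite !mul0r.
  apply: cvgM; last exact: cvg_cst.
  apply: cvgM; last exact: cvg_cst.
  apply: cvg_sqrt0.
  have : `|x - z| @[z --> x] --> `|x - x|.
    by apply: cvg_norm; apply: cvgB; [exact: cvg_cst|exact: cvg_id].
  by rewrite subrr normr0.
near=> z; rewrite (le_trans (key2 x z))// (le_trans (ler_norm _))//.
rewrite -[X in `|X|]subr0 distrC.
by near: z; move/cvgrPdist_le : lim0; apply.
Unshelve. all: by end_near. Qed.

(** An exchange of integrals without joint measurability. As functions of the upper limit both sides
    have the derivative [ip r (prim (y t))], the right one by differentiation under the integral
    sign, so their increments over [a, b] agree. The primitive stands in place of [y s] because its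
    value at a point is continuous in [s]. *)
Lemma tint_swap a b (r : R -> R) : a <= b -> continuous r ->
  tint a b (fun s => ip r (prim (y s))) =
  ip r (fun x => tint a b (fun s => prim (y s) x)).
Proof.
move=> ab cr.
(* Margins on both sides, so that two-sided derivatives exist at every point of [a, b]. *)
pose c := a - 1; pose v := b + 1.
have ca : c < a by rewrite /c ltrBlDr ltrDl.
have bv : b < v by rewrite /v ltrDl.
have Lr := sqint_continuous cr.
have LP s : sqint (prim (y s)) by apply: sqint_continuous; exact: prim_continuous.
have cN : continuous (fun s => Num.sqrt (ip (y s) (y s))).
  move=> s; apply: continuous_cvg; first exact: sqrt_continuous.
  exact: continuous_ip_self.
have [M M0 HM] := continuous_bounded_segment c v cN.
have [K K0 HK] := continuous_bounded_itv cr.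
have cIP : continuous (fun s => ip r (prim (y s))).
  move=> s; apply: cvg_ip => //; first exact: cvg2_cst.
  apply: (@cvg2_unif _ _ _ _ _ _ (fun t => Num.sqrt
    (ip (fun x => y t x - y s x) (fun x => y t x - y s x)))) => //.
    by move=> t x _; rewrite -primB//; apply: prim_le; exact: sqintB.
  by apply: cvg_sqrt0; exact: cy.
pose f (t x : R) := r x * tint c t (fun s => prim (y s) x).
have df t x : c < t -> is_derive t 1 (f ^~ x) (r x * prim (y t) x).
  move=> ct; have := tint_derive (@cprim x) ct => dt.
  by have := @is_deriveZ _ _ _ _ (r x) _ _ _ dt.
have d1f t x : c < t -> ((f ^~ x)^`())%classic t = r x * prim (y t) x.
  by move=> /(df _ x)[_]; rewrite derive1E.
have LT t : c < t -> sqint (fun x => tint c t (fun s => prim (y s) x)).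
  by move=> ct; apply: sqint_continuous; apply: tint_prim_continuous; exact: ltW.
have intf t : t \in `]c, v[ -> mu.-integrable D (EFin \o f t).
  rewrite in_itv/= => /andP[ct _].
  exact: (sqint_integrableM Lr (LT t ct)).
have mD : measurable (D : set (measurableTypeR R)) by exact: measurable_itv.
have intG : mu.-integrable D (EFin \o (fun=> K * M : R)).
  have := sqint_integrableM (sqint_cst K) (sqint_cst M).
  by apply: eq_integrable.
pose N t := tint c t (fun s => ip r (prim (y s))).
pose Q t := \int[mu]_(x in D) f t x.
have dQ t : c < t < v -> is_derive t 1 Q (ip r (prim (y t))).
  move=> ctv; have Ia : t \in `]c, v[ by rewrite in_itv.
  have H1 : forall t x, `]c, v[%classic t -> D x -> derivable (f ^~ x) t 1.
    by move=> t' x; rewrite /= in_itv/= => /andP[ct' _] _; have [] := df t' x ct'.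
  have H2 : forall t x, `]c, v[%classic t -> D x -> `|partial1of2 f t x| <= K * M.
    move=> t' x; rewrite /= in_itv/= => /andP[ct' tv'] Dx.
    rewrite /partial1of2 d1f// normrM ler_pM// ?HK//.
    rewrite (le_trans (prim_le _ _))// (le_trans (ler_norm _))// HM//.
    by rewrite !ltW.
  have KM0 : forall x : R, 0 <= K * M by move=> _; rewrite mulr_ge0// ltW.
  have := @derivable_under_integral R _ _ mu f D mD t c v Ia intf H1 _ KM0 intG H2.
  have := @differentiation_under_integral R _ _ mu f D mD t c v Ia intf H1 _ KM0 intG H2.
  rewrite derive1E => E dd; apply: DeriveDef => //; rewrite E.
  apply: eq_Rintegral => x _; rewrite /partial1of2 d1f//.
  by case/andP : ctv.
have dN t : c < t -> is_derive t 1 N (ip r (prim (y t))).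
  by move=> ct; exact: (tint_derive cIP ct).
have E : (N - Q) a = (N - Q) b.
  apply: derive0_eq => // s /andP[sa sb].
  rewrite -(subrr (ip r (prim (y s)))); apply: is_deriveB.
    by apply: dN; exact: lt_le_trans sa.
  by apply: dQ; rewrite (lt_le_trans ca sa) (le_lt_trans sb bv).
move: E; rewrite !fctE => E.
have EN : tint a b (fun s => ip r (prim (y s))) = N b - N a.
  by rewrite /N (tint_split cIP (ltW ca) ab) addrAC subrr add0r.
have EQ : ip r (fun x => tint a b (fun s => prim (y s) x)) = Q b - Q a.
  rewrite /Q -[X in X - _]/(ip r (fun x => tint c b (fun s => prim (y s) x))).
  rewrite -[X in _ - X]/(ip r (fun x => tint c a (fun s => prim (y s) x))).
  rewrite -(ipBr Lr (LT b (lt_le_trans ca ab)) (LT a ca)).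
  apply: eq_ip => x _; congr (_ * _).
  by rewrite (tint_split (@cprim x) (ltW ca) ab) addrAC subrr add0r.
rewrite EN EQ; clear -E; move: (N a) (N b) (Q a) (Q b) E => *; lra.
Qed.

End swap.
End TimeIntegral.

(** * Time averages of a weak solution *)

Section WeakAverage.
Context {R : realType} (n : nat).
Implicit Types (f g r : R -> R).

(** Test functions that do not depend on time: these suffice once the solution is integrated over
    time. *)
Definition testfun (phi phi' : 'I_n -> R -> R) : Prop :=
  forall k, [/\ continuous (phi k), continuous (phi' k) &
    forall x : R, 0 < x < 1 -> is_derive x 1 (phi k) (phi' k x)].

Lemma ip_null f g : sqint f -> sqint g -> ip f f = 0 -> ip g f = 0.
Proof.
move=> Lf Lg f0; apply/eqP; rewrite -sqrf_eq0 eq_le sqr_ge0 andbT.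
by rewrite (le_trans (ip_CS Lg Lf))// f0 mulr0.
Qed.

Variables (lam : 'I_n -> R) (F : 'I_n -> 'I_n -> R).
Hypothesis lam0 : forall k, lam k != 0.
Variables (y : R -> 'I_n -> R -> R).
Hypothesis Ly : forall s k, sqint (y s k).
Hypothesis cy : forall k (s : R), cvg2 (nbhs s) (fun t => y t k) (y s k).
(* [bc al be] says that [al] and [be] are admissible values at [x = 0] and
   [x = 1] of a test function. *)
Variables (t1 t2 : R) (bc : ('I_n -> R) -> ('I_n -> R) -> Prop).
Hypothesis t12 : t1 <= t2.
Hypothesis bc0 : bc (fun=> 0) (fun=> 0).
Hypothesis weak : forall phi phi', testfun phi phi' ->
  bc (fun k => phi k 0) (fun k => phi k 1) ->
  \sum_k ip (phi k) (y t2 k) - \sum_k ip (phi k) (y t1 k) =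
  tint t1 t2 (fun s =>
    \sum_k ip (fun x => lam k * phi' k x + \sum_j F j k * phi j x) (y s k)).

Let d k x := y t2 k x - y t1 k x.
Let Ld k : sqint (d k). Proof. exact: sqintB. Qed.

(** The time integral of component [k], known only through its pairings. The function [U k] below
    stands for its primitive in [x], which is meaningful pointwise. *)
Let ell k r := tint t1 t2 (fun s => ip r (y s k)).
Let U k x := tint t1 t2 (fun s => prim (y s k) x).

Let cip k r : sqint r -> continuous (fun s => ip r (y s k)).
Proof. exact: (@continuous_ip _ (fun s => y s k)). Qed.

Let cU k : continuous (U k).
Proof. exact: (@tint_prim_continuous _ (fun s => y s k)). Qed.

Let LU k : sqint (U k). Proof. exact: sqint_continuous. Qed.

(** Integration by parts at each time, followed by [tint_swap]. The boundary term at 0 vanishes with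
    [prim], the one at 1 by [chi 1 = 0]. *)
Let ell_parts k (chi r : R -> R) : continuous chi -> continuous r ->
  (forall x : R, 0 < x < 1 -> is_derive x 1 chi (r x)) -> chi 1 = 0 ->
  ell k chi = - ip r (U k).
Proof.
move=> cc cr dc c1.
rewrite -(@tint_swap _ (fun s => y s k))// -mulN1r -tintZ; last first.
  move=> s; apply: cvg_ip (cvg2_cst (F:=nbhs s) (sqint_continuous cr)) _.
  - by move=> _; exact: sqint_continuous.
  - by move=> t; apply: sqint_continuous; exact: prim_continuous.
  - exact: sqint_continuous.
  - by apply: sqint_continuous; exact: prim_continuous.
  - apply: (@cvg2_unif _ _ _ _ _ _ (fun t => Num.sqrt
      (ip (fun x => y t k x - y s k x) (fun x => y t k x - y s k x)))).
    + by move=> t; apply: sqint_continuous; exact: prim_continuous.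
    + by apply: sqint_continuous; exact: prim_continuous.
    + by move=> t x _; rewrite -primB//; apply: prim_le; exact: sqintB.
    + by apply: cvg_sqrt0; exact: (cy k s).
apply: eq_Rintegral => s _.
by rewrite (ip_parts (Ly s k) cc dc cr) c1 mul0r add0r mulN1r.
Qed.

(** The right-hand side of Lambda v_x = F v - d, integrated in [x]: up to an additive constant it
    represents [lam k * ell k]. *)
Let W k x := \sum_j F k j * U j x - prim (d k) x.

Let cW k : continuous (W k).
Proof.
move=> x; apply: cvgB; last exact: prim_continuous.
apply: (@continuous_sum _ _ _ (fun j x => F k j * U j x)) => j z.
by apply: cvgM; [exact: cvg_cst|exact: cU].
Qed.

(* Tested against [prim r] in the [k]-th component: it vanishes at both ends. *)
Let ell_mean0 k r : continuous r -> prim r 1 = 0 -> lam k * ell k r = ip r (W k).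
Proof.
move=> cr r1.
have Lr := sqint_continuous cr.
have cc := prim_continuous Lr.
have Lc := sqint_continuous cc.
pose phi (j : 'I_n) x := (j == k)%:R * prim r x.
pose phi' (j : 'I_n) x := (j == k)%:R * r x.
have tphi : testfun phi phi'.
  move=> j; split.
  - by move=> x; apply: cvgM; [exact: cvg_cst|exact: cc].
  - by move=> x; apply: cvgM; [exact: cvg_cst|exact: cr].
  - move=> x x01; have dp := prim_derive cr x01.
    by have := @is_deriveZ _ _ _ _ ((j == k)%:R) _ _ _ dp.
have bphi : bc (fun j => phi j 0) (fun j => phi j 1).
  rewrite (_ : (fun j => phi j 0) = fun=> 0); last first.
    by apply/funext => j; rewrite /phi prim0// mulr0.
  rewrite (_ : (fun j => phi j 1) = fun=> 0)//.
  by apply/funext => j; rewrite /phi r1 mulr0.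
have S (G : 'I_n -> R) : \sum_j (j == k)%:R * G j = G k.
  rewrite (bigD1 k)//= eqxx mul1r big1 ?addr0// => j /negPf ->.
  by rewrite mul0r.
have := weak tphi bphi.
under eq_bigr do rewrite (ipZl _ (Ly t2 _) Lc).
rewrite S; under eq_bigr do rewrite (ipZl _ (Ly t1 _) Lc).
rewrite S -(ipBr Lc (Ly t2 k) (Ly t1 k)) -[X in ip _ X]/(d k).
have -> : tint t1 t2 (fun s =>
    \sum_k0 ip (fun x => lam k0 * phi' k0 x + \sum_j F j k0 * phi j x) (y s k0)) =
  tint t1 t2 (fun s => lam k * ip r (y s k) + \sum_j F k j * ip (prim r) (y s j)).
  apply: eq_Rintegral => s _.
  rewrite -(S (fun j => lam j * ip r (y s j))) -big_split/=.
  apply: eq_bigr => j _.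
  have -> : (fun x => lam j * phi' j x + \sum_i F i j * phi i x) =
    (fun x => (j == k)%:R * lam j * r x + F k j * prim r x).
    apply/funext => x; rewrite /phi' /phi; congr (_ + _); first by ring.
    by under eq_bigr do rewrite mulrCA; rewrite (S (fun i => F i j * prim r x)).
  rewrite (ipDl (Ly s j) (sqintZ _ Lr) (sqintZ _ Lc)).
  by rewrite (ipZl _ (Ly s j) Lr) (ipZl _ (Ly s j) Lc) mulrA.
have cF j : continuous (fun s => F k j * ip (prim r) (y s j)).
  by move=> s; apply: cvgM; [exact: cvg_cst|exact: cip].
have cl : continuous (fun s => lam k * ip r (y s k)).
  by move=> s; apply: cvgM; [exact: cvg_cst|exact: cip].
have cS : continuous (fun s => \sum_j F k j * ip (prim r) (y s j)).
  exact: (@continuous_sum _ _ _ (fun j s => F k j * ip (prim r) (y s j))).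
rewrite (tintD _ _ cl cS) (tintZ _ _ _ (cip Lr)).
rewrite (tint_sum _ t12 cF) -/(ell k r).
under eq_bigr do rewrite (tintZ _ _ _ (cip Lc)).
have E j : tint t1 t2 (fun s => ip (prim r) (y s j)) = - ip r (U j).
  by apply: ell_parts => // x; exact: prim_derive.
under eq_bigr do rewrite E mulrN.
have dp (x : R) : 0 < x < 1 -> is_derive x 1 (prim r) (r x) by exact: prim_derive.
rewrite (ip_parts (Ld k) cc dp cr) r1 mul0r add0r sumrN => H.
have LF j : sqint (fun x => F k j * U j x) by exact: sqintZ.
have LP : sqint (prim (d k)) by apply: sqint_continuous; exact: prim_continuous.
rewrite /W (ipBr Lr (sqint_sum _ LF) LP) (ip_sumr _ Lr LF).
under [X in _ = X - _]eq_bigr do rewrite (ipZr _ Lr (LU _)).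
move: H; move: (\sum_(_ < n) _) (ip _ _) (lam k * _) => *; lra.
Qed.

(** Test functions of mean zero determine [lam k * ell k] up to a constant; pairing with the
    function 1 on an interval of length one fixes it. *)
Let kap k := lam k * ell k (fun=> 1) - ip (fun=> 1) (W k).
Let v0 k x := (lam k)^-1 * (W k x + kap k).

Let cv0 k : continuous (v0 k).
Proof.
move=> x; apply: cvgM; first exact: cvg_cst.
by apply: cvgD; [exact: cW|exact: cvg_cst].
Qed.

Let Lv0 k : sqint (v0 k). Proof. exact: sqint_continuous. Qed.

(** Split [r] into its mean, for which the choice of [kap] is made, and a part of mean zero, for
    which [ell_mean0] applies. *)
Let ell_v0 k r : continuous r -> ell k r = ip r (v0 k).
Proof.
move=> cr; have Lr := sqint_continuous cr.
have L1 := sqint_cst (1 : R).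
pose mean := ip (fun=> 1) r.
pose r0 x := r x - mean * 1.
have Lm : sqint (fun=> mean * 1 : R) := sqintZ mean L1.
have cr0 : continuous r0 by move=> x; apply: cvgB; [exact: cr|exact: cvg_cst].
have r01 : prim r0 1 = 0.
  rewrite prim1 /r0 (ipBr L1 Lr Lm) (ipZr _ L1 L1) ip_cst !mulr1.
  by rewrite -/mean subrr.
have LW : sqint (W k) by exact: sqint_continuous.
have := ell_mean0 k cr0 r01.
have -> : ell k r0 = ell k r - mean * ell k (fun=> 1).
  rewrite /ell -(tintZ _ _ _ (cip L1)).
  have c1 : continuous (fun s => mean * ip (fun=> 1) (y s k)).
    by move=> s; apply: cvgM; [exact: cvg_cst|exact: cip].
  rewrite -(tintB _ _ (cip Lr) c1); apply: eq_Rintegral => s _.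
  by rewrite /r0 (ipBl (Ly s k) Lr Lm) (ipZl _ (Ly s k) L1).
rewrite /r0 (ipBl LW Lr Lm) (ipZl _ LW L1) => H.
have Lk : sqint (fun=> kap k : R) by exact: sqint_cst.
have Ek : ip r (fun=> kap k) = kap k * mean.
  rewrite /mean (ipC (fun=> 1)) -(ipZr _ Lr L1).
  by apply: eq_ip => x _; rewrite mulr1.
rewrite /v0 (ipZr _ Lr (sqintD LW Lk)) (ipDr Lr LW Lk) Ek /kap.
apply: (mulfI (lam0 k)); rewrite mulrA divff// mul1r.
have -> : lam k * ell k r =
    lam k * (ell k r - mean * ell k (fun=> 1)) + lam k * (mean * ell k (fun=> 1)).
  by rewrite mulrBr subrK.
rewrite H; ring.
Qed.

(* [U k] and [prim (v0 k)] have the same distributional derivative, hence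
   differ by the constant [z k]; substituting this in [v0] gives the
   representative [v] with a square-integrable derivative. *)
Let Z k x := U k x - prim (v0 k) x.
Let z k := ip (fun=> 1) (Z k).
Let Zz k x := Z k x - z k * 1.

Let LZ k : sqint (Z k).
Proof.
by apply: sqintB => //; apply: sqint_continuous; exact: prim_continuous.
Qed.

Let LZz k : sqint (Zz k).
Proof. by apply: sqintB => //; exact: sqintZ (sqint_cst 1). Qed.

(** The primitive of [Zz k] vanishes at both ends. Evaluating [ell] on it by [ell_parts] and by
    [ell_v0] shows that [Zz k] is orthogonal to [Z k]; having mean zero, it is orthogonal to
    constants as well, hence to itself. *)
Let Zz0 k : ip (Zz k) (Zz k) = 0.
Proof.
have L1 := sqint_cst (1 : R); have Lz := sqintZ (z k) L1.
have cZz : continuous (Zz k).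
  move=> x; apply: cvgB; last exact: cvg_cst.
  by apply: cvgB; [exact: cU|exact: prim_continuous].
have Zz1 : prim (Zz k) 1 = 0.
  by rewrite prim1 /Zz (ipBr L1 (LZ k) Lz) (ipZr _ L1 L1) ip_cst !mulr1 -/(z k) subrr.
have cp := prim_continuous (LZz k).
have dp (x : R) : 0 < x < 1 -> is_derive x 1 (prim (Zz k)) (Zz k x).
  exact: prim_derive.
have E1 := ell_parts k cp cZz dp Zz1.
have := ell_v0 k cp.
rewrite E1 (ip_parts (Lv0 k) cp dp cZz) Zz1 mul0r add0r => /oppr_inj E2.
have LP : sqint (prim (v0 k)) by apply: sqint_continuous; exact: prim_continuous.
have E3 : ip (Zz k) (Z k) = 0 by rewrite /Z (ipBr (LZz k) (LU k) LP) E2 subrr.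
have E4 : ip (Zz k) (fun=> 1) = 0 by rewrite ipC -prim1.
by rewrite {2}/Zz (ipBr (LZz k) (LZ k) Lz) (ipZr _ (LZz k) L1) E3 E4 mulr0 subrr.
Qed.

Let v k x := (lam k)^-1 * (\sum_j F k j * (prim (v0 j) x + z j) - prim (d k) x + kap k).

Let cv k : continuous (v k).
Proof.
move=> x; apply: cvgM; first exact: cvg_cst.
apply: cvgD; last exact: cvg_cst.
apply: cvgB; last exact: prim_continuous.
apply: (@continuous_sum _ _ _ (fun j x => F k j * (prim (v0 j) x + z j))) => j w.
apply: cvgM; first exact: cvg_cst.
by apply: cvgD; [exact: prim_continuous|exact: cvg_cst].
Qed.

Let Lv k : sqint (v k). Proof. exact: sqint_continuous. Qed.

(** [v0 k] and [v k] differ by a combination of the functions [Zz j], all of norm zero. *)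
Let ip_v k r : sqint r -> ip r (v k) = ip r (v0 k).
Proof.
move=> Lr; apply/eqP; rewrite eq_sym -subr_eq0 -(ipBr Lr (Lv0 k) (Lv k)); apply/eqP.
have LF j : sqint (fun x => F k j * Zz j x) by exact: sqintZ.
have -> : (fun x => v0 k x - v k x) =
  (fun x => (lam k)^-1 * (\sum_j F k j * Zz j x)).
  apply/funext => x; rewrite /v0 /v -mulrBr; congr (_ * _).
  have -> : \sum_j F k j * Zz j x =
     \sum_j F k j * U j x - \sum_j F k j * (prim (v0 j) x + z j).
    by rewrite -sumrB; apply: eq_bigr => j _; rewrite -mulrBr /Zz /Z mulr1 opprD addrA.
  by rewrite /W; move: (\sum_(_ < _) _) (\sum_(_ < _) _) => *; ring.
rewrite (ipZr _ Lr (sqint_sum _ LF)) (ip_sumr _ Lr LF) big1 ?mulr0// => j _.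
by rewrite (ipZr _ Lr (LZz j)) (ip_null (LZz j) Lr (Zz0 j)) mulr0.
Qed.

(** The derivative of [v k] in [x]: the equation Lambda v_x = F v - d solved for v_x. *)
Let g k x := (lam k)^-1 * (\sum_j F k j * v j x - d k x).

Let Lg k : sqint (g k).
Proof.
by apply: sqintZ; apply: sqintB => //; apply: sqint_sum => j; exact: sqintZ.
Qed.

Let prim_g k x :
  prim (g k) x = (lam k)^-1 * (\sum_j F k j * prim (v0 j) x - prim (d k) x).
Proof.
have Lb := sqint_before x.
have LF j : sqint (fun x => F k j * v j x) by exact: sqintZ.
rewrite /prim /g (ipZr _ Lb (sqintB (sqint_sum _ LF) (Ld k))).
rewrite (ipBr Lb (sqint_sum _ LF) (Ld k)) (ip_sumr _ Lb LF).
congr (_ * (_ - _)); apply: eq_bigr => j _.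
by rewrite (ipZr _ Lb (Lv j)) ip_v.
Qed.

Let v_prim k x : v k x = v k 0 + prim (g k) x.
Proof.
rewrite prim_g /v -mulrDr; congr (_ * _).
have -> : \sum_j F k j * (prim (v0 j) 0 + z j) = \sum_j F k j * z j.
  by apply: eq_bigr => j _; rewrite prim0// add0r.
have -> : \sum_j F k j * (prim (v0 j) x + z j) =
   \sum_j F k j * prim (v0 j) x + \sum_j F k j * z j.
  by rewrite -big_split; apply: eq_bigr => j _; rewrite mulrDr.
rewrite prim0//; move: (\sum_(_ < _) _) (\sum_(_ < _) _) => *; ring.
Qed.

(* Tested against the affine function with boundary values [al] and [be]. *)
Let v_bc (al be : 'I_n -> R) : bc al be ->
  \sum_k lam k * (be k * v k 1 - al k * v k 0) = 0.
Proof.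
move=> bcab.
pose phi (k : 'I_n) x := al k + (be k - al k) * x.
pose phi' (k : 'I_n) (x : R) := be k - al k.
have cphi k : continuous (phi k).
  move=> x; apply: cvgD; first exact: cvg_cst.
  by apply: cvgM; [exact: cvg_cst|exact: cvg_id].
have cphi' k : continuous (phi' k) by move=> x; exact: cvg_cst.
have dphi k (x : R) : is_derive x 1 (phi k) (phi' k x).
  have := @is_deriveD _ _ _ _ _ _ _ _ _ (is_derive_cst (al k) x 1)
    (@is_deriveZ _ _ _ _ (be k - al k) _ _ _ (is_derive_id x 1)).
  by rewrite add0r /GRing.scale/= mulr1.
have L1 := sqint_cst (1 : R).
have Lphi k : sqint (phi k) by exact: sqint_continuous.
have Lphi' k : sqint (phi' k) by exact: sqint_continuous.
have tphi : testfun phi phi' by move=> k; split => // x _.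
have := weak tphi.
have -> : (fun k => phi k 0) = al by apply/funext => k; rewrite /phi mulr0 addr0.
have -> : (fun k => phi k 1) = be by apply/funext => k; rewrite /phi mulr1 addrC subrK.
move=> /(_ bcab).
rewrite -sumrB.
under eq_bigr do rewrite -(ipBr (Lphi _) (Ly t2 _) (Ly t1 _)) -/(d _).
have LFp k : sqint (fun x => \sum_j F j k * phi j x).
  by apply: sqint_sum => j; exact: sqintZ.
have cFp k : continuous (fun x => lam k * phi' k x + \sum_j F j k * phi j x).
  move=> x; apply: cvgD.
    by apply: cvgM; [exact: cvg_cst|exact: cphi'].
  apply: (@continuous_sum _ _ _ (fun j x => F j k * phi j x)) => j w.
  by apply: cvgM; [exact: cvg_cst|exact: cphi].
rewrite tint_sum//; last first.
  by move=> k; apply: cip; exact: sqint_continuous.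
have E k : tint t1 t2 (fun s => ip (fun x => lam k * phi' k x + \sum_j F j k * phi j x) (y s k))
  = lam k * (be k - al k) * ip (fun=> 1) (v k) + \sum_j F j k * ip (phi j) (v k).
  rewrite -/(ell k _) (ell_v0 k (cFp k)) -(ip_v k (sqint_continuous (cFp k))).
  rewrite (ipDl (Lv k) (sqintZ _ (Lphi' k)) (LFp k)).
  have LF j : sqint (fun x => F j k * phi j x) by exact: sqintZ.
  rewrite (ip_suml _ (Lv k) LF); congr (_ + _).
    rewrite -(ipZl _ (Lv k) L1); apply: eq_ip => x _.
    by rewrite /phi' mulr1.
  by apply: eq_bigr => j _; rewrite (ipZl _ (Lv k) (Lphi j)).
under [X in _ = X -> _]eq_bigr do rewrite E.
rewrite big_split/= exchange_big/= => H.
(* Integration by parts of [phi k] against [lam k * g k]. Summed over [k], the bulk terms are those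
   of [H], in which exchanging the two sums has turned the transpose of [F] into [F]. *)
have P k : lam k * (be k * v k 1 - al k * v k 0) =
  lam k * (be k - al k) * ip (fun=> 1) (v k) +
  (\sum_j F k j * ip (phi k) (v j) - ip (phi k) (d k)).
  have -> : \sum_j F k j * ip (phi k) (v j) - ip (phi k) (d k) =
    lam k * ip (phi k) (g k).
    have LF j : sqint (fun x => F k j * v j x) by exact: sqintZ.
    rewrite /g (ipZr _ (Lphi k) (sqintB (sqint_sum _ LF) (Ld k))).
    rewrite mulrA divff// mul1r (ipBr (Lphi k) (sqint_sum _ LF) (Ld k)).
    rewrite (ip_sumr _ (Lphi k) LF); congr (_ - _).
    by apply: eq_bigr => j _; rewrite (ipZr _ (Lphi k) (Lv j)).
  have LPg : sqint (prim (g k)) by apply: sqint_continuous; exact: prim_continuous.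
  have dphi0 (x : R) : 0 < x < 1 -> is_derive x 1 (phi k) (phi' k x) by move=> _.
  rewrite (ip_parts (Lg k) (cphi k) dphi0 (cphi' k)).
  have -> : ip (phi' k) (prim (g k)) = (be k - al k) * (ip (fun=> 1) (v k) - v k 0).
    have -> : ip (fun=> 1) (v k) = v k 0 + ip (fun=> 1) (prim (g k)).
      have Lc := sqintZ (v k 0) L1.
      transitivity (ip (fun=> 1) (fun x => v k 0 * 1 + prim (g k) x)).
        by apply: eq_ip => x _; rewrite v_prim mulr1.
      by rewrite (ipDr L1 Lc LPg) (ipZr _ L1 L1) ip_cst !mulr1.
    rewrite [X in _ * X]addrAC subrr add0r -(ipZl _ LPg L1).
    by apply: eq_ip => x _; rewrite mulr1.
  have -> : prim (g k) 1 = v k 1 - v k 0 by rewrite (v_prim k 1) addrAC subrr add0r.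
  rewrite /phi; move: (v k 0) (v k 1) (ip _ _) => *; ring.
under eq_bigr do rewrite P.
rewrite !big_split/= sumrN H.
move: (\sum_(_ < _) _) (\sum_(_ < _) _) => *; ring.
Qed.

(** Here [v] is the time integral of [y], characterised by its pairings with continuous functions,
    and [g] is its derivative in [x]. The boundary condition appears in dual form: the boundary
    values of [v] are annihilated by all admissible boundary values of test functions. *)
Lemma weak_average : exists v g : 'I_n -> R -> R,
  [/\ forall k, sqint (g k),
      forall k x, v k x = v k 0 + prim (g k) x,
      forall k x, lam k * g k x =
        \sum_j F k j * v j x - (y t2 k x - y t1 k x),
      forall k r, continuous r ->
        ip r (v k) = tint t1 t2 (fun s => ip r (y s k)) &
      forall al be, bc al be ->
        \sum_k lam k * (be k * v k 1 - al k * v k 0) = 0].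
Proof.
exists v, g; split => //.
- by move=> k x; rewrite /g mulrA divff// mul1r.
- by move=> k r cr; rewrite (ip_v k (sqint_continuous cr)) -ell_v0.
Qed.

End WeakAverage.

(** * Weighted energies *)

Section WeightedForm.
Context {R : realType} (n : nat).
Variable q : 'I_n -> R -> R.
Hypothesis cq : forall k, continuous (q k).
Hypothesis q0 : forall k x, 0 < x < 1 -> 0 <= q k x.
Implicit Types f g h : 'I_n -> R -> R.

Definition bil f g : R := \sum_k ip (fun x => q k x * f k x) (g k).

Let Lq f : (forall k, sqint (f k)) -> forall k, sqint (fun x => q k x * f k x).
Proof. by move=> Lf k; exact: sqintM_continuous. Qed.

Lemma bilC f g : bil f g = bil g f.
Proof.
apply: eq_bigr => k _; rewrite ipC; apply: eq_ip => x _.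
by rewrite mulrCA mulrA.
Qed.

Lemma bilBr f g h : (forall k, sqint (f k)) -> (forall k, sqint (g k)) ->
  (forall k, sqint (h k)) ->
  bil f (fun k x => g k x - h k x) = bil f g - bil f h.
Proof.
move=> Lf Lg Lh; rewrite /bil -sumrB; apply: eq_bigr => k _.
by rewrite ipBr//; exact: Lq.
Qed.

Lemma bilZr (c : R) f g : (forall k, sqint (f k)) -> (forall k, sqint (g k)) ->
  bil f (fun k x => c * g k x) = c * bil f g.
Proof.
move=> Lf Lg; rewrite /bil mulr_sumr; apply: eq_bigr => k _.
by rewrite ipZr//; exact: Lq.
Qed.

Lemma bil_ge0 f : (forall k, sqint (f k)) -> 0 <= bil f f.
Proof.
move=> Lf; apply: sumr_ge0 => k _; apply: Rintegral_ge0 => x.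
rewrite /= in_itv/= => x01.
by rewrite -mulrA mulr_ge0 ?q0// -expr2 sqr_ge0.
Qed.

Lemma bil_sqrB f g : (forall k, sqint (f k)) -> (forall k, sqint (g k)) ->
  bil (fun k x => f k x - g k x) (fun k x => f k x - g k x) =
  bil f f - 2 * bil f g + bil g g.
Proof.
move=> Lf Lg; have Lfg k : sqint (fun x => f k x - g k x) by exact: sqintB.
rewrite bilBr// bilC (bilC _ g) !bilBr// (bilC g f); ring.
Qed.

(** Nonnegativity of the weighted square of [e * f - g]. The free parameter is later tuned to the
    length of a time interval, so that half of a term can be absorbed or powers of [h] balance. *)
Lemma bil_amgm (e : R) f g : 0 < e ->
  (forall k, sqint (f k)) -> (forall k, sqint (g k)) ->
  2 * bil f g <= e * bil f f + e^-1 * bil g g.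
Proof.
move=> e0 Lf Lg; have Lef k : sqint (fun x => e * f k x) by exact: sqintZ.
have := @bil_ge0 (fun k x => e * f k x - g k x) (fun k => sqintB (Lef k) (Lg k)).
rewrite bil_sqrB// (bilC (fun k x => e * f k x) g) !bilZr// bilC bilZr// (bilC g f).
move: (bil f f) (bil f g) (bil g g) => A B C H.
rewrite -subr_ge0.
have -> : e * A + e^-1 * C - 2 * B = e^-1 * (e * (e * A) - 2 * (e * B) + C).
  by field; rewrite gt_eqF.
by rewrite mulr_ge0// invr_ge0 ltW.
Qed.

Lemma bil_norm_amgm (e : R) f g : 0 < e ->
  (forall k, sqint (f k)) -> (forall k, sqint (g k)) ->
  2 * `|bil f g| <= e * bil f f + e^-1 * bil g g.
Proof.
move=> e0 Lf Lg; have [fg|fg] := ger0P (bil f g); first exact: bil_amgm.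
have L1 k : sqint (fun x => -1 * g k x) by exact: sqintZ.
have E : bil (fun k x => -1 * g k x) (fun k x => -1 * g k x) = bil g g.
  by rewrite (bilZr _ L1 Lg) bilC (bilZr _ Lg Lg); ring.
by have := bil_amgm e0 Lf L1; rewrite E (bilZr _ Lf Lg) mulN1r.
Qed.

Lemma cvg2M {T : Type} (F : set_system T) {FF : Filter F} (p : R -> R)
  (u : T -> R -> R) (f : R -> R) : continuous p ->
  (forall t, sqint (u t)) -> sqint f ->
  cvg2 F u f -> cvg2 F (fun t x => p x * u t x) (fun x => p x * f x).
Proof.
move=> cp Lu Lf uf; have [K K0 HK] := continuous_bounded_itv cp.
apply: (@squeeze_cvgr _ _ _ _ (fun=> 0) (fun t =>
   K ^+ 2 * ip (fun x => u t x - f x) (fun x => u t x - f x))).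
- near=> t; rewrite ip_ge0/=.
  have L1 := sqintB (Lu t) Lf.
  have L2 := sqintB (sqintM_continuous cp (Lu t)) (sqintM_continuous cp Lf).
  rewrite -(ipZr _ L1 L1); apply: le_ip => //; first exact: sqintZ.
  move=> x x01; rewrite -mulrBr.
  have -> : p x * (u t x - f x) * (p x * (u t x - f x)) = p x ^+ 2 * (u t x - f x) ^+ 2 by ring.
  have -> : (u t x - f x) * (K ^+ 2 * (u t x - f x)) = K ^+ 2 * (u t x - f x) ^+ 2 by ring.
  rewrite ler_wpM2r ?sqr_ge0// -(real_normK (num_real (p x))).
  by rewrite lerXn2r ?nnegrE ?(ltW K0)// HK//= in_itv.
- exact: cvg_cst.
- rewrite -(mulr0 (K ^+ 2)); apply: cvgM => //; exact: cvg_cst.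
Unshelve. all: by end_near. Qed.

Lemma bil_dense f (e : R) : (forall k, sqint (f k)) -> 0 < e ->
  exists2 psi : 'I_n -> R -> R, forall k, continuous (psi k) &
    bil (fun k x => f k x - psi k x) (fun k x => f k x - psi k x) < e.
Proof.
move=> Lf e0.
have /choice[K HK] : forall k, exists M : R, 0 < M /\
    forall x : R, `]0, 1[%classic x -> `|q k x| <= M.
  by move=> k; have [M M0 HM] := continuous_bounded_itv (@cq k); exists M.
(* With [n.+1] instead of [n], the sum of the [n] errors stays strictly below [e], and [n = 0] is
   covered. *)
have /choice[psi Hpsi] : forall k, exists g : R -> R, continuous g /\
    ip (fun x => f k x - g x) (fun x => f k x - g x) < e / (K k * n.+1%:R).
  move=> k; have ek : 0 < e / (K k * n.+1%:R).
    by rewrite divr_gt0// mulr_gt0//; have [] := HK k.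
  by have [g cg Hg] := sqint_continuous_dense (Lf k) ek; exists g.
exists psi => [k|]; first by have [] := Hpsi k.
have Hk k : ip (fun x => q k x * (f k x - psi k x)) (fun x => f k x - psi k x)
    <= e / n.+1%:R.
  have [K0 qK] := HK k; have [cpsi H] := Hpsi k.
  have L1 := sqintB (Lf k) (sqint_continuous cpsi).
  have -> : e / n.+1%:R = K k * (e / (K k * n.+1%:R)).
    by rewrite invfM mulrCA mulVKf// gt_eqF.
  apply: (@le_trans _ _ (K k * ip (fun x => f k x - psi k x) (fun x => f k x - psi k x))).
    rewrite -(ipZl _ L1 L1); apply: le_ip => //.
    - exact: sqintM_continuous.
    - exact: sqintZ.
    - move=> x x01; rewrite -!mulrA ler_wpM2r -?expr2 ?sqr_ge0//.
      by rewrite (le_trans (ler_norm _))// qK//= in_itv.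
  by rewrite ler_wpM2l ?ltW.
apply: (@le_lt_trans _ _ (\sum_(k < n) e / n.+1%:R)).
  by apply: ler_sum => k _; exact: Hk.
rewrite sumr_const card_ord -[ltLHS]mulr_natr mulrAC ltr_pdivrMr//.
by rewrite ltr_pM2l// ltr_nat.
Qed.

End WeightedForm.

(** * Two facts about real functions of one variable *)

Section CalculusFacts.
Context {R : realType}.

Lemma is_derive_quadratic (f : R -> R) (x0 C : R) :
  (\forall x \near x0, `|f x - f x0| <= C * (x - x0) ^+ 2) ->
  is_derive x0 1 f 0.
Proof.
move=> H.
suff L : h^-1 *: (f (h *: 1 + x0) - f x0) @[h --> (0 : R)^'] --> (0 : R).
  apply: DeriveDef; last exact: cvg_lim L.
  by apply/cvg_ex; exists 0.
apply/cvgrPdist_le => e e0.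
have C0 : 0 < `|C| + 1 by rewrite ltr_wpDl.
have H2 : \forall h \near (0 : R)^', `|f (h *: 1 + x0) - f x0| <= C * h ^+ 2.
  have cs : h + x0 @[h --> (0 : R)] --> x0.
    by rewrite -[X in _ --> X]add0r; apply: cvgD; [exact: cvg_id|exact: cvg_cst].
  have H3 : \forall h \near (0 : R), `|f (h + x0) - f x0| <= C * (h + x0 - x0) ^+ 2.
    exact: cs H.
  apply: nbhs_dnbhs; apply: filterS H3 => h.
  by rewrite addrK /GRing.scale/= mulr1.
near=> h.
have h0 : h != 0 by near: h; exact: nbhs_dnbhs_neq.
rewrite sub0r normrN normrZ normfV ler_pdivrMl ?normr_gt0//.
have Hh : `|f (h *: 1 + x0) - f x0| <= C * h ^+ 2 by near: h.
have hs : `|h| <= e / (`|C| + 1).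
  near: h; apply: nbhs_dnbhs.
  have : `|h| @[h --> (0 : R)] --> (0 : R).
    by rewrite -[X in _ --> X](@normr0 _ R); apply: cvg_norm; exact: cvg_id.
  move=> /cvgrPdist_le/(_ (e / (`|C| + 1))).
  rewrite divr_gt0// => /(_ isT); apply: filterS => h.
  by rewrite sub0r normrN normr_id.
rewrite (le_trans Hh)// (le_trans (ler_norm _))// normrM normrX expr2 mulrCA.
rewrite ler_wpM2l//.
have := ler_wpM2l (normr_ge0 C) hs; move/le_trans; apply.
by rewrite mulrCA ler_piMr ?(ltW e0)// ler_pdivrMr// mul1r lerDl.
Unshelve. all: by end_near. Qed.

(** Monotonicity is given only strictly inside the interval. If [f t] exceeded [f a], points close
    to [a] and to [t], with values within half the gap, would contradict it. *)
Lemma nonincreasing_closure (a b : R) (f : R -> R) : continuous f ->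
  (forall s t : R, a < s -> s <= t -> t < b -> f t <= f s) ->
  forall t, a <= t <= b -> f t <= f a.
Proof.
move=> cf H t /andP[]; rewrite le_eqVlt => /predU1P[<- //|at_ tb].
rewrite leNgt; apply/negP => fat.
pose e := (f t - f a) / 2; have e0 : 0 < e by rewrite divr_gt0// subr_gt0.
pose m := (a + t) / 2.
have am : a < m by rewrite /m; lra.
have mt : m < t by rewrite /m; lra.
have [s [sa sm fs]] : exists s, [/\ a < s, s < m & f s < f a + e].
  have near_s : \forall s \near a^'+, [/\ a < s, s < m & f s < f a + e].
    near=> s; split.
    - by near: s; exact: nbhs_right_gt.
    - by near: s; exact: nbhs_right_lt.
    - near: s; apply: (cvgr_lt (f a)); last by rewrite ltrDl.
      exact/cvg_at_right_filter/cf.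
  by have [s] := filter_ex near_s; exists s.
have [u [um ut fu]] : exists u, [/\ m < u, u < t & f t - e < f u].
  have near_u : \forall u \near t^'-, [/\ m < u, u < t & f t - e < f u].
    near=> u; split.
    - by near: u; exact: nbhs_left_gt.
    - by near: u; exact: nbhs_left_lt.
    - near: u; apply: (cvgr_gt (f t)); last by rewrite gtrBl.
      exact/cvg_at_left_filter/cf.
  by have [u] := filter_ex near_u; exists u.
have := H s u sa (ltW (lt_trans sm um)) (lt_le_trans ut tb).
by rewrite leNgt => /negP; apply; move: fs fu; rewrite /e; lra.
Unshelve. all: by end_near. Qed.

End CalculusFacts.

(** * Decay of a weighted energy between two switches *)

Section EnergyDecay.
Context {R : realType} (n : nat).
Variables (lam : 'I_n -> R) (F : 'I_n -> 'I_n -> R).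
Hypothesis lam0 : forall k, lam k != 0.
Variables (y : R -> 'I_n -> R -> R).
Hypothesis Ly : forall s k, sqint (y s k).
Hypothesis cy : forall k (s : R), cvg2 (nbhs s) (fun t => y t k) (y s k).
Variable (bc : ('I_n -> R) -> ('I_n -> R) -> Prop).
Hypothesis bc0 : bc (fun=> 0) (fun=> 0).
Variables (a T : R).
Hypothesis weak : forall t1 t2, a <= t1 -> t1 <= t2 -> t2 <= T ->
  forall phi phi', testfun phi phi' ->
  bc (fun k => phi k 0) (fun k => phi k 1) ->
  \sum_k ip (phi k) (y t2 k) - \sum_k ip (phi k) (y t1 k) =
  tint t1 t2 (fun s =>
    \sum_k ip (fun x => lam k * phi' k x + \sum_j F j k * phi j x) (y s k)).
Variables (q q' : 'I_n -> R -> R) (nu : R).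
Hypothesis cq : forall k, continuous (q k).
Hypothesis cq' : forall k, continuous (q' k).
Hypothesis dq : forall k (x : R), 0 < x < 1 -> is_derive x 1 (q k) (q' k x).
Hypothesis q_ge0 : forall k x, 0 < x < 1 -> 0 <= q k x.
Hypothesis nu0 : 0 < nu.
Hypothesis dissipation : forall (x : R) (u : 'I_n -> R), 0 < x < 1 ->
  \sum_k (2 * (q k x * u k * \sum_j F k j * u j) + lam k * (q' k x * u k ^+ 2)) <=
  - (2 * nu) * \sum_k q k x * u k * u k.
(** The premise is the boundary condition on (u0, u1) in dual form; the conclusion says that the net
    energy flux through the two ends is not incoming. *)
Hypothesis boundary : forall u0 u1 : 'I_n -> R,
  (forall al be, bc al be -> \sum_k lam k * (be k * u1 k - al k * u0 k) = 0) ->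
  \sum_k lam k * (q k 0 * u0 k ^+ 2 - q k 1 * u1 k ^+ 2) <= 0.

Let N2 s := bil q (y s) (y s).
Let G psi s := bil q psi (y s).

Let cG psi : (forall k, sqint (psi k)) -> continuous (G psi).
Proof.
move=> Lpsi; apply: continuous_sum => k.
apply: (@continuous_ip _ (fun s => y s k)) => //.
by apply: sqintM_continuous => //; exact: cq.
Qed.

Let cN2 : continuous N2.
Proof.
apply: continuous_sum => k s.
apply: cvg_ip (cy k s).
- by move=> t; apply: sqintM_continuous.
- by [].
- exact: sqintM_continuous.
- by [].
- by apply: (@cvg2M _ _ (nbhs s) _ (q k) (fun t => y t k)).
Qed.

(* [v] is the integral of [y] over [t, t + h]; unlike [y] it has traces at
   [x = 0] and [x = 1]. *)
Let single_average t h : a <= t -> 0 < h -> t + h <= T ->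
  exists v : 'I_n -> R -> R,
  [/\ forall k, continuous (v k),
      forall psi, (forall k, continuous (psi k)) ->
        bil q psi v = tint t (t + h) (G psi) &
      2 * bil q v (fun k x => y (t + h) k x - y t k x) <=
        - (2 * nu) * bil q v v].
Proof.
move=> at_ h0 thT; have tth : t <= t + h by rewrite lerDl ltW.
have [v [g [Lg vE gE ipE bcE]]] := weak_average lam0 Ly cy tth bc0 (weak at_ tth thT).
have cv k : continuous (v k).
  move=> x; rewrite (_ : v k = fun x => v k 0 + prim (g k) x); last first.
    by apply/funext => z.
  by apply: cvgD; [exact: cvg_cst|exact: prim_continuous].
have Lv k : sqint (v k) by exact: sqint_continuous.
have Lqv k : sqint (fun x => q k x * v k x) by exact: sqintM_continuous.
exists v; split => //.
  move=> psi cpsi.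
  have cqpsi k : continuous (fun x => q k x * psi k x).
    by move=> x; apply: cvgM; [exact: cq|exact: cpsi].
  rewrite /bil; under eq_bigr do rewrite ipE//.
  rewrite -tint_sum// => k; apply: (@continuous_ip _ (fun s => y s k)) => //.
  exact: sqint_continuous.
pose Fv k x := \sum_j F k j * v j x.
have cFv k : continuous (Fv k).
  apply: (@continuous_sum _ _ _ (fun j x => F k j * v j x)) => j x.
  by apply: cvgM; [exact: cvg_cst|exact: cv].
have LFv k : sqint (Fv k) by exact: sqint_continuous.
have cv2 k : continuous (fun x => v k x ^+ 2).
  by move=> x; under eq_fun do rewrite expr2; apply: (cvgM (cv k x) (cv k x)).
have Lv2 k : sqint (fun x => v k x ^+ 2) by exact: sqint_continuous.
have Lq' k : sqint (q' k) by exact: sqint_continuous.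
pose A k x := 2 * (q k x * v k x * Fv k x) + lam k * (q' k x * v k x ^+ 2).
have cA k : continuous (A k).
  move=> x; apply: cvgD; (apply: cvgM; first exact: cvg_cst).
    by apply: cvgM; [apply: cvgM; [exact: cq|exact: cv]|exact: cFv].
  by apply: cvgM; [exact: cq'|exact: cv2].
have LA k : sqint (A k) by exact: sqint_continuous.
have L1 := sqint_cst (1 : R).
(* Energy identity for one component: by [gE] the increment is F v - Lambda v_x, and [ip_square]
   turns the integral of 2 q v v_x into boundary values minus the integral of q' v^2. *)
have E k : 2 * ip (fun x => q k x * v k x) (fun x => y (t + h) k x - y t k x) =
  ip (fun=> 1) (A k) + lam k * (q k 0 * v k 0 ^+ 2 - q k 1 * v k 1 ^+ 2).
  have Llg := sqintZ (lam k) (Lg k).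
  have -> : (fun x => y (t + h) k x - y t k x) = (fun x => Fv k x - lam k * g k x).
    by apply/funext => x; rewrite gE /Fv opprB addrCA subrr addr0.
  rewrite (ipBr (Lqv k) (LFv k) Llg) (ipZr _ (Lqv k) (Lg k)).
  have := ip_square (v k 0) (Lg k) (@cq k) (dq k) (@cq' k).
  have -> : (fun x => q k x * (v k 0 + prim (g k) x)) = (fun x => q k x * v k x).
    by apply/funext => x; rewrite -vE.
  have -> : (fun x => (v k 0 + prim (g k) x) ^+ 2) = (fun x => v k x ^+ 2).
    by apply/funext => x; rewrite -vE.
  rewrite -!vE => S.
  have -> : ip (fun=> 1) (A k) = 2 * ip (fun x => q k x * v k x) (Fv k) +
     lam k * ip (q' k) (fun x => v k x ^+ 2).
    have Lp1 : sqint (fun x => q k x * v k x * Fv k x).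
      by apply: sqint_continuous => x; apply: cvgM; [apply: cvgM; [exact: cq|exact: cv]|exact: cFv].
    have Lp2 : sqint (fun x => q' k x * v k x ^+ 2).
      by apply: sqint_continuous => x; apply: cvgM; [exact: cq'|exact: cv2].
    rewrite /A (ipDr L1 (sqintZ 2 Lp1) (sqintZ (lam k) Lp2)).
    rewrite (ipZr _ L1 Lp1) (ipZr _ L1 Lp2).
    by congr (_ * _ + _ * _); apply: eq_ip => x _; rewrite mul1r.
  move: S; move: (ip (fun x => q k x * v k x) (g k)) (ip _ (Fv k)) (ip (q' k) _) (lam k) => *.
  nra.
rewrite /bil mulr_sumr; under eq_bigr do rewrite E.
rewrite big_split/= -(ip_sumr _ L1 LA).
have H1 : \sum_(k < n) lam k * (q k 0 * v k 0 ^+ 2 - q k 1 * v k 1 ^+ 2) <= 0.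
  exact: boundary.
have H2 : ip (fun=> 1) (fun x => \sum_k A k x) <=
  - (2 * nu) * \sum_k ip (fun x => q k x * v k x) (v k).
  have Lqvv k : sqint (fun x => q k x * v k x * v k x).
    by apply: sqint_continuous => x; apply: cvgM; [apply: cvgM; [exact: cq|exact: cv]|exact: cv].
  have -> : \sum_k ip (fun x => q k x * v k x) (v k) =
     ip (fun=> 1) (fun x => \sum_k q k x * v k x * v k x).
    rewrite (ip_sumr _ L1 Lqvv); apply: eq_bigr => k _.
    by apply: eq_ip => x _; rewrite mul1r.
  rewrite -(ipZr _ L1 (sqint_sum _ Lqvv)); apply: le_ip => //.
  - exact: sqint_sum.
  - by apply: sqintZ; exact: sqint_sum.
  - by move=> x x01; rewrite !mul1r; exact: dissipation.
by rewrite (le_trans (lerD H2 H1))// addr0.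
Qed.

(** * Energy of the averages over a fixed time step [h] *)

Section FixedStep.
Variables (h : R) (h0 : 0 < h) (v : R -> 'I_n -> R -> R).
Hypothesis cv : forall t k, a <= t <= T - h -> continuous (v t k).
Hypothesis ipv : forall t, a <= t <= T - h ->
  forall psi, (forall k, continuous (psi k)) -> bil q psi (v t) = tint t (t + h) (G psi).
Hypothesis decv : forall t, a <= t <= T - h ->
  2 * bil q (v t) (fun k x => y (t + h) k x - y t k x) <=
        - (2 * nu) * bil q (v t) (v t).

Let E t := bil q (v t) (v t).

Let Lv t k : a <= t <= T - h -> sqint (v t k).
Proof. by move=> tI; apply: sqint_continuous; exact: cv. Qed.

Let dist t t0 := bil q (fun k x => v t k x - v t0 k x) (fun k x => v t k x - v t0 k x).

(* [v t - v t0] is the difference of the integrals of [y] over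
   [t0 + h, t + h] and [t0, t]. *)
Let dist_lt (M t0 t : R) : (forall s, a <= s <= T -> N2 s <= M) ->
  a <= t0 -> t0 < t -> t <= T - h ->
  dist t t0 <= 4 * M * (t - t0) ^+ 2.
Proof.
move=> HM at0 t0t tT.
have tI : a <= t <= T - h by rewrite tT (le_trans at0 (ltW t0t)).
have t0I : a <= t0 <= T - h by rewrite at0 (le_trans (ltW t0t) tT).
pose del k x := v t k x - v t0 k x.
have cdel k : continuous (del k).
  by move=> x; apply: cvgB; apply: cv.
have Ldel k : sqint (del k) by exact: sqint_continuous.
have Lvt k : sqint (v t k) by exact: Lv.
have Lvt0 k : sqint (v t0 k) by exact: Lv.
have cGd := cG Ldel.
set B := dist t t0.
have B0 : 0 <= B by exact: bil_ge0.
have EB : B = tint (t0 + h) (t + h) (G del) - tint t0 t (G del).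
  rewrite /B /dist -/del (bilBr cq Ldel Lvt Lvt0) (ipv tI cdel) (ipv t0I cdel).
  have := tint_split cGd (ltW t0t) (_ : t <= t + h).
  rewrite lerDl (ltW h0) => /(_ isT) S1.
  have := tint_split cGd (_ : t0 <= t0 + h) (_ : t0 + h <= t + h).
  rewrite lerDl lerD2r (ltW h0) (ltW t0t) => /(_ isT isT).
  rewrite S1 => S2.
  have -> : tint t (t + h) (G del) = tint t0 (t0 + h) (G del) +
      tint (t0 + h) (t + h) (G del) - tint t0 t (G del).
    by rewrite -S2 addrAC subrr add0r.
  by ring.
have d0 : 0 < t - t0 by rewrite subr_gt0.
(* Chosen so that [e * B * (t - t0)] equals [B / 2], which is absorbed by the left-hand side of
   [H3]. *)
pose e := (2 * (t - t0))^-1.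
have e0 : 0 < e by rewrite invr_gt0 mulr_gt0.
have ei : e^-1 = 2 * (t - t0) by rewrite invrK.
have HG s : a <= s <= T -> `|G del s| <= (e * B + e^-1 * M) / 2.
  move=> sI; rewrite ler_pdivlMr// mulrC.
  apply: (le_trans (bil_norm_amgm cq q_ge0 e0 Ldel (Ly s))).
  by rewrite lerD2l; apply: ler_wpM2l; [rewrite invr_ge0 ltW|exact: HM].
have H1 : `|tint (t0 + h) (t + h) (G del)| <= (e * B + e^-1 * M) / 2 * (t - t0).
  have -> : t - t0 = t + h - (t0 + h) by ring.
  apply: tint_norm_le => //; first by rewrite lerD2r ltW.
  move=> s /andP[s1 s2]; apply: HG; apply/andP; split.
    by rewrite (le_trans _ s1)// (le_trans at0)// lerDl ltW.
  by rewrite (le_trans s2)// -lerBrDr.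
have H2 : `|tint t0 t (G del)| <= (e * B + e^-1 * M) / 2 * (t - t0).
  apply: tint_norm_le => //; first exact: ltW.
  move=> s /andP[s1 s2]; apply: HG; rewrite (le_trans at0 s1)/=.
  by rewrite (le_trans s2)// (le_trans tT)// gerBl ltW.
have H3 : B <= (e * B + e^-1 * M) * (t - t0).
  rewrite [leLHS]EB (le_trans (ler_norm _))// (le_trans (ler_normB _ _))//.
  by rewrite (le_trans (lerD H1 H2))//; lra.
have H4 : (e * B + e^-1 * M) * (t - t0) = B / 2 + 2 * M * (t - t0) ^+ 2.
  by rewrite ei /e; field; rewrite gt_eqF.
by move: H3; rewrite H4; lra.
Qed.

Let dist_sym t t0 : a <= t <= T - h -> a <= t0 <= T - h -> dist t t0 = dist t0 t.
Proof.
move=> tI t0I; rewrite /dist !bil_sqrB//; try (by move=> k; exact: Lv).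
by rewrite (bilC _ (v t0)); ring.
Qed.

Let dist_self t : a <= t <= T - h -> dist t t = 0.
Proof.
by move=> tI; rewrite /dist bil_sqrB//; [ring|move=> k; exact: Lv|move=> k; exact: Lv].
Qed.

(* [E s = 2 * bil q (v t0) (v s) - E t0 + dist s t0], where the middle terms
   are explicit and [dist s t0] is quadratic in [s - t0]. *)
Let E_derive t0 : a < t0 < T - h ->
  is_derive t0 1 E (2 * (G (v t0) (t0 + h) - G (v t0) t0)).
Proof.
move=> /andP[at0 t0T].
have t0I : a <= t0 <= T - h by rewrite !ltW.
have Lvt0 k : sqint (v t0 k) by exact: Lv.
have [M M0 HM] := continuous_bounded_segment a T cN2.
have HM' s : a <= s <= T -> N2 s <= M by move=> /HM; exact: le_trans (ler_norm _).
have cGv := cG Lvt0.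
pose c := a - 1.
have ca : c < a by rewrite /c ltrBlDr ltrDl.
pose P s := tint c s (G (v t0)).
have nearI : \forall s \near t0, a < s < T - h.
  near=> s; apply/andP; split; near: s; [exact: lt_nbhsr|exact: lt_nbhsl].
have dd : is_derive t0 1 (dist ^~ t0) 0.
  apply: (@is_derive_quadratic _ _ _ (4 * M)).
  near=> s; have /andP[sa sT] : a < s < T - h by near: s.
  have sI : a <= s <= T - h by rewrite !ltW.
  rewrite dist_self// subr0 ger0_norm; last first.
    by apply: bil_ge0 => // k; apply: sqintB; exact: Lv.
  have [st|ts|->] := ltgtP s t0.
  - rewrite dist_sym//; have -> : (s - t0) ^+ 2 = (t0 - s) ^+ 2 by ring.
    by apply: dist_lt => //; exact: ltW.
  - by apply: dist_lt => //; exact: ltW.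
  - by rewrite dist_self// subrr expr0n mulr0.
have dP1 : is_derive t0 1 P (G (v t0) t0).
  by apply: tint_derive => //; exact: lt_trans at0.
have dP2 : is_derive t0 1 (fun s => P (s + h)) (G (v t0) (t0 + h)).
  have dsh : is_derive t0 1 (fun s : R => s + h) 1.
    have := @is_deriveD _ _ _ _ _ _ _ _ _ (is_derive_id t0 (1 : R)) (is_derive_cst h t0 1).
    by rewrite addr0.
  have dPh : is_derive (t0 + h) 1 P (G (v t0) (t0 + h)).
    by apply: tint_derive => //; rewrite (lt_trans ca)// (lt_trans at0)// ltrDl.
  have := @is_derive1_comp _ P (fun s : R => s + h) t0 _ _ dPh dsh.
  by rewrite mulr1.
have dR : is_derive t0 1 ((2 \*: ((fun s => P (s + h)) - P) - cst (E t0)) + dist ^~ t0)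
   (2 *: (G (v t0) (t0 + h) - G (v t0) t0) - 0 + 0).
  apply: is_deriveD; apply: is_deriveB; apply: is_deriveZ; exact: is_deriveB.
rewrite subr0 addr0 in dR.
apply: (near_eq_is_derive _ dR).
near=> s; have /andP[sa sT] : a < s < T - h by near: s.
have sI : a <= s <= T - h by rewrite !ltW.
have Lvs k : sqint (v s k) by exact: Lv.
have cvt0 k : continuous (v t0 k) by exact: cv.
rewrite !fctE /= /GRing.scale/= /dist (bil_sqrB cq Lvs Lvt0).
rewrite (bilC _ (v s) (v t0)) (ipv sI cvt0).
have cs : c <= s by rewrite ltW// (lt_trans ca).
rewrite /P (tint_split cGv cs (_ : s <= s + h)) ?lerDl ?(ltW h0)//.
by rewrite /E; ring.
Unshelve. all: by end_near. Qed.

(** Gronwall: the derivative of [expR (2 * nu * s) * E s] is a positive multiple of E' + 2 nu E,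
    which [decv] makes nonpositive. The interval is open at both ends because [E_derive] is
    two-sided. *)
Let E_decay t' t : a < t' -> t' <= t -> t < T - h ->
  expR (2 * nu * t) * E t <= expR (2 * nu * t') * E t'.
Proof.
move=> at' t't tT.
pose f s := expR (2 * nu * s) * E s.
have df s : a < s < T - h -> is_derive s 1 f
    (expR (2 * nu * s) * (2 * (G (v s) (s + h) - G (v s) s) + 2 * nu * E s)).
  move=> sI.
  have dl : is_derive s 1 (fun s : R => 2 * nu * s) (2 * nu).
    have := @is_deriveZ _ _ _ _ (2 * nu) _ _ _ (is_derive_id s (1 : R)).
    by rewrite /GRing.scale/= mulr1.
  have de := @is_derive1_comp _ expR (fun s : R => 2 * nu * s) s _ _
    (is_derive_expR (2 * nu * s)) dl.
  have := is_deriveM de (E_derive sI).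
  move/is_derive_eq; apply.
  by rewrite /GRing.scale/=; ring.
have sub s : t' <= s <= t -> a < s < T - h.
  by move=> /andP[s1 s2]; rewrite (lt_le_trans at' s1) (le_lt_trans s2 tT).
apply: (@ler0_derive1_le_cc _ f t' t) => //.
- by move=> s; rewrite in_itv/= => /andP[s1 s2]; have [] := df s (sub s _); rewrite ?ltW.
- move=> s; rewrite in_itv/= => /andP[s1 s2]; rewrite derive1E.
  have sI := sub s (_ : t' <= s <= t); rewrite !ltW// in sI.
  have [_ ->] := df s (sI isT).
  have /andP[s3 s4] := sI isT.
  have sI' : a <= s <= T - h by rewrite !ltW.
  rewrite pmulr_rle0 ?expR_gt0//.
  have Lvs k : sqint (v s k) by exact: Lv.
  by have := decv sI'; rewrite (bilBr cq Lvs (Ly _) (Ly _)) -/(E s) /G; lra.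
- apply: derivable_within_continuous => s; rewrite in_itv/= => sI.
  by have [] := df s (sub s sI).
- by rewrite in_itv/= lexx t't.
- by rewrite in_itv/= lexx t't.
Qed.

(* After division by [h ^+ 2] both sides converge as [h] tends to [0]; the
   left one to [2 * G psi t - bil q psi psi], which is close to [N2 t] when
   [psi] is close to [y t]. *)
Lemma average_decay psi t' t : (forall k, continuous (psi k)) ->
  a < t' -> t' <= t -> t < T - h ->
  2 * h * tint t (t + h) (G psi) - h ^+ 2 * bil q psi psi <=
  expR (- (2 * nu * (t - t'))) * (h * tint t' (t' + h) N2).
Proof.
move=> cpsi at' t't tT.
have tI : a <= t <= T - h by rewrite (le_trans (ltW at') t't) ltW.
have t'I : a <= t' <= T - h by rewrite ltW// (le_trans t't)// ltW.
have Lpsi k : sqint (psi k) by exact: sqint_continuous.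
have Lvt k : sqint (v t k) by exact: Lv.
have Lvt' k : sqint (v t' k) by exact: Lv.
have cvt' k : continuous (v t' k) by exact: cv.
(* Young's inequality with parameter [h], multiplied by [h]. *)
have H1 : 2 * h * tint t (t + h) (G psi) - h ^+ 2 * bil q psi psi <= E t.
  rewrite -(ipv tI cpsi).
  have := bil_amgm cq q_ge0 h0 Lpsi Lvt; rewrite -/(E t) => H.
  have := ler_wpM2l (ltW h0) H.
  have -> : h * (h * bil q psi psi + h^-1 * E t) = h ^+ 2 * bil q psi psi + E t.
    by field; rewrite gt_eqF.
  by rewrite lerBlDl; apply: le_trans; rewrite le_eqVlt; apply/orP; left; apply/eqP; ring.
(* Cauchy-Schwarz in time, obtained by pairing [v t'] with itself: Young's inequality with parameter
   [h^-1] leaves half of [E t'] on the right after integration over a step of length [h], and this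
   half is absorbed. *)
have H2 : E t' <= h * tint t' (t' + h) N2.
  have cGv := cG Lvt'.
  have cc : continuous (fun _ : R => E t' / (2 * h)) by move=> x; exact: cvg_cst.
  have cN : continuous (fun s => h / 2 * N2 s).
    by move=> s; apply: cvgM; [exact: cvg_cst|exact: cN2].
  have cD : continuous (fun s => E t' / (2 * h) + h / 2 * N2 s).
    by move=> s; apply: cvgD; [exact: cc|exact: cN].
  have : E t' <= tint t' (t' + h) (fun s => E t' / (2 * h) + h / 2 * N2 s).
    rewrite {1}/E (ipv t'I cvt'); apply: le_tint => // s _.
    have hi0 : 0 < h^-1 by rewrite invr_gt0.
    have := bil_amgm cq q_ge0 hi0 Lvt' (Ly s); rewrite invrK -/(E t') -/(N2 s) -/(G (v t') s).
    have -> : E t' / (2 * h) = h^-1 * E t' / 2 by field; rewrite gt_eqF.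
    by lra.
  rewrite (tintD _ _ cc cN) (tintZ _ _ _ cN2) tint_cst ?lerDl ?(ltW h0)//.
  have -> : E t' / (2 * h) * (t' + h - t') = E t' / 2 by field; rewrite gt_eqF.
  by move: (tint _ _ _) => I; lra.
apply: (le_trans H1).
have H3 := E_decay at' t't tT.
have -> : - (2 * nu * (t - t')) = 2 * nu * t' - 2 * nu * t by ring.
rewrite expRD expRN.
have et : 0 < expR (2 * nu * t) by exact: expR_gt0.
rewrite mulrAC ler_pdivlMr// mulrC (le_trans H3)//.
by rewrite ler_wpM2l// ltW// expR_gt0.
Qed.

End FixedStep.

(** The estimate is proved at times strictly between [a] and [T], where the averages can be
    differentiated, by letting the step shrink in [average_decay]; continuity of [N2] then carries
    it to the end points. *)
Lemma energy_decay t : a <= t <= T ->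
  bil q (y t) (y t) <= expR (- (2 * nu * (t - a))) * bil q (y a) (y a).
Proof.
have arith1 (N w1 we g p e1 e2 : R) : e1 = e2 / 4 -> we <= e1 ->
    2 * (g - e1) - p <= w1 + we -> N - 2 * g + p < e1 -> N <= w1 + e2.
  by move=> ->; lra.
have arith2 (h g p w N I1 I2 : R) : 2 * h * (h * g) <= 2 * h * I1 ->
    w * (h * I2) <= w * (h * (h * N)) ->
    2 * h * I1 - h ^+ 2 * p <= w * (h * I2) ->
    h ^+ 2 * (2 * g - p) <= h ^+ 2 * (w * N).
  have -> : h ^+ 2 * (2 * g - p) = 2 * h * (h * g) - h ^+ 2 * p by ring.
  have -> : h ^+ 2 * (w * N) = w * (h * (h * N)) by ring.
  lra.
have interior t' s : a < t' -> t' <= s -> s < T ->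
    N2 s <= expR (- (2 * nu * (s - t'))) * N2 t'.
  move=> at' t's sT.
  set w := expR _.
  have w0 : 0 < w by exact: expR_gt0.
  have w1 : w <= 1.
    rewrite /w -expR0 ler_expR oppr_le0 mulr_ge0 ?subr_ge0//.
    by rewrite mulr_ge0// ltW.
  apply/ler_addgt0Pr => e0 e00.
  (* Four errors of size [e] add up: one from approximating [y s] by [psi], two from [2 * G psi],
     one from [N2] near [t'], where the factor [w] is at most 1. *)
  pose e := e0 / 4; have e_gt0 : 0 < e by rewrite divr_gt0.
  have [psi cpsi Hpsi] := bil_dense cq (Ly s) e_gt0.
  have Lpsi k : sqint (psi k) by exact: sqint_continuous.
  have cGp := cG Lpsi.
  have /cvgrPdist_le/(_ _ e_gt0)[d1 /= d10 Hd1] := cGp s.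
  have /cvgrPdist_le/(_ _ e_gt0)[d2 /= d20 Hd2] := @cN2 t'.
  (* Strictly below the moduli of continuity of [G psi] at [s] and of [N2] at [t'], and below
     [T - s], so that [s + h] stays inside the interval. *)
  pose h := Num.min (Num.min d1 d2) (T - s) / 2.
  have m0 : 0 < Num.min (Num.min d1 d2) (T - s) by rewrite !lt_min d10 d20 subr_gt0.
  have h0 : 0 < h by rewrite divr_gt0.
  have hm : h < Num.min (Num.min d1 d2) (T - s) by rewrite /h ltr_pdivrMr// ltr_pMr// ltr1n.
  have /andP[/andP[hd1 hd2] hT] : (h < d1) && (h < d2) && (h < T - s).
    by move: hm; rewrite !lt_min.
  have sTh : s < T - h by rewrite ltrBrDl -ltrBrDr.
  have /choice[v Hv] : forall t : R, exists v : 'I_n -> R -> R, a <= t <= T - h ->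
    [/\ forall k, continuous (v k),
      forall psi, (forall k, continuous (psi k)) ->
        bil q psi v = tint t (t + h) (G psi) &
      2 * bil q v (fun k x => y (t + h) k x - y t k x) <=
        - (2 * nu) * bil q v v].
    (* Outside [a, T - h] nothing is required, and [psi] serves as an arbitrary value. *)
    move=> r; have [/andP[ar rT]|] := boolP (a <= r <= T - h); last by exists psi.
    have rhT : r + h <= T by rewrite -lerBrDr.
    by have [v Hv] := single_average ar h0 rhT; exists v.
  have := @average_decay h h0 v _ _ _ psi t' s cpsi at' t's sTh.
  move=> /(_ _ _ _)/wrap[|||H].
  - by move=> r k /Hv[].
  - by move=> r /Hv[].
  - by move=> r /Hv[].
  have cc (z : R) : continuous (fun _ : R => z) by move=> x; exact: cvg_cst.
  have L1 : h * (G psi s - e) <= tint s (s + h) (G psi).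
    have -> : h * (G psi s - e) = tint s (s + h) (fun=> G psi s - e).
      by rewrite tint_cst ?lerDl ?(ltW h0)//; ring.
    apply: le_tint => // r /andP[r1 r2].
    have /Hd1 : `|s - r| < d1.
      by rewrite distrC ger0_norm ?subr_ge0//; apply: le_lt_trans hd1; rewrite lerBlDl.
    by rewrite /= ler_norml => /andP[_]; rewrite lerBlDr lerBlDl addrC.
  have L2 : tint t' (t' + h) N2 <= h * (N2 t' + e).
    have -> : h * (N2 t' + e) = tint t' (t' + h) (fun=> N2 t' + e).
      by rewrite tint_cst ?lerDl ?(ltW h0)//; ring.
    apply: le_tint => // r /andP[r1 r2].
    have /Hd2 : `|t' - r| < d2.
      by rewrite distrC ger0_norm ?subr_ge0//; apply: le_lt_trans hd2; rewrite lerBlDl.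
    by rewrite /= ler_norml => /andP[+ _]; rewrite lerBrDl lerBlDr addrC.
  have H2 : h ^+ 2 * (2 * (G psi s - e) - bil q psi psi) <= h ^+ 2 * (w * (N2 t' + e)).
    have h20 : 0 <= 2 * h by rewrite mulr_ge0// ltW.
    have M1 := ler_wpM2l h20 L1.
    have M2 := ler_wpM2l (ltW w0) (ler_wpM2l (ltW h0) L2).
    exact: arith2 M1 M2 H.
  have {H2} := H2; rewrite ler_pM2l ?exprn_gt0// => H2.
  have := Hpsi; rewrite (bil_sqrB cq (Ly s) Lpsi) (bilC q (y s) psi) -/(G psi s) -/(N2 s) => H3.
  have H4 : w * e <= e by rewrite ler_piMl// ltW.
  by rewrite [w * (_ + _)]mulrDr in H2; exact: (arith1 _ _ _ _ _ e e0 erefl H4 H2 H3).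
have cf : continuous (fun s => expR (2 * nu * s) * N2 s).
  move=> s; apply: cvgM; last exact: cN2.
  apply: (@continuous_comp _ _ _ (fun s => 2 * nu * s) expR).
    by apply: cvgM; [exact: cvg_cst|exact: cvg_id].
  exact: continuous_expR.
move=> tI.
have -> : - (2 * nu * (t - a)) = 2 * nu * a - 2 * nu * t by ring.
rewrite expRD expRN mulrAC ler_pdivlMr ?expR_gt0// mulrC -/(N2 t) -/(N2 a).
apply: (nonincreasing_closure cf _ tI) => s r as_ sr rT.
have := interior s r as_ sr rT.
have -> : - (2 * nu * (r - s)) = 2 * nu * s - 2 * nu * r by ring.
by rewrite expRD expRN mulrAC ler_pdivlMr ?expR_gt0// mulrC.
Qed.

End EnergyDecay.

(** * The weights of a mode *)

Section Dot.
Context {R : realType}.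

Lemma dotvE n (u v : 'cV[R]_n) : dotv u v = \sum_k u k 0 * v k 0.
Proof. by rewrite /dotv mxE; apply: eq_bigr => k _; rewrite mxE. Qed.

Lemma dotvC n (u v : 'cV[R]_n) : dotv u v = dotv v u.
Proof. by rewrite !dotvE; apply: eq_bigr => k _; rewrite mulrC. Qed.

Lemma dotvDr n (u v w : 'cV[R]_n) : dotv u (v + w) = dotv u v + dotv u w.
Proof. by rewrite /dotv mulmxDr mxE. Qed.

Lemma dotvBr n (u v w : 'cV[R]_n) : dotv u (v - w) = dotv u v - dotv u w.
Proof. by rewrite /dotv mulmxBr !mxE. Qed.

Lemma dotvZr n (c : R) (u v : 'cV[R]_n) : dotv u (c *: v) = c * dotv u v.
Proof. by rewrite /dotv -scalemxAr mxE. Qed.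

Lemma dotv_mulmxl n k (A : 'M[R]_(k, n)) (u : 'cV[R]_n) (v : 'cV[R]_k) :
  dotv (A *m u) v = dotv u (A^T *m v).
Proof. by rewrite /dotv trmx_mul mulmxA. Qed.

Lemma dotv_ge0 n (u : 'cV[R]_n) : 0 <= dotv u u.
Proof. by rewrite dotvE sumr_ge0// => k _; rewrite -expr2 sqr_ge0. Qed.

Lemma dotv_eq0 n (u : 'cV[R]_n) : dotv u u = 0 -> u = 0.
Proof.
rewrite dotvE => /eqP; rewrite psumr_eq0 => [/allP H|k _]; last first.
  by rewrite -expr2 sqr_ge0.
apply/colP => k; rewrite mxE; apply/eqP.
by have := H k (mem_index_enum _); rewrite -expr2 sqrf_eq0.
Qed.

Lemma dotv_col m p (a c : 'cV[R]_m) (b d : 'cV[R]_p) :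
  dotv (col_mx a b) (col_mx c d) = dotv a c + dotv b d.
Proof. by rewrite /dotv tr_col_mx mul_row_col mxE. Qed.

Lemma dotv_diag n (d : 'rV[R]_n) (u : 'cV[R]_n) :
  dotv u (diag_mx d *m u) = \sum_k d 0 k * u k 0 ^+ 2.
Proof.
rewrite dotvE; apply: eq_bigr => k _.
by rewrite mul_diag_mx mxE expr2 mulrCA.
Qed.

(** A crude operator bound: each entry of [A *m u] is at most the sum of the moduli in its row times
    the norm of [u]. The added 1 keeps the constant positive when [A] is zero. *)
Lemma dotv_mulmx_le n k (A : 'M[R]_(k, n)) : exists2 C : R, 0 < C &
  forall u : 'cV[R]_n, dotv (A *m u) (A *m u) <= C * dotv u u.
Proof.
exists (1 + \sum_i (\sum_j `|A i j|) ^+ 2).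
  by rewrite ltr_pwDl// sumr_ge0// => i _; rewrite sqr_ge0.
move=> u; rewrite mulrDl mul1r ler_wpDl ?dotv_ge0// [leLHS]dotvE mulr_suml.
apply: ler_sum => i _.
set r := Num.sqrt (dotv u u).
have ur j : `|u j 0| <= r.
  rewrite -sqrtr_sqr ler_wsqrtr// dotvE (bigD1 j)//= -expr2 lerDl sumr_ge0// => l _.
  by rewrite -expr2 sqr_ge0.
have r2 : dotv u u = r ^+ 2 by rewrite sqr_sqrtr// dotv_ge0.
have Au : `|(A *m u) i 0| <= (\sum_j `|A i j|) * r.
  rewrite mxE (le_trans (ler_norm_sum _ _ _))// mulr_suml.
  by apply: ler_sum => j _; rewrite normrM ler_wpM2l.
rewrite -expr2 r2 -exprMn -real_normK ?num_real//.
by rewrite lerXn2r ?nnegrE// (le_trans _ Au).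
Qed.

Lemma loewner_dotv n (A B : 'M[R]_n) (u : 'cV[R]_n) :
  loewner_le A B -> dotv u (A *m u) <= dotv u (B *m u).
Proof. by move=> [_ /(_ u)]; rewrite mulmxBl dotvBr subr_ge0. Qed.

Lemma posdef_diag_gt0 n (A : 'M[R]_n) (k : 'I_n) : posdefmx A -> 0 < A k k.
Proof.
move=> [_ /(_ (delta_mx k 0))].
have S (G : 'I_n -> R) : \sum_j (delta_mx k 0 : 'cV[R]_n) j 0 * G j = G k.
  rewrite (bigD1 k)//= mxE !eqxx mul1r big1 ?addr0// => j /negPf jk.
  by rewrite mxE jk mul0r.
rewrite dotvE S mxE; under eq_bigr do rewrite mulrC.
rewrite S; apply; apply/negP => /eqP/matrixP/(_ k 0)/eqP.
by rewrite !mxE !eqxx oner_eq0.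
Qed.

End Dot.

Section Weight.
Context {R : realType} (m p : nat).
Variables (mu : R) (Qm : 'M[R]_m) (Qp : 'M[R]_p).
Hypothesis Qm_diag : is_diag_mx Qm.
Hypothesis Qp_diag : is_diag_mx Qp.

(** The sign opposite to that of the speed, since the first [m] speeds are negative. It is also the
    sign of the exponent in [weight], so one formula [wq] covers the diagonal entries of both
    blocks. *)
Definition wsign (k : 'I_(m + p)) : R := if (k < m)%N then 1 else -1.
Definition wcoef (k : 'I_(m + p)) : R := block_mx Qm 0 0 Qp k k.
Definition wq (k : 'I_(m + p)) (x : R) : R :=
  wcoef k * expR (2 * mu * wsign k * x).

Lemma weightE (x : R) : weight mu Qm Qp x = diag_mx (\row_k wq k x).
Proof.
apply/matrixP => i j; rewrite /weight !mxE/= /wq /wcoef /wsign.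
case: (split_ordP i) => i' ->; case: (split_ordP j) => j' ->.
- rewrite row_mxEl block_mxEul mxE mulr1 eq_lshift; have [<-|ij] := eqVneq i' j'.
    by rewrite mulr1n mulrC.
  by move/is_diag_mxP : Qm_diag => ->//; rewrite mulr0 mulr0n.
- by rewrite row_mxEr mxE eq_lrshift mulr0n.
- by rewrite row_mxEl mxE eq_rlshift mulr0n.
- rewrite row_mxEr block_mxEdr mxE eq_rshift; have [<-|ij] := eqVneq i' j'.
    by rewrite mulr1n mulrC mulrN1 mulNr.
  by move/is_diag_mxP : Qp_diag => ->//; rewrite mulr0 mulr0n.
Qed.

Lemma dotv_weight (x : R) (u : 'cV[R]_(m + p)) :
  dotv u (weight mu Qm Qp x *m u) = \sum_k wq k x * u k 0 * u k 0.
Proof.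
rewrite weightE dotv_diag; apply: eq_bigr => k _.
by rewrite mxE expr2 mulrA.
Qed.

Lemma wcoef_gt0 k : posdefmx Qm -> posdefmx Qp -> 0 < wcoef k.
Proof.
move=> pm pp; rewrite /wcoef; case: (split_ordP k) => j ->.
  by rewrite block_mxEul; exact: posdef_diag_gt0.
by rewrite block_mxEdr; exact: posdef_diag_gt0.
Qed.

Lemma continuous_wq k : continuous (wq k).
Proof.
move=> x; apply: cvgM; first exact: cvg_cst.
apply: (@continuous_comp _ _ _ (fun x => 2 * mu * wsign k * x) expR).
  by apply: cvgM; [exact: cvg_cst|exact: cvg_id].
exact: continuous_expR.
Qed.

Lemma is_derive_wq k (x : R) :
  is_derive x 1 (wq k) (2 * mu * wsign k * wq k x).
Proof.
have dl : is_derive x 1 (fun x : R => 2 * mu * wsign k * x) (2 * mu * wsign k).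
  have := @is_deriveZ _ _ _ _ (2 * mu * wsign k) _ _ _ (is_derive_id x (1 : R)).
  by rewrite /GRing.scale/= mulr1.
have de := @is_derive1_comp _ expR (fun x : R => 2 * mu * wsign k * x) x _ _
  (is_derive_expR (2 * mu * wsign k * x)) dl.
have := @is_deriveZ _ _ _ _ (wcoef k) _ _ _ de.
by move/is_derive_eq; apply; rewrite /wq /GRing.scale/=; ring.
Qed.

End Weight.

(** * The matrix inequalities of a mode, in coordinates *)

Section Mode.
Context {R : realType} (I : finType) (m p : nat).
Variables (sys : switched_system R I m p) (i : I).
Variables (nu mu : R) (Qm : 'M[R]_m) (Qp : 'M[R]_p).
Hypothesis Qm_diag : is_diag_mx Qm.
Hypothesis Qp_diag : is_diag_mx Qp.
Notation q := (wq mu Qm Qp).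
Notation lam := (fun k => speed sys i 0 k).
Notation F := (fun k j => sysF sys i k j).

Lemma speed_neq0 k : speed sys i 0 k != 0.
Proof.
case: (split_ordP k) => j ->.
  by rewrite lt_eqF//; exact: speed_neg.
by rewrite gt_eqF//; exact: speed_pos.
Qed.

Lemma speed_wsign k : speed sys i 0 k * wsign k = - `|speed sys i 0 k|.
Proof.
rewrite /wsign; case: (split_ordP k) => j ->.
  by rewrite ltr0_norm ?opprK ?mulr1//; exact: speed_neg.
by rewrite gtr0_norm ?mulrN1//; exact: speed_pos.
Qed.

(** The weight satisfies q' = 2 mu [wsign] q, and the speed times [wsign] is minus its modulus, so
    the derivative term is the [Lamp] term of the matrix inequality. The two terms in [sysF] are
    transposes of each other and give the same quadratic form, whence the factor 2. *)
Lemma mode_dissipation (x : R) (u : 'I_(m + p) -> R) :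
  (let Q := weight mu Qm Qp in
      loewner_le
        (- (2 * mu) *: (Q x *m Lamp sys i) +
           (sysF sys i)^T *m Q x + Q x *m sysF sys i)
        (- (2 * nu) *: Q x)) ->
  \sum_k (2 * (q k x * u k * \sum_j F k j * u j) +
     lam k * (2 * mu * wsign k * q k x * u k ^+ 2)) <=
  - (2 * nu) * \sum_k q k x * u k * u k.
Proof.
move=> H; pose U : 'cV[R]_(m + p) := \col_k u k.
have := loewner_dotv U H.
rewrite -scalemxAl dotvZr dotv_weight//.
rewrite !mulmxDl !dotvDr -scalemxAl dotvZr -(mulmxA (sysF sys i)^T) -!(mulmxA (weight mu Qm Qp x)).
have -> : \sum_k q k x * U k 0 * U k 0 = \sum_k q k x * u k * u k.
  by apply: eq_bigr => k _; rewrite mxE.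
apply: le_trans; rewrite le_eqVlt; apply/orP; left; apply/eqP.
have E1 : dotv U (weight mu Qm Qp x *m (sysF sys i *m U)) =
    \sum_k q k x * u k * \sum_j F k j * u j.
  rewrite weightE// dotvE; apply: eq_bigr => k _.
  rewrite mul_diag_mx !mxE -mulrA mulrCA; congr (_ * (_ * _)).
  by apply: eq_bigr => j _; rewrite [U _ _]mxE.
have E2 : dotv U ((sysF sys i)^T *m (weight mu Qm Qp x *m U)) =
    \sum_k q k x * u k * \sum_j F k j * u j.
  rewrite -dotv_mulmxl dotvC weightE// dotvE; apply: eq_bigr => k _.
  rewrite mul_diag_mx !mxE; congr (_ * _).
  by apply: eq_bigr => j _; rewrite [U _ _]mxE.
have E3 : dotv U (weight mu Qm Qp x *m (Lamp sys i *m U)) =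
    \sum_k q k x * `|lam k| * u k ^+ 2.
  rewrite weightE// dotvE; apply: eq_bigr => k _.
  by rewrite mul_diag_mx /Lamp mul_diag_mx !mxE; ring.
rewrite E1 E2 E3 big_split/= -mulr_sumr.
have -> : \sum_k lam k * (2 * mu * wsign k * q k x * u k ^+ 2) =
  - (2 * mu) * \sum_k q k x * `|lam k| * u k ^+ 2.
  rewrite mulr_sumr; apply: eq_bigr => k _.
  have -> : lam k * (2 * mu * wsign k * q k x * u k ^+ 2) =
    (lam k * wsign k) * (2 * mu * q k x * u k ^+ 2) by ring.
  by rewrite speed_wsign; ring.
by ring.
Qed.

(* [al] and [be] are the values of the test function at [x = 0] and [x = 1]. *)
Definition adjoint_bc (al be : 'I_(m + p) -> R) : Prop :=
  let A : 'cV[R]_(m + p) := \col_k al k in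
  let B : 'cV[R]_(m + p) := \col_k be k in
  Lamp sys i *m col_mx (usubmx A) (dsubmx B) =
      (sysG sys i)^T *m Lamp sys i *m col_mx (usubmx B) (dsubmx A).

Lemma adjoint_bc0 : adjoint_bc (fun=> 0) (fun=> 0).
Proof.
rewrite /adjoint_bc; set A := \col_k _.
have -> : A = 0 by apply/colP => k; rewrite !mxE.
by rewrite !linear0 col_mx0 !mulmx0.
Qed.

Let Lampi : 'M[R]_(m + p) := diag_mx (\row_k `|speed sys i 0 k|^-1).

Let LampK (u : 'cV[R]_(m + p)) : Lamp sys i *m (Lampi *m u) = u.
Proof.
apply/colP => k; rewrite /Lamp /Lampi !mul_diag_mx !mxE mulrA divff ?mul1r//.
by rewrite normr_eq0 speed_neq0.
Qed.

(** For a test function the values of the negative components at 1 and of the positive components at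
    0 can be prescribed freely, as [kp]; the adjoint condition then determines the remaining ones,
    [eta]. The pairing reduces to that of [Lamp sys i *m kp] with the defect [e] of the boundary
    condition, and since [Lamp] is invertible [kp] can be chosen to make it [dotv e e]. *)
Lemma mode_boundary_condition (u0 u1 : 'cV[R]_(m + p)) :
  (forall al be, adjoint_bc al be ->
     \sum_k lam k * (be k * u1 k 0 - al k * u0 k 0) = 0) ->
  col_mx (usubmx u1) (dsubmx u0) = sysG sys i *m col_mx (usubmx u0) (dsubmx u1).
Proof.
move=> H.
set z := col_mx (usubmx u0) (dsubmx u1); set b := col_mx (usubmx u1) (dsubmx u0).
pose e := b - sysG sys i *m z.
have key (kp : 'cV[R]_(m + p)) : dotv (Lamp sys i *m kp) e = 0.
  pose eta := Lampi *m ((sysG sys i)^T *m (Lamp sys i *m kp)).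
  pose A := col_mx (usubmx eta) (dsubmx kp).
  pose B := col_mx (usubmx kp) (dsubmx eta).
  have bcAB : adjoint_bc (fun k => A k 0) (fun k => B k 0).
    rewrite /adjoint_bc.
    have cE (C : 'cV[R]_(m + p)) : \col_k C k 0 = C by apply/colP => k; rewrite mxE.
    rewrite !cE /A /B !(col_mxKu, col_mxKd) !vsubmxK.
    by rewrite /eta LampK mulmxA.
  have LampE (u w : 'cV[R]_(m + p)) :
      dotv (Lamp sys i *m u) w = \sum_k `|lam k| * u k 0 * w k 0.
    by rewrite dotvE; apply: eq_bigr => k _; rewrite /Lamp mul_diag_mx !mxE.
  have E : \sum_k lam k * (B k 0 * u1 k 0 - A k 0 * u0 k 0) =
      dotv (Lamp sys i *m eta) z - dotv (Lamp sys i *m kp) b.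
    rewrite !LampE -sumrB !big_split_ord/=; congr (_ + _); apply: eq_bigr => j _.
      rewrite /A /B /z /b !col_mxEu !mxE ltr0_norm ?speed_neg//; ring.
    rewrite /A /B /z /b !col_mxEd !mxE gtr0_norm ?speed_pos//; ring.
  have := H _ _ bcAB; rewrite E /eta LampK dotv_mulmxl trmxK /e dotvBr.
  by move=> /subr0_eq ->; rewrite subrr.
have := key (Lampi *m e); rewrite LampK => /dotv_eq0 /subr0_eq.
by [].
Qed.

(** Under the boundary condition all boundary values are determined by the outgoing ones, [z], made
    of u0^- and u1^+: [bdry0] and [bdry1] map [z] to the full vectors at 0 and at 1. The claim is
    the matrix inequality evaluated at [z]. *)
Lemma mode_boundary (u0 u1 : 'I_(m + p) -> R) :
  (let Q := weight mu Qm Qp in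
      loewner_le
        ((bdry0 sys i)^T *m (Q 0 *m Lam sys i) *m bdry0 sys i)
        ((bdry1 sys i)^T *m (Q 1 *m Lam sys i) *m bdry1 sys i)) ->
  (forall al be, adjoint_bc al be -> \sum_k lam k * (be k * u1 k - al k * u0 k) = 0) ->
  \sum_k lam k * (q k 0 * u0 k ^+ 2 - q k 1 * u1 k ^+ 2) <= 0.
Proof.
move=> HQ H.
pose U0 : 'cV[R]_(m + p) := \col_k u0 k; pose U1 : 'cV[R]_(m + p) := \col_k u1 k.
have bcU : col_mx (usubmx U1) (dsubmx U0) =
    sysG sys i *m col_mx (usubmx U0) (dsubmx U1).
  apply: mode_boundary_condition => al be /H H0; rewrite -[RHS]H0.
  by apply: eq_bigr => k _; rewrite !mxE.
pose z := col_mx (usubmx U0) (dsubmx U1).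
move: bcU; rewrite -{1}(submxK (sysG sys i)) mul_block_col => /eq_col_mx[bm bp].
have E0 : bdry0 sys i *m z = U0.
  by rewrite /bdry0 mul_block_col mul1mx mul0mx addr0 -bp vsubmxK.
have E1 : bdry1 sys i *m z = U1.
  by rewrite /bdry1 mul_block_col mul1mx mul0mx add0r -bm vsubmxK.
have := loewner_dotv z HQ.
rewrite -!mulmxA -!dotv_mulmxl E0 E1 -subr_ge0 -oppr_le0 opprB.
have LE x (U : 'cV[R]_(m + p)) : dotv U (weight mu Qm Qp x *m (Lam sys i *m U)) =
    \sum_k lam k * (q k x * U k 0 ^+ 2).
  rewrite weightE// dotvE; apply: eq_bigr => k _.
  by rewrite mul_diag_mx /Lam mul_diag_mx !mxE; ring.
rewrite !LE -sumrB; apply: le_trans; rewrite le_eqVlt; apply/orP; left; apply/eqP.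
by apply: eq_bigr => k _; rewrite !mxE mulrBr.
Qed.

End Mode.

(** * Decay within a mode *)

Section ModeDecay.
Context {R : realType} (I : finType) (m p : nat).
Notation mu_ := (@lebesgue_measure R).
Notation n := (m + p)%N.
Variables (sys : switched_system R I m p).

Lemma mulmx_colE (k l : nat) (A : 'M[R]_(k, l)) (u : 'cV[R]_l) i :
  (A *m u) i 0 = \sum_j A i j * u j 0.
Proof. by rewrite mxE. Qed.

Lemma sqint_mulmx (k l : nat) (A : 'M[R]_(k, l)) (f : R -> 'cV[R]_l) :
  in_L2 f -> forall i, sqint (fun x => (A *m f x) i 0).
Proof.
move=> Lf i; under eq_fun do rewrite mulmx_colE.
by apply: sqint_sum => j; apply: sqintZ; exact: Lf.
Qed.

Lemma integrable_sum_ip (J : Type) (s : seq J) (f g : J -> R -> R) :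
  (forall k, sqint (f k)) -> (forall k, sqint (g k)) ->
  mu_.-integrable `]0, 1[ (EFin \o (fun x => \sum_(k <- s) f k x * g k x)).
Proof.
move=> Lf Lg; elim: s => [|k s IH].
  have := integrable0 mu_ (`]0 : R, 1[%classic : set (measurableTypeR R)).
  by apply: eq_integrable => // x _; rewrite /= big_nil.
have mD : measurable (`]0 : R, 1[%classic : set (measurableTypeR R)).
  exact: measurable_itv.
have := integrableD mD (sqint_integrableM (Lf k) (Lg k)) IH.
by apply: eq_integrable => // x _; rewrite /= big_cons EFinD.
Qed.

Lemma Rintegral_sum_ip (J : Type) (s : seq J) (f g : J -> R -> R) :
  (forall k, sqint (f k)) -> (forall k, sqint (g k)) ->
  \int[mu_]_(x in `]0, 1[) (\sum_(k <- s) f k x * g k x) =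
  \sum_(k <- s) ip (f k) (g k).
Proof.
move=> Lf Lg.
elim: s => [|k s IH].
  rewrite big_nil; under eq_Rintegral do rewrite big_nil.
  by rewrite Rintegral_cst ?mul0r.
under eq_Rintegral do rewrite big_cons.
rewrite RintegralD//= ?big_cons ?IH//; last exact: integrable_sum_ip.
exact: sqint_integrableM.
Qed.

Lemma le_sum_ip (J J' : Type) (s : seq J) (s' : seq J') (f g : J -> R -> R)
    (f' g' : J' -> R -> R) (C : R) :
  (forall k, sqint (f k)) -> (forall k, sqint (g k)) ->
  (forall k, sqint (f' k)) -> (forall k, sqint (g' k)) ->
  (forall x, 0 < x < 1 ->
    \sum_(k <- s) f k x * g k x <= C * \sum_(k <- s') f' k x * g' k x) ->
  \sum_(k <- s) ip (f k) (g k) <= C * \sum_(k <- s') ip (f' k) (g' k).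
Proof.
move=> Lf Lg Lf' Lg' H; rewrite -!Rintegral_sum_ip// -RintegralZl//; last first.
  exact: integrable_sum_ip.
apply: le_Rintegral => //.
- exact: integrable_sum_ip.
- have Lf'' k : sqint (fun x => C * f' k x) by exact: sqintZ.
  have := integrable_sum_ip s' Lf'' Lg'; apply: eq_integrable => // x _ /=.
  by rewrite mulr_sumr; congr (_%:E); apply: eq_bigr => k _; rewrite mulrA.
Qed.

Lemma Rintegral_dotv (l : nat) (u f : R -> 'cV[R]_l) :
  (forall k, sqint (fun x => u x k 0)) -> (forall k, sqint (fun x => f x k 0)) ->
  \int[mu_]_(x in `]0, 1[) dotv (u x) (f x) =
  \sum_k ip (fun x => u x k 0) (fun x => f x k 0).
Proof.
move=> Lu Lf; under eq_Rintegral do rewrite dotvE.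
exact: (@Rintegral_sum_ip _ _ (fun k x => u x k 0) (fun k x => f x k 0)).
Qed.

Lemma ip_le_L2norm (l : nat) (f : R -> 'cV[R]_l) (k : 'I_l) : in_L2 f ->
  ip (fun x => f x k 0) (fun x => f x k 0) <= L2norm f ^+ 2.
Proof.
move=> Lf; rewrite /L2norm Rintegral_dotv// sqr_sqrtr; last first.
  by apply: sumr_ge0 => j _; exact: ip_ge0.
by rewrite (bigD1 k)//= lerDl sumr_ge0// => j _; exact: ip_ge0.
Qed.

Lemma in_L2B (l : nat) (f g : R -> 'cV[R]_l) : in_L2 f -> in_L2 g ->
  in_L2 (fun x => f x - g x).
Proof.
move=> Lf Lg k; suff : sqint (fun x => (f x - g x) k 0) by [].
rewrite (_ : (fun x => _) = (fun x => f x k 0 - g x k 0)); first exact: sqintB.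
by apply/funext => x; rewrite !mxE.
Qed.

Lemma cvg2_sum {T : Type} (G : set_system T) {FG : Filter G} (J : Type) (s : seq J)
    (u : J -> T -> R -> R) (f : J -> R -> R) :
  (forall j t, sqint (u j t)) -> (forall j, sqint (f j)) ->
  (forall j, cvg2 G (u j) (f j)) ->
  cvg2 G (fun t x => \sum_(j <- s) u j t x) (fun x => \sum_(j <- s) f j x).
Proof.
move=> Lu Lf uf; elim: s => [|j s IH].
  have -> : (fun t x => \sum_(j <- [::]) u j t x) = (fun _ : T => fun _ : R => 0).
    by apply/funext => t; apply/funext => x; rewrite big_nil.
  have -> : (fun x => \sum_(j <- [::]) f j x) = (fun _ : R => 0).
    by apply/funext => x; rewrite big_nil.
  by apply: cvg2_cst; exact: sqint_cst.
have -> : (fun t x => \sum_(j <- j :: s) u j t x) =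
    (fun t x => u j t x + \sum_(j <- s) u j t x).
  by apply/funext => t; apply/funext => x; rewrite big_cons.
have -> : (fun x => \sum_(j <- j :: s) f j x) = (fun x => f j x + \sum_(j <- s) f j x).
  by apply/funext => x; rewrite big_cons.
by apply: cvg2D => //; try move=> t; exact: sqint_sum.
Qed.

Definition char_energy (mu : R) (Qm : 'M[R]_m) (Qp : 'M[R]_p) (i : I)
    (f : R -> 'cV[R]_n) : R :=
  let y k x := (sysS sys i *m f x) k 0 in bil (wq mu Qm Qp) y y.

Variables (w : R -> R -> 'cV[R]_n) (i : I) (a T : R).
Hypothesis hw : C0_L2 w.
Hypothesis a0 : 0 <= a.
Hypothesis aT : a <= T.
Hypothesis hweak : forall T', a < T' -> T' <= T ->
  weak_identity sys i a T' (fun t x => sysS sys i *m w t x).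

(* Freezing time outside [a, T] makes the curve continuous on the whole line. *)
Let cl := clamp a T.

Let cl_ge0 s : 0 <= cl s.
Proof. by have /andP[al _] := clamp_itv s aT; exact: le_trans al. Qed.

Let y (s : R) (k : 'I_n) (x : R) := (sysS sys i *m w (cl s) x) k 0.

Let Lw s : in_L2 (w (cl s)). Proof. exact: hw.1. Qed.

Let Ly s k : sqint (y s k). Proof. exact: sqint_mulmx. Qed.

(** Continuity of [w] is only given within the half-line of nonnegative times; clamped times never
    leave it. *)
Let cl_within s : cl t @[t --> s] --> within `[0 : R, +oo[ (nbhs (cl s)).
Proof.
have ccl : continuous cl.
  by apply: (@lipschitz_continuous_comp _ cl id);
    [exact: clamp_lipschitz|move=> x; exact: cvg_id].
move=> P HP.
have HP' : \forall t \near s, `[0 : R, +oo[%classic (cl t) -> P (cl t) by exact: (ccl s _ HP).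
have : \forall t \near s, P (cl t).
  by apply: filterS HP' => t; apply; rewrite /= in_itv/= cl_ge0.
by [].
Qed.

Let cw (j : 'I_n) s : cvg2 (nbhs s) (fun t x => w (cl t) x j 0) (fun x => w (cl s) x j 0).
Proof.
have H := hw.2 (cl s) (cl_ge0 s).
have H2 : L2norm (fun x => w (cl t) x - w (cl s) x) @[t --> s] --> (0 : R).
  exact: cvg_comp (@cl_within s) H.
apply: (@squeeze_cvgr _ _ _ _ (fun=> 0)
  (fun t => L2norm (fun x => w (cl t) x - w (cl s) x) *
            L2norm (fun x => w (cl t) x - w (cl s) x))).
- near=> t; rewrite ip_ge0/= -expr2.
  have := ip_le_L2norm j (in_L2B (Lw t) (Lw s)); apply: le_trans.
  rewrite le_eqVlt; apply/orP; left; apply/eqP.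
  by apply: eq_ip => x _; rewrite !mxE.
- exact: cvg_cst.
- by rewrite -(mulr0 (0 : R)); exact: cvgM.
Unshelve. all: by end_near. Qed.

Let cy k (s : R) : cvg2 (nbhs s) (fun t => y t k) (y s k).
Proof.
have -> : (fun t => y t k) = (fun t x => \sum_j sysS sys i k j * w (cl t) x j 0).
  by apply/funext => t; apply/funext => x; rewrite /y mulmx_colE.
have -> : y s k = (fun x => \sum_j sysS sys i k j * w (cl s) x j 0).
  by apply/funext => x; rewrite /y mulmx_colE.
apply: (@cvg2_sum _ (nbhs s) _ _ _ (fun j t x => sysS sys i k j * w (cl t) x j 0)
  (fun j x => sysS sys i k j * w (cl s) x j 0)).
- by move=> j t; apply: sqintZ; exact: Lw.
- by move=> j; apply: sqintZ; exact: Lw.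
- move=> j; apply: (@cvg2Z _ _ (nbhs s) _ _ (fun t x => w (cl t) x j 0)) => //.
  + by move=> t; exact: Lw.
  + exact: Lw.
Qed.

Let K (phi phi' : 'I_n -> R -> R) (s : R) := \sum_k ip (fun x =>
  speed sys i 0 k * phi' k x + \sum_j sysF sys i j k * phi j x) (y s k).

(** The test functions are extended constantly in time, so their time derivative [Phit] is zero and
    the admissibility condition is the same at every time. *)
Let weak_from_a T' phi phi' : a < T' -> T' <= T -> testfun phi phi' ->
  adjoint_bc sys i (fun k => phi k 0) (fun k => phi k 1) ->
  \sum_k ip (phi k) (y T' k) - \sum_k ip (phi k) (y a k) = tint a T' (K phi phi').
Proof.
move=> aT' T'T tphi bphi.
pose Phi (t x : R) : 'cV[R]_n := \col_k phi k x.
pose Phit (t x : R) : 'cV[R]_n := 0.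
pose Phix (t x : R) : 'cV[R]_n := \col_k phi' k x.
have csnd (f : R -> R) : continuous f -> continuous (fun z : R * R => f z.2).
  by move=> cf z; apply: (@continuous_comp _ _ _ snd f); [exact: cvg_snd|exact: cf].
have C1 : C1_rect a T' Phi Phit Phix.
  move=> k; have [cphi cphi' dphi] := tphi k; split.
  - rewrite (_ : (fun z : R * R => _) = (fun z => phi k z.2)); last first.
      by apply/funext => z; rewrite mxE.
    by apply: continuous_subspaceT; exact: csnd.
  - rewrite (_ : (fun z : R * R => _) = (fun=> 0)); last first.
      by apply/funext => z; rewrite mxE.
    by apply: continuous_subspaceT => z; exact: cvg_cst.
  - rewrite (_ : (fun z : R * R => _) = (fun z => phi' k z.2)); last first.
      by apply/funext => z; rewrite mxE.
    by apply: continuous_subspaceT; exact: csnd.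
  - move=> t x _ x01; split.
      rewrite (_ : (fun s : R => _) = cst (phi k x)); last first.
        by apply/funext => s; rewrite mxE.
      by rewrite mxE; exact: is_derive_cst.
    rewrite (_ : (fun z : R => _) = phi k); last first.
      by apply/funext => z; rewrite mxE.
    by rewrite mxE; exact: dphi.
have := hweak aT' T'T C1 (fun t _ => bphi).
have Lphi t k : sqint (fun x => Phi t x k 0).
  by under eq_fun do rewrite mxE; apply: sqint_continuous; have [] := tphi k.
have clE s : a <= s <= T' -> cl s = s.
  by move=> /andP[as_ sT]; rewrite /cl clamp_id// as_ (le_trans sT T'T).
have DE (s : R) : a <= s <= T' ->
    \int[mu_]_(x in `]0, 1[) dotv (Phi s x) (sysS sys i *m w s x) =
    \sum_k ip (phi k) (y s k).
  move=> sI; rewrite Rintegral_dotv//; last by move=> k; rewrite -(clE s sI); exact: Ly.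
  by apply: eq_bigr => k _; apply: eq_ip => x _; rewrite /y mxE clE.
rewrite !DE ?lexx ?(ltW aT')// => ->.
apply: eq_Rintegral => s; rewrite inE/= in_itv/= => sI.
have cG k : continuous (fun x => speed sys i 0 k * phi' k x + \sum_j sysF sys i j k * phi j x).
  have [cphi cphi' _] := tphi k.
  move=> x; apply: cvgD.
    by apply: cvgM; [exact: cvg_cst|exact: cphi'].
  apply: (@continuous_sum _ _ _ (fun j x => sysF sys i j k * phi j x)) => j z.
  by apply: cvgM; [exact: cvg_cst|have [+ _ _] := tphi j; apply].
have GE x k : (Phit s x + Lam sys i *m Phix s x + (sysF sys i)^T *m Phi s x) k 0 =
    speed sys i 0 k * phi' k x + \sum_j sysF sys i j k * phi j x.
  rewrite [LHS]mxE [X in X + _]mxE /Phit [X in X + _ + _]mxE add0r /Lam mul_diag_mx.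
  rewrite mulmx_colE [X in X + _]mxE [in X in X + _]mxE; congr (_ + _).
  by apply: eq_bigr => j _; rewrite [X in X * _]mxE [Phi _ _ _ _]mxE.
rewrite Rintegral_dotv.
- apply: eq_bigr => k _; apply: eq_ip => x _.
  by rewrite GE /y clE.
- by move=> k; under eq_fun do rewrite GE; exact: sqint_continuous.
- by move=> k; rewrite -(clE s sI); exact: Ly.
Qed.

(** The weak formulation is available only from the starting time [a]; an interval starting later is
    a difference of two such intervals. An end point equal to [a] is treated apart, as the
    formulation requires positive length. *)
Let weak t1 t2 : a <= t1 -> t1 <= t2 -> t2 <= T ->
  forall phi phi', testfun phi phi' ->
  adjoint_bc sys i (fun k => phi k 0) (fun k => phi k 1) ->
  \sum_k ip (phi k) (y t2 k) - \sum_k ip (phi k) (y t1 k) = tint t1 t2 (K phi phi').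
Proof.
move=> at1 t12 t2T phi phi' tphi bphi.
have cK : continuous (K phi phi').
  apply: continuous_sum => k; apply: (@continuous_ip _ (fun s => y s k)) => //.
  apply: sqint_continuous => x; have [cphi cphi' _] := tphi k; apply: cvgD.
    by apply: cvgM; [exact: cvg_cst|exact: cphi'].
  apply: (@continuous_sum _ _ _ (fun j x => sysF sys i j k * phi j x)) => j z.
  by apply: cvgM; [exact: cvg_cst|have [+ _ _] := tphi j; apply].
have H t : a <= t -> t <= T ->
    \sum_k ip (phi k) (y t k) - \sum_k ip (phi k) (y a k) = tint a t (K phi phi').
  rewrite le_eqVlt => /predU1P[<- _|at_ tT]; last exact: weak_from_a.
  by rewrite subrr /tint set_itv1 Rintegral_set1.
have H1 := H t1 at1 (le_trans t12 t2T).
have H2 := H t2 (le_trans at1 t12) t2T.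
have := tint_split cK at1 t12; rewrite -H1 -H2 => E.
have -> : tint t1 t2 (K phi phi') =
  \sum_k ip (phi k) (y t1 k) - \sum_k ip (phi k) (y a k) + tint t1 t2 (K phi phi')
  - (\sum_k ip (phi k) (y t1 k) - \sum_k ip (phi k) (y a k)) by rewrite addrAC subrr add0r.
rewrite -E; move: (\sum_(_ < _) _) (\sum_(_ < _) _) (\sum_(_ < _) _) => *; ring.
Qed.

Variables (nu mu : R) (Qm : 'M[R]_m) (Qp : 'M[R]_p).
Hypothesis nu0 : 0 < nu.
Hypothesis hQm : is_diag_mx Qm /\ posdefmx Qm.
Hypothesis hQp : is_diag_mx Qp /\ posdefmx Qp.
Hypothesis hdecay : forall x : R, 0 <= x <= 1 ->
  let Q := weight mu Qm Qp in
  loewner_le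
    (- (2 * mu) *: (Q x *m Lamp sys i) +
       (sysF sys i)^T *m Q x + Q x *m sysF sys i)
    (- (2 * nu) *: Q x).
Hypothesis hbdry :
  let Q := weight mu Qm Qp in
  loewner_le
    ((bdry0 sys i)^T *m (Q 0 *m Lam sys i) *m bdry0 sys i)
    ((bdry1 sys i)^T *m (Q 1 *m Lam sys i) *m bdry1 sys i).

Lemma wq_ge0 k x : 0 <= wq mu Qm Qp k x.
Proof. by rewrite mulr_ge0 ?expR_ge0// ltW// wcoef_gt0; [|case: hQm|case: hQp]. Qed.

Lemma mode_decay t : a <= t <= T ->
  char_energy mu Qm Qp i (w t) <=
  expR (- (2 * nu * (t - a))) * char_energy mu Qm Qp i (w a).
Proof.
move=> tI; pose f s := fun k x => (sysS sys i *m w s x) k 0; have [Qmd _] := hQm; have [Qpd _] := hQp.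
have := @energy_decay R n (fun k => speed sys i 0 k) (fun k j => sysF sys i k j)
  (@speed_neq0 _ _ _ _ sys i) y Ly cy (adjoint_bc sys i) (adjoint_bc0 sys i) a T weak
  (wq mu Qm Qp) (fun k x => 2 * mu * wsign k * wq mu Qm Qp k x) nu
  (@continuous_wq _ _ _ mu Qm Qp) _ _ _ nu0 _ _ t tI.
have yE s : a <= s <= T -> y s = f s.
  by move=> sI; rewrite /y /cl clamp_id.
rewrite !yE ?lexx//; apply.
- by move=> k x; apply: cvgM; [exact: cvg_cst|exact: continuous_wq].
- by move=> k x _; exact: is_derive_wq.
- by move=> k x _; exact: wq_ge0.
- move=> x u /andP[x0 x1]; apply: mode_dissipation => //.
  by apply: hdecay; rewrite !ltW.
- by move=> u0 u1; exact: mode_boundary.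
Qed.

End ModeDecay.

(** * Energy jumps and equivalence with the norm *)

Section EnergyComparison.
Context {R : realType} (I : finType) (m p : nat).
Notation n := (m + p)%N.
Variables (sys : switched_system R I m p) (mu : I -> R).
Variables (Qm : I -> 'M[R]_m) (Qp : I -> 'M[R]_p).
Hypothesis hQm : forall i, is_diag_mx (Qm i) /\ posdefmx (Qm i).
Hypothesis hQp : forall i, is_diag_mx (Qp i) /\ posdefmx (Qp i).

Notation q i := (wq (mu i) (Qm i) (Qp i)).

Definition energy (i : I) (f : R -> 'cV[R]_n) : R :=
  char_energy sys (mu i) (Qm i) (Qp i) i f.

Let c_gt0 i k : 0 < wcoef (Qm i) (Qp i) k.
Proof. by apply: wcoef_gt0; [case: (hQm i)|case: (hQp i)]. Qed.

Let q_ge0 i k x : 0 <= q i k x.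
Proof. by rewrite mulr_ge0 ?expR_ge0// ltW. Qed.

Let Ly i (f : R -> 'cV[R]_n) : in_L2 f ->
  forall k, sqint (fun x => (sysS sys i *m f x) k 0).
Proof. by move=> Lf k; exact: sqint_mulmx. Qed.

Let Lqy i (f : R -> 'cV[R]_n) : in_L2 f ->
  forall k, sqint (fun x => q i k x * (sysS sys i *m f x) k 0).
Proof. by move=> Lf k; apply: sqintM_continuous; [exact: continuous_wq|exact: Ly]. Qed.

Lemma energy_ge0 i f : in_L2 f -> 0 <= energy i f.
Proof.
by move=> Lf; apply: bil_ge0; [move=> k x _; exact: q_ge0|exact: Ly].
Qed.

Lemma sqr_L2norm (f : R -> 'cV[R]_n) : in_L2 f ->
  L2norm f ^+ 2 = \sum_k ip (fun x => f x k 0) (fun x => f x k 0).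
Proof.
move=> Lf; rewrite /L2norm Rintegral_dotv// sqr_sqrtr//.
by apply: sumr_ge0 => j _; exact: ip_ge0.
Qed.

Let exp_bound (a s x : R) : `|s| = 1 -> 0 < x < 1 ->
  expR (- (2 * `|a|)) <= expR (2 * a * s * x) <= expR (2 * `|a|).
Proof.
move=> s1 /andP[x0 x1]; rewrite !ler_expR -ler_norml !normrM s1 mulr1 (gtr0_norm x0).
by rewrite ger0_norm// ler_piMr ?mulr_ge0// ltW.
Qed.

Let norm_wsign k : `|@wsign R m p k| = 1.
Proof. by rewrite /wsign; case: ifP; rewrite ?normrN1 ?normr1. Qed.

Lemma energy_le_norm i : exists2 C : R, 0 < C &
  forall f, in_L2 f -> energy i f <= C * L2norm f ^+ 2.
Proof.
have [C C0 HC] := dotv_mulmx_le (sysS sys i).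
(* The sum replaces a maximum over the components, and the added 1 makes it positive in every
   dimension. *)
pose B := 1 + \sum_k wcoef (Qm i) (Qp i) k * expR (2 * `|mu i|).
have c0 k : 0 <= wcoef (Qm i) (Qp i) k * expR (2 * `|mu i|).
  by rewrite mulr_ge0 ?expR_ge0// ltW.
have B0 : 0 < B by rewrite ltr_pwDl// sumr_ge0.
exists (B * C); first exact: mulr_gt0.
move=> f Lf; rewrite sqr_L2norm//.
apply: le_sum_ip; [exact: Lqy|exact: Ly|exact: Lf|exact: Lf|].
move=> x x01.
apply: (@le_trans _ _ (B * dotv (sysS sys i *m f x) (sysS sys i *m f x))).
  rewrite dotvE mulr_sumr; apply: ler_sum => k _.
  rewrite -mulrA -expr2 ler_wpM2r ?sqr_ge0//.
  apply: (@le_trans _ _ (wcoef (Qm i) (Qp i) k * expR (2 * `|mu i|))).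
    rewrite /wq ler_wpM2l ?(ltW (c_gt0 i k))//.
    by have /andP[] := exp_bound (mu i) (norm_wsign k) x01.
  by rewrite /B (bigD1 k)//= ler_wpDl// lerDl sumr_ge0.
by rewrite -mulrA ler_wpM2l ?(ltW B0)// (le_trans (HC (f x)))// dotvE.
Qed.

Lemma norm_le_energy i : exists2 C : R, 0 < C &
  forall f, in_L2 f -> L2norm f ^+ 2 <= C * energy i f.
Proof.
have [C C0 HC] := dotv_mulmx_le (invmx (sysS sys i)).
pose B := 1 + \sum_k expR (2 * `|mu i|) / wcoef (Qm i) (Qp i) k.
have c0 k : 0 <= expR (2 * `|mu i|) / wcoef (Qm i) (Qp i) k.
  by rewrite divr_ge0 ?expR_ge0// ltW.
have B0 : 0 < B by rewrite ltr_pwDl// sumr_ge0.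
exists (C * B); first exact: mulr_gt0.
move=> f Lf; rewrite sqr_L2norm//.
apply: le_sum_ip; [exact: Lf|exact: Lf|exact: Lqy|exact: Ly|].
move=> x x01; rewrite -dotvE.
have -> : f x = invmx (sysS sys i) *m (sysS sys i *m f x) by rewrite mulKmx// sysS_unit.
rewrite (le_trans (HC _))// mulKVmx ?sysS_unit//.
rewrite -mulrA ler_wpM2l ?(ltW C0)// dotvE mulr_sumr; apply: ler_sum => k _.
set yk := (_ *m _) k 0.
have ck := c_gt0 i k.
have -> : B * (q i k x * yk * yk) = B * q i k x * yk ^+ 2 by ring.
rewrite -expr2.
rewrite -[leLHS]mul1r ler_wpM2r ?sqr_ge0//.
apply: (@le_trans _ _ (expR (2 * `|mu i|) / wcoef (Qm i) (Qp i) k * q i k x)).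
  rewrite /wq mulrA divfK ?gt_eqF//.
  have /andP[H _] := exp_bound (mu i) (norm_wsign k) x01.
  apply: le_trans (ler_wpM2l (expR_ge0 _) H).
  by rewrite -expRD subrr expR0.
rewrite ler_wpM2r//.
by rewrite /B (bigD1 k)//= ler_wpDl// lerDl sumr_ge0.
Qed.

Let posdef_ge0 l (Q : 'M[R]_l) (u : 'cV[R]_l) : posdefmx Q -> 0 <= dotv u (Q *m u).
Proof.
move=> [_ H]; have [->|u0] := eqVneq u 0; last exact/ltW/H.
by rewrite mulmx0 dotvE big1// => k _; rewrite !mxE mul0r.
Qed.

(** At fixed [x] the two blocks carry exponentials of opposite sign, so they are compared
    separately: the block form costs the factor [gamma], and its exponential at most
    [expR (2 * Delta)] because 0 < x < 1. The factors multiply since the block forms are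
    nonnegative. *)
Lemma energy_jump (gamma Delta : R) i j : 0 <= gamma ->
  `|mu j - mu i| <= Delta ->
  loewner_le ((Sp sys j)^T *m Qp j *m Sp sys j)
             (gamma *: ((Sp sys i)^T *m Qp i *m Sp sys i)) ->
  loewner_le ((Sm sys j)^T *m Qm j *m Sm sys j)
             (gamma *: ((Sm sys i)^T *m Qm i *m Sm sys i)) ->
  forall f, in_L2 f -> energy j f <= gamma * expR (2 * Delta) * energy i f.
Proof.
move=> g0 muD hp hm f Lf.
apply: le_sum_ip; [exact: Lqy|exact: Ly|exact: Lqy|exact: Ly|].
move=> x x01; set v := f x.
have E l : \sum_k q l k x * (sysS sys l *m v) k 0 * (sysS sys l *m v) k 0 =
    expR (2 * mu l * x) * dotv v ((Sm sys l)^T *m Qm l *m Sm sys l *m v) +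
    expR (- (2 * mu l * x)) * dotv v ((Sp sys l)^T *m Qp l *m Sp sys l *m v).
  have [dm _] := hQm l; have [dp _] := hQp l.
  rewrite -(dotv_weight _ dm dp) /weight -[sysS sys l]vsubmxK.
  rewrite -/(Sm sys l) -/(Sp sys l) mul_col_mx mul_block_col !mul0mx addr0 add0r.
  by rewrite dotv_col -!scalemxAl !dotvZr -!mulmxA -!dotv_mulmxl.
rewrite !E.
have Hm := loewner_dotv v hm; have Hp := loewner_dotv v hp.
rewrite -scalemxAl dotvZr in Hm; rewrite -scalemxAl dotvZr in Hp.
have m0 : 0 <= dotv v ((Sm sys i)^T *m Qm i *m Sm sys i *m v).
  by rewrite -!mulmxA -dotv_mulmxl; apply: posdef_ge0; case: (hQm i).
have p0 : 0 <= dotv v ((Sp sys i)^T *m Qp i *m Sp sys i *m v).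
  by rewrite -!mulmxA -dotv_mulmxl; apply: posdef_ge0; case: (hQp i).
have /andP[x0 x1] := x01.
have D0 : 0 <= Delta by exact: le_trans (normr_ge0 _) muD.
have em : expR (2 * mu j * x) <= expR (2 * Delta) * expR (2 * mu i * x).
  rewrite -expRD ler_expR; move: muD; rewrite ler_norml => /andP[_ H].
  by nra.
have ep : expR (- (2 * mu j * x)) <= expR (2 * Delta) * expR (- (2 * mu i * x)).
  rewrite -expRD ler_expR; move: muD; rewrite ler_norml => /andP[H _].
  by nra.
have scale (b c d e : R) : 0 <= e -> b <= c * d -> b * (gamma * e) <= gamma * c * (d * e).
  move=> e0 bcd; have -> : b * (gamma * e) = gamma * e * b by ring.
  have -> : gamma * c * (d * e) = gamma * e * (c * d) by ring.
  by rewrite ler_wpM2l// mulr_ge0.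
rewrite mulrDr; apply: lerD.
  by apply: (le_trans (ler_wpM2l (expR_ge0 _) Hm)); exact: scale.
by apply: (le_trans (ler_wpM2l (expR_ge0 _) Hp)); exact: scale.
Qed.

Lemma sub_le_max_sub_min i j : mu j - mu i <= max_sub_min mu.
Proof.
rewrite /max_sub_min; case: pickP => [i0 _|/(_ i)//].
apply: lerB; first exact: le_bigmax.
exact: bigmin_le.
Qed.

End EnergyComparison.

(** * Switching *)

Section Switching.
Context {R : realType} (I : finType) (m p : nat).
Notation mu_ := (@lebesgue_measure R).
Notation n := (m + p)%N.

Lemma seq_has_min (s : seq R) : s != [::] ->
  exists2 b, b \in s & forall c, c \in s -> b <= c.
Proof.
elim: s => // x s IH _; have [->|s0] := eqVneq s [::].
  by exists x; rewrite ?inE// => c; rewrite inE => /eqP ->.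
have [b bs Hb] := IH s0; have [xb|bx] := leP x b.
  exists x; first by rewrite inE eqxx.
  by move=> c; rewrite inE => /predU1P[->//|/Hb]; exact: le_trans.
exists b; first by rewrite inE bs orbT.
by move=> c; rewrite inE => /predU1P[->|/Hb//]; exact: ltW.
Qed.

Lemma switching_finite (sigma : R -> I) (a t : R) : switching_signal sigma -> 0 <= a ->
  finite_set (switching_times sigma `&` `]a, t]).
Proof.
move=> [_ fin] a0; apply: sub_finite_set (fin t) => s [ss] /=.
rewrite !in_itv/= => /andP[as_ ->]; split => //.
by rewrite (le_trans a0 (ltW as_)).
Qed.

Lemma nb_switch0 (sigma : R -> I) (a t : R) : switching_signal sigma -> 0 <= a ->
  nb_switch sigma a t = 0%N ->
  forall s, a < s <= t -> ~ switching_times sigma s.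
Proof.
move=> sw a0 /eqP; rewrite cardfs_eq0 => /eqP E s ast ss.
have : s \in fset_set (switching_times sigma `&` `]a, t]).
  by rewrite in_fset_set ?inE; [split => //=; rewrite in_itv|exact: switching_finite].
by rewrite E inE.
Qed.

(** Take [b] to be the least switching time in []a, t]]: no switch precedes it, and removing it
    leaves those of []b, t]]. This is the step of the induction on the number of switches. *)
Lemma nb_switchS (sigma : R -> I) (a t : R) (k : nat) : switching_signal sigma -> 0 <= a ->
  nb_switch sigma a t = k.+1 ->
  exists b, [/\ a < b <= t, switching_times sigma b,
    forall s, a < s < b -> ~ switching_times sigma s & nb_switch sigma b t = k].
Proof.
move=> sw a0; rewrite /nb_switch; set A := switching_times sigma `&` _.
have finA : finite_set A by exact: switching_finite.
move=> cA.
have A0 : (fset_set A : seq R) != [::].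
  have /fset0Pn[x xA] : fset_set A != fset0 by rewrite -cardfs_gt0 cA.
  by apply/eqP => E; move: xA; rewrite -[_ \in _]/(x \in (fset_set A : seq R)) E.
have [b bA Hb] := seq_has_min A0.
have [sb ab] : A b by move: bA; rewrite in_fset_set// inE.
move: ab; rewrite /= in_itv/= => abt; have /andP[ab bt] := abt.
exists b; split => //.
  move=> s /andP[as_ sb'] ss.
  have : s \in fset_set A.
    by rewrite in_fset_set// inE; split => //=; rewrite in_itv/= as_ (le_trans (ltW sb') bt).
  by move=> /Hb; rewrite leNgt sb'.
set B := switching_times sigma `&` `]b, t].
have finB : finite_set B by apply: switching_finite => //; rewrite (le_trans a0 (ltW ab)).
have EA : A = b |` B.
  apply/seteqP; split => s /=.
    move=> [ss]; rewrite /= in_itv/= => /andP[as_ st].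
    have : b <= s.
      apply: Hb; rewrite in_fset_set// inE; split => //=.
      by rewrite in_itv/= as_ st.
    by rewrite le_eqVlt => /predU1P[->|bs]; [left|right; split => //=; rewrite in_itv/= bs st].
  move=> [->|[ss]]; first by split => //=; rewrite in_itv.
  rewrite /= in_itv/= => /andP[bs st]; split => //=.
  by rewrite in_itv/= (lt_trans ab bs) st.
move: cA; rewrite EA fset_setU1// cardfsU1.
have -> : b \notin fset_set B.
  by rewrite in_fset_set// notin_setE => -[_]/=; rewrite in_itv/= ltxx.
by rewrite add1n => -[].
Qed.

(** For the initial condition, which a weak solution meets only almost everywhere. *)
Lemma L2norm_ae (f g : R -> 'cV[R]_n) : in_L2 f -> in_L2 g ->
  {ae mu_, forall x, `]0, 1[%classic x -> f x = g x} -> L2norm f = L2norm g.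
Proof.
move=> Lf Lg fg; rewrite /L2norm; congr (Num.sqrt (fine _)).
have mdot (h : R -> 'cV[R]_n) : in_L2 h ->
    measurable_fun (`]0 : R, 1[%classic : set (measurableTypeR R)) (fun x => (dotv (h x) (h x))%:E).
  move=> Lh; have := @integrable_sum_ip _ _ (index_enum 'I_n)
    (fun k x => h x k 0) (fun k x => h x k 0) Lh Lh.
  move=> /(measurable_int mu_).
  by apply: eq_measurable_fun => x _ /=; rewrite dotvE.
apply: ae_eq_integral => //; [exact: mdot|exact: mdot|].
case: fg => N [mN N0 sub]; exists N; split => // x /= nH.
by apply: sub => /= H; apply: nH => Dx; rewrite H.
Qed.

Variables (sys : switched_system R I m p) (nu gamma : R) (mu : I -> R).
Variables (Qm : I -> 'M[R]_m) (Qp : I -> 'M[R]_p).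
Hypothesis hnu : 0 < nu.
Hypothesis hgamma : 1 <= gamma.
Hypothesis hQm : forall i : I, is_diag_mx (Qm i) /\ posdefmx (Qm i).
Hypothesis hQp : forall i : I, is_diag_mx (Qp i) /\ posdefmx (Qp i).
Hypothesis hdecay : forall (i : I) (x : R), 0 <= x <= 1 ->
  let Q := weight (mu i) (Qm i) (Qp i) in
  loewner_le
    (- (2 * mu i) *: (Q x *m Lamp sys i) +
       (sysF sys i)^T *m Q x + Q x *m sysF sys i)
    (- (2 * nu) *: Q x).
Hypothesis hbdry : forall i : I,
  let Q := weight (mu i) (Qm i) (Qp i) in
  loewner_le
    ((bdry0 sys i)^T *m (Q 0 *m Lam sys i) *m bdry0 sys i)
    ((bdry1 sys i)^T *m (Q 1 *m Lam sys i) *m bdry1 sys i).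
Hypothesis hjump_p : forall i j : I,
  loewner_le ((Sp sys i)^T *m Qp i *m Sp sys i)
             (gamma *: ((Sp sys j)^T *m Qp j *m Sp sys j)).
Hypothesis hjump_m : forall i j : I,
  loewner_le ((Sm sys i)^T *m Qm i *m Sm sys i)
             (gamma *: ((Sm sys j)^T *m Qm j *m Sm sys j)).

Notation V := (energy sys mu Qm Qp).
Let K := gamma * expR (2 * max_sub_min mu).

Let jump i j f : in_L2 f -> V j f <= K * V i f.
Proof.
move=> Lf; apply: energy_jump => //.
  exact: le_trans hgamma.
by rewrite ler_norml lerNl opprB !sub_le_max_sub_min.
Qed.

(** Induction on the number of switches, restarting only at 0 or at switching times, where the weak
    formulation is available. The final mode is left existential: the constants that compare its
    energy with the norm will be uniform over the modes. A switch at [t] itself is counted in []a,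
    t]], so its jump is included. *)
Lemma switched_decay (sigma : R -> I) (w0 : R -> 'cV[R]_n) (w : R -> R -> 'cV[R]_n) :
  switching_signal sigma -> weak_solution sys sigma w0 w ->
  forall (k : nat) (a t : R), 0 <= a -> a = 0 \/ switching_times sigma a -> a <= t ->
  nb_switch sigma a t = k ->
  exists i, V i (w t) <= K ^+ k * expR (- (2 * nu * (t - a))) * V (sigma a) (w a).
Proof.
move=> sw [hw _ hweak].
have K0 : 0 <= K by rewrite mulr_ge0 ?expR_ge0// (le_trans _ hgamma).
have step a b : 0 <= a -> a = 0 \/ switching_times sigma a -> a <= b ->
    (forall s, a < s < b -> ~ switching_times sigma s) ->
    V (sigma a) (w b) <= expR (- (2 * nu * (b - a))) * V (sigma a) (w a).
  move=> a0 ha ab nosw; apply: (@mode_decay _ _ _ _ sys w (sigma a) a b) => //.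
  - move=> T' aT' T'b; apply: hweak => // s /andP[as_ sT']; apply: nosw.
    by rewrite as_ (lt_le_trans sT' T'b).
  - exact: hdecay.
  - by rewrite ab lexx.
elim=> [|k IH] a t a0 ha at_ nb.
  exists (sigma a); rewrite expr0 mul1r; apply: step => // s /andP[as_ st].
  by apply: (nb_switch0 sw a0 nb); rewrite as_ ltW.
have [b [/andP[ab bt] sb nosw nbb]] := nb_switchS sw a0 nb.
have b0 : 0 <= b := le_trans a0 (ltW ab).
have [i Hi] := IH b t b0 (or_intror sb) bt nbb.
exists i; apply: (le_trans Hi).
have H1 := step a b a0 ha (ltW ab) nosw.
have H2 := @jump (sigma a) (sigma b) (w b) (hw.1 b b0).
have -> : - (2 * nu * (t - a)) = - (2 * nu * (t - b)) + - (2 * nu * (b - a)) by ring.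
rewrite expRD exprS.
have -> : K * K ^+ k * (expR (- (2 * nu * (t - b))) * expR (- (2 * nu * (b - a)))) *
    V (sigma a) (w a) = K ^+ k * expR (- (2 * nu * (t - b))) *
    (K * (expR (- (2 * nu * (b - a))) * V (sigma a) (w a))) by ring.
rewrite ler_wpM2l ?mulr_ge0 ?exprn_ge0 ?expR_ge0//.
by rewrite (le_trans H2)// ler_wpM2l.
Qed.

Lemma dwell_time_stability (N0 : nat) (tauD : R) : 0 < tauD ->
  ln gamma / (2 * nu) + max_sub_min mu / nu < tauD ->
  GUES sys (@dwell_signals R I tauD N0).
Proof.
move=> tau0 Htau.
have g0 : 0 < gamma by exact: lt_le_trans hgamma.
pose lK := ln gamma + 2 * max_sub_min mu.
have KE : K = expR lK by rewrite /K /lK expRD lnK ?posrE.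
(* Once the number of switches is bounded by N0 + t / tauD, the energy decays at rate 2 nu - ln K /
   tauD; the norm, whose square is comparable to the energy, decays at half this rate. *)
pose rate := nu - lK / (2 * tauD).
have rate0 : 0 < rate.
  rewrite subr_gt0 ltr_pdivrMr ?mulr_gt0// /lK.
  have -> : nu * (2 * tauD) = 2 * nu * tauD by ring.
  have : 2 * nu * (ln gamma / (2 * nu) + max_sub_min mu / nu) < 2 * nu * tauD.
    by rewrite ltr_pM2l// mulr_gt0.
  by apply: le_lt_trans; rewrite le_eqVlt; apply/orP; left; apply/eqP; field; rewrite gt_eqF.
have /choice[C1 HC1] : forall i, exists C : R, 0 < C /\
    forall f, in_L2 f -> V i f <= C * L2norm f ^+ 2.
  by move=> i; have [C C0 HC] := energy_le_norm sys mu hQm hQp i; exists C.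
have /choice[C2 HC2] : forall i, exists C : R, 0 < C /\
    forall f, in_L2 f -> L2norm f ^+ 2 <= C * V i f.
  by move=> i; have [C C0 HC] := norm_le_energy sys mu hQm hQp i; exists C.
(* Sums over the finite set of modes serve as uniform bounds, positive even if the set is empty. *)
pose M1 := 1 + \sum_i C1 i; pose M2 := 1 + \sum_i C2 i.
have C1M i : C1 i <= M1.
  rewrite /M1 (bigD1 i)//= ler_wpDl// lerDl sumr_ge0// => j _.
  by have [/ltW] := HC1 j.
have C2M i : C2 i <= M2.
  rewrite /M2 (bigD1 i)//= ler_wpDl// lerDl sumr_ge0// => j _.
  by have [/ltW] := HC2 j.
have M10 : 0 < M1 by rewrite ltr_pwDl// sumr_ge0// => j _; have [/ltW] := HC1 j.
have M20 : 0 < M2 by rewrite ltr_pwDl// sumr_ge0// => j _; have [/ltW] := HC2 j.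
(* The three factors come from bounding the norm by the energy at time [t], from the [N0] switches
   granted by the chatter bound, and from bounding the initial energy by the norm. *)
pose C := Num.sqrt (M2 * expR (N0%:R * lK) * M1).
have C0 : 0 < C by rewrite sqrtr_gt0 !mulr_gt0// expR_gt0.
exists rate, C; split => // w0 sigma w Lw0 [sw dw] sol t t0.
have [hw hw0 _] := sol.
have -> : L2norm w0 = L2norm (w 0).
  by apply/esym/L2norm_ae => //; exact: hw.1.
have [i Hi] := switched_decay sw sol (lexx 0) (or_introl erefl) t0 erefl.
rewrite subr0 in Hi.
have lK0 : 0 <= lK.
  rewrite addr_ge0 ?ln_ge0// mulr_ge0//.
  by have := sub_le_max_sub_min mu i i; rewrite subrr.
have HK : K ^+ nb_switch sigma 0 t <= expR (N0%:R * lK) * expR (t / tauD * lK).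
  rewrite KE -expRM_natl -expRD ler_expR -mulrDl ler_wpM2r//.
  (* The dwell time bound is only assumed on intervals of positive length; at [t = 0] the interval
     []0, 0]] is empty and contains no switch. *)
  move: t0; rewrite le_eqVlt => /predU1P[<-|t0].
    rewrite mul0r addr0 ler_nat.
    have -> // : nb_switch sigma 0 0 = 0%N.
    rewrite /nb_switch (_ : _ `&` _ = set0) ?fset_set0 ?cardfs0//.
    by rewrite set_itv_ge ?setI0// bnd_simp ltxx.
  by have := dw 0 t (lexx 0) t0; rewrite subr0.
have nn (f : R -> 'cV[R]_n) : 0 <= L2norm f by exact: sqrtr_ge0.
rewrite -(@ler_pXn2r _ 2)// ?nnegrE ?mulr_ge0 ?expR_ge0 ?(ltW C0)//.
have C2E : C ^+ 2 = M2 * expR (N0%:R * lK) * M1.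
  by rewrite sqr_sqrtr// !mulr_ge0 ?expR_ge0 ?(ltW M10) ?(ltW M20).
rewrite !exprMn C2E.
have [_ H2] := HC2 i; have [_ H1] := HC1 (sigma 0).
have L0 := hw.1 0 (lexx 0); have Lt := hw.1 t t0.
have Vi0 := energy_ge0 sys mu hQm hQp i Lt.
have V00 := energy_ge0 sys mu hQm hQp (sigma 0) L0.
apply: (@le_trans _ _ (M2 * V i (w t))).
  by rewrite (le_trans (H2 _ Lt))// ler_wpM2r.
have V0n : V (sigma 0) (w 0) <= M1 * L2norm (w 0) ^+ 2.
  by rewrite (le_trans (H1 _ L0))// ler_wpM2r// sqr_ge0.
have -> : expR (- rate * t) ^+ 2 = expR (t / tauD * lK) * expR (- (2 * nu * t)).
  rewrite -expRM_natl -expRD; congr expR; rewrite /rate.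
  by field; rewrite gt_eqF.
have -> : M2 * expR (N0%:R * lK) * M1 * (expR (t / tauD * lK) * expR (- (2 * nu * t))) *
    L2norm (w 0) ^+ 2 = M2 * (expR (N0%:R * lK) * expR (t / tauD * lK) *
    expR (- (2 * nu * t)) * (M1 * L2norm (w 0) ^+ 2)) by ring.
rewrite ler_wpM2l ?(ltW M20)// (le_trans Hi)//.
apply: ler_pM => //; first by rewrite mulr_ge0 ?exprn_ge0 ?expR_ge0// KE expR_ge0.
by rewrite ler_wpM2r ?expR_ge0.
Qed.

End Switching.

Theorem theorem2 (R : realType) (I : finType) (m p : nat)
    (sys : switched_system R I m p)
    (nu gamma : R) (mu : I -> R) (Qm : I -> 'M[R]_m) (Qp : I -> 'M[R]_p)
    (hnu : 0 < nu) (hgamma : 1 <= gamma)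
    (hQm : forall i : I, is_diag_mx (Qm i) /\ posdefmx (Qm i))
    (hQp : forall i : I, is_diag_mx (Qp i) /\ posdefmx (Qp i))
    (hdecay : forall (i : I) (x : R), 0 <= x <= 1 ->
      let Q := weight (mu i) (Qm i) (Qp i) in
      loewner_le
        (- (2 * mu i) *: (Q x *m Lamp sys i) +
           (sysF sys i)^T *m Q x + Q x *m sysF sys i)
        (- (2 * nu) *: Q x))
    (hbdry : forall i : I,
      let Q := weight (mu i) (Qm i) (Qp i) in
      loewner_le
        ((bdry0 sys i)^T *m (Q 0 *m Lam sys i) *m bdry0 sys i)
        ((bdry1 sys i)^T *m (Q 1 *m Lam sys i) *m bdry1 sys i))
    (hjump_p : forall i j : I,
      loewner_le ((Sp sys i)^T *m Qp i *m Sp sys i)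
                 (gamma *: ((Sp sys j)^T *m Qp j *m Sp sys j)))
    (hjump_m : forall i j : I,
      loewner_le ((Sm sys i)^T *m Qm i *m Sm sys i)
                 (gamma *: ((Sm sys j)^T *m Qm j *m Sm sys j))) :
  forall (N0 : nat) (tauD : R), 0 < tauD ->
    ln gamma / (2 * nu) + max_sub_min mu / nu < tauD ->
    GUES sys (@dwell_signals R I tauD N0).
Proof. by move=> N0 tauD; apply: dwell_time_stability. Qed.
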